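(* Let $u>0$ and let $K\subset\mathbb Z^d$ be finite and nonempty. Let $N_K$ be a Poisson random variable with parameter $u\cdot\mathrm{BCap}(K)$, and let $(X^j)_{j\ge1}$ be i.i.d. branching random walks with $m_K$ as the initial measure, independent of $N_K$. Then $K\cap\left(\bigcup_{j=1}^{N_K}\mathrm{Range}(X^j)\right)$ has the same distribution as $\mathcal I^u\cap K$, where $\mathcal I^u$ is the branching interlacement at level $u$.
   Context: Setting: $d\ge 5$; $\mathbb N=\{0,1,2,\dots\}$. $\mu$ is a probability measure on $\mathbb N$ with mean one and finite variance, not the Dirac mass at $1$. $\theta$ is a probability measure on $\mathbb Z^d$ with mean zero and finite range (finite support), not supported on any strict subgroup of $\mathbb Z^d$. The size-biased law is $\tilde\mu(k)=k\mu(k)$. Branching capacity. Let $\mathbf T^{\mathrm v}$ be the following random infinite plane (rooted ordered) tree, in which every non-root vertex is normal or special. The root produces $i\ge 1$ children with probability $\mu(i-1)$; the last child is special, the others are normal. A normal vertex produces only normal children, their number having law $\mu$. A special vertex produces a number of children with law $\tilde\mu$; one of them, chosen uniformly at random, is special, the others are normal. All choices are independent. The infinite path formed by the root and the special vertices is the spine. The past of the root is the set of vertices $v$ such that, for some non-root spine vertex $s$ with next spine vertex (special child) $s'$, either $v=s$ or $v$ is a descendant of (or equal to) a child of $s$ that comes after $s'$ in the order of the children of $s$. The random walk indexed by $\mathbf T^{\mathrm v}$ started at $x\in\mathbb Z^d$ is the random map $\mathcal S:\mathbf T^{\mathrm v}\to\mathbb Z^d$ with $\mathcal S(\text{root})=x$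 and, conditionally on the tree, independent $\theta$-distributed increments $\mathcal S(v_2)-\mathcal S(v_1)$ along the oriented edges $(v_1,v_2)$; spine edges are oriented from child to parent, all other edges from parent to child. For finite $K\subset\mathbb Z^d$ and $x\in K$, $\mathrm{Es}_K(x)$ is the probability that no vertex of the past of the root is mapped into $K$ when the walk is started at $x$; and $\mathrm{BCap}(K)=\sum_{x\in K}\mathrm{Es}_K(x)$. Branching interlacement: $\mathcal I^u$ is a random subset of $\mathbb Z^d$ whose law is the unique one satisfying $P[\mathcal I^u\cap K=\emptyset]=\exp(-u\,\mathrm{BCap}(K))$ for every finite $K\subset\mathbb Z^d$. Branching harmonic measure $m_K$ ($K$ finite, nonempty). Choose $x\in K$ with probability $\mathrm{Es}_K(x)/\mathrm{BCap}(K)$ and, given $x$, let $(T,\mathcal S)$ be the random walk indexed by $\mathbf T^{\mathrm v}$ started at $x$, conditioned on the event that no vertex of the past of the root is mapped into $K$. Each vertex $v$ of $T$ is the starting point of a unique infinite simple path in $T$; say that $v$ enters $K$ if $\mathcal S(v)\in K$ and $\mathcal S(v')\notin K$ for every other vertex $v'$ of that path. The entering measure is the finite point measure $\sum_{v\text{ enters }K}\delta_{\mathcal S(v)}$ on $K$, and $m_K$ is its law (a probability law on finite point measures on $K$). Branching random walk with initial measure $m_K$: sample a point measure $\sum_i\delta_{x_i}$ from $m_K$ and, given it, attach to each atom $x_i$ an independent random walk indexed by an unconditioned Galton–Watson tree with offspring law $\mu$, root mapped to $x_i$, with independent $\theta$-distributed increments from parent to child. $\mathrm{Range}(X^j)$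 is the set of all sites visited by all these walks. *)

(* Defs.v *)
From HB Require Import structures.
From mathcomp Require Import all_boot all_order all_algebra finmap.
From mathcomp Require Import all_classical all_reals all_analysis.

Set Implicit Arguments.
Unset Strict Implicit.
Unset Printing Implicit Defensive.

Import Order.TTheory GRing.Theory Num.Theory.

Local Open Scope classical_set_scope.
Local Open Scope ring_scope.
Local Open Scope ereal_scope.

Notation site d := 'rV[int]_d.

(* Plane trees use Ulam-Harris labels: the root is [::] and the children of v
   are rcons v 0, rcons v 1, ... in this order. *)
Notation vertex := (seq nat).

(* The (countable) target E carries its discrete sigma-algebra. *)
Definition has_law dO (Om : measurableType dO) (R : realType)
    (P : probability Om R) (E : Type) (X : Om -> E) (p : E -> R) : Prop :=
  (forall B : set E, measurable (X @^-1` B)) /\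
  (forall a : E, P (X @^-1` [set a]) = (p a)%:E).

Definition events_of (Om E : Type) (X : Om -> E) : set (set Om) :=
  [set X @^-1` B | B in [set: set E]].

Definition mutually_independent dO (Om : measurableType dO) (R : realType)
    (P : probability Om R) (I : choiceType) (F : I -> set (set Om)) : Prop :=
  forall (J : {fset I}) (A : I -> set Om), (forall i, i \in J -> F i (A i)) ->
    P (\bigcap_(i in [set` J]) A i) = \prod_(i <- J) P (A i).

Definition cond_prob dO (Om : measurableType dO) (R : realType)
    (P : probability Om R) (A B : set Om) : R :=
  (fine (P (A `&` B)) / fine (P B))%R.

Definition mass (R : realType) (mu : probability nat R) (k : nat) : R :=
  fine (mu [set k]).

Definition critical_offspring (R : realType) (mu : probability nat R) : Prop :=
  [/\ 'E_mu[fun k : nat => k%:R%R] = 1,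
      'V_mu[fun k : nat => k%:R%R] < +oo
    & (mu : set nat -> \bar R) <> \d_(1%N)].

Definition size_biased (R : realType) (mu : probability nat R) (k : nat) : R :=
  (k%:R * mass mu k)%R.

Definition step_distribution (R : realType) (d : nat)
    (theta : {fsfun site d -> R with 0%R}) : Prop :=
  [/\ forall z, (0 <= theta z)%R,
      (\sum_(z <- finsupp theta) theta z = 1)%R,
      forall i : 'I_d, (\sum_(z <- finsupp theta) theta z * (z ord0 i)%:~R = 0)%R
    & forall H : {pred site d}, GRing.zmod_closed H ->
        {subset finsupp theta <= H} -> H =i predT].

Definition in_tree (c : vertex -> nat) (v : vertex) : Prop :=
  forall k, (k < size v)%N -> (nth 0 v k < c (take k v))%N.

(* inc w is the displacement from the parent of w to w. *)
Definition position (d : nat) (x : site d) (inc : vertex -> site d)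
    (v : vertex) : site d :=
  (x + \sum_(1 <= k < (size v).+1) inc (take k v))%R.

(* gw_nchild v is the number of children of v, gw_step v the increment along
   the edge from the parent of v to v. *)
Record gw_walk (d : nat) := GWWalk {
  gw_nchild : vertex -> nat;
  gw_step : vertex -> site d
}.

Definition gw_range (d : nat) (W : gw_walk d) (x : site d) : set (site d) :=
  [set position x (gw_step W) v | v in in_tree (gw_nchild W)].

(* vspine n = (a, b) when the n-th spine vertex has a children before and b
   children after its special child, i.e. a + b + 1 children in all, of which
   the one with index a is the next spine vertex; vnchild is used for the
   normal vertices only; vstep v is the increment along the oriented edge
   between v and its parent. *)
Record vtree_walk (d : nat) := VTreeWalk {
  vnchild : vertex -> nat;
  vspine : nat -> nat * nat;
  vstep : vertex -> site d
}.

Definition spine_vertex (d : nat) (W : vtree_walk d) (n : nat) : vertex :=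
  [seq (vspine W i).1 | i <- iota 0 n].

Definition on_spine (d : nat) (W : vtree_walk d) (v : vertex) : bool :=
  v == spine_vertex W (size v).

Definition vtree (d : nat) (W : vtree_walk d) : set vertex :=
  in_tree (fun v =>
    if on_spine W v
    then ((vspine W (size v)).1 + (vspine W (size v)).2).+1
    else vnchild W v).

(* Spine edges are oriented from child to parent, hence the sign. *)
Definition vposition (d : nat) (W : vtree_walk d) (x : site d) :
    vertex -> site d :=
  position x (fun v => if on_spine W v then (- vstep W v)%R else vstep W v).

Definition past (d : nat) (W : vtree_walk d) : set vertex :=
  [set v | vtree W v /\ exists2 n, (0 < n)%N &
    v = spine_vertex W n \/
    exists2 j, ((vspine W n).1 < j)%N & prefix (rcons (spine_vertex W n) j) v].

Definition adjacent (v w : vertex) : Prop :=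
  exists j, w = rcons v j \/ v = rcons w j.

Definition infinite_simple_path (T : set vertex) (v : vertex)
    (p : nat -> vertex) : Prop :=
  [/\ p 0%N = v, forall i, T (p i), forall i, adjacent (p i) (p i.+1)
    & injective p].

Definition enters (d : nat) (W : vtree_walk d) (x : site d)
    (K : {fset site d}) (v : vertex) : Prop :=
  [/\ vtree W v, vposition W x v \in K &
      exists2 p, unique (infinite_simple_path (vtree W) v) p &
        forall i, vposition W x (p i.+1) \notin K].

(* The root has i children with probability mu (i - 1), the last one special; a
   special vertex has k children with probability size_biased mu k and, given
   k, its special child is uniform among them. *)
Definition spine_pmf (R : realType) (mu : probability nat R) (n : nat)
    (ab : nat * nat) : R :=
  let k := (ab.1 + ab.2).+1 in
  if n is 0%N then (if ab.2 == 0%N then mass mu k.-1 else 0%R)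
  else (size_biased mu k * k%:R^-1)%R.

Definition is_vtree_walk (R : realType) (d : nat) (mu : probability nat R)
    (theta : {fsfun site d -> R with 0%R})
    dO (Om : measurableType dO) (P : probability Om R)
    (W : Om -> vtree_walk d) : Prop :=
  [/\ forall v, has_law P (fun w => vnchild (W w) v) (mass mu),
      forall n, has_law P (fun w => vspine (W w) n) (spine_pmf mu n),
      forall v, has_law P (fun w => vstep (W w) v) theta
    & @mutually_independent _ _ _ P (vertex + nat + vertex)%type (fun i =>
        match i with
        | inl (inl v) => events_of (fun w => vnchild (W w) v)
        | inl (inr n) => events_of (fun w => vspine (W w) n)
        | inr v => events_of (fun w => vstep (W w) v)
        end)].

Definition past_avoids (d : nat) (Om : Type) (W : Om -> vtree_walk d)
    (K : {fset site d}) (x : site d) : set Om :=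
  [set w | forall v, past (W w) v -> vposition (W w) x v \notin K].

Definition Es (R : realType) (d : nat) dO (Om : measurableType dO)
    (P : probability Om R) (W : Om -> vtree_walk d)
    (K : {fset site d}) (x : site d) : R :=
  fine (P (past_avoids W K x)).

Definition BCap (R : realType) (d : nat) dO (Om : measurableType dO)
    (P : probability Om R) (W : Om -> vtree_walk d) (K : {fset site d}) : R :=
  (\sum_(x <- K) Es P W K x)%R.

Definition is_branching_interlacement (R : realType) (d : nat)
    (bcap : {fset site d} -> R) (u : R) dO (Om : measurableType dO)
    (P : probability Om R) (I : Om -> set (site d)) : Prop :=
  (forall z, measurable [set w | I w z]) /\
  (forall K : {fset site d},
     P [set w | I w `&` [set` K] = set0] = (expR (- (u * bcap K)))%:E).

(* A finite point measure on K is represented by its multiplicities. *)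
Notation point_measure K := {ffun K -> nat}.

Definition entering_measure_is (d : nat) (Om : Type) (W : Om -> vtree_walk d)
    (K : {fset site d}) (x : site d) (m : point_measure K) : set Om :=
  [set w | forall y : K,
     ([set v | enters (W w) x K v /\ vposition (W w) x v = val y]
        #= `I_(m y))%card].

(* Probability mass function of the law m_K. *)
Definition harmonic_measure (R : realType) (d : nat) dO (Om : measurableType dO)
    (P : probability Om R) (W : Om -> vtree_walk d) (K : {fset site d})
    (m : point_measure K) : R :=
  (\sum_(x <- K) Es P W K x / BCap P W K *
     cond_prob P (entering_measure_is W x m) (past_avoids W K x))%R.

(* The walk attached to the i-th atom at y, for i < initial y, is walk_at y i;
   the walk_at y i with i >= initial y play no role. *)
Record brw (d : nat) (K : {fset site d}) := BRW {
  initial : point_measure K;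
  walk_at : K -> nat -> gw_walk d
}.

Definition brw_range (d : nat) (K : {fset site d}) (X : brw K) :
    set (site d) :=
  [set z | exists (y : K) (i : nat),
     (i < initial X y)%N /\ gw_range (walk_at X y i) (val y) z].

Definition indep_poisson_iid_brw (R : realType) (d : nat)
    (mu : probability nat R) (theta : {fsfun site d -> R with 0%R})
    (K : {fset site d}) (mK : point_measure K -> R) (rate : R)
    dO (Om : measurableType dO) (P : probability Om R)
    (N : Om -> nat) (X : nat -> Om -> brw K) : Prop :=
  [/\ has_law P N (poisson_pmf rate),
      forall j, has_law P (fun w => initial (X j w)) mK,
      forall j y i v,
        has_law P (fun w => gw_nchild (walk_at (X j w) y i) v) (mass mu),
      forall j y i v,
        has_law P (fun w => gw_step (walk_at (X j w) y i) v) theta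
    & @mutually_independent _ _ _ P
        (unit + nat + nat * K * nat * vertex + nat * K * nat * vertex)%type
        (fun s => match s with
         | inl (inl (inl _)) => events_of N
         | inl (inl (inr j)) => events_of (fun w => initial (X j w))
         | inl (inr (j, y, i, v)) =>
             events_of (fun w => gw_nchild (walk_at (X j w) y i) v)
         | inr (j, y, i, v) =>
             events_of (fun w => gw_step (walk_at (X j w) y i) v)
         end)].

(* Main.v *)
(* For B a subset of K, let g_B(y) be the probability that a walk indexed by an
   unconditioned Galton-Watson tree and started at y avoids B, and for a function
   r with values in [0, 1] let e_r(x) be the probability that the reversed
   theta-walk started at x, killed at each y with probability 1 - r(y), survives
   forever.  Decomposing the past along the spine gives Es_K = e_{r_K}, where r_K
   vanishes on K and is outside K the probability that the later subtrees of a
   spine vertex avoid K.  When the past avoids K, the vertices entering K are the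
   root and the first visits to K in the subtrees hanging off before the spine;
   weighting each of them by g_B replaces r_K by a rate r_{K,B}, so that
     BCap(K) (1 - E_{m_K} prod g_B) = sum_{x in K} (e_{r_K} - g_B e_{r_{K,B}})(x).
   Duality between the walk and its reversal shows that the right-hand side is
   sum_{x in B} e_{r_B}(x) = BCap(B).  Hence the Poissonian cloud misses B with
   probability exp(- u BCap(B)), as the interlacement does, and the law of a
   random subset of K is determined by such probabilities.  That m_K has total
   mass one forces BCap(K) > 0 and the finiteness of the entering measure. *)

Require Import Defs.
From HB Require Import structures.
From mathcomp Require Import all_boot all_order all_algebra finmap.
From mathcomp Require Import all_classical all_reals all_analysis.
From mathcomp Require Import measurable_realfun.
From mathcomp Require Import ring lra zify.

Set Implicit Arguments.
Unset Strict Implicit.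
Unset Printing Implicit Defensive.

Import Order.TTheory GRing.Theory Num.Theory numFieldNormedType.Exports.
Local Open Scope classical_set_scope.
Local Open Scope ring_scope.

(** The offspring law acts through its generating function f and the divided differences of f:
    [bush_gf] at p, q is (f(q) - f(p)) / (q - p). Freezing such a quotient as a rate makes the
    nonlinear equations of avoidance probabilities linear: with Q the step operator, 1 - g_B solves
    h = 1_B + r_B Q h, and g_B - g_K solves h = 1_K g_B + r_{K,B} Q h. Both are thus Green
    potentials of killed walks, and adjointness turns differences of escape probabilities into
    pairings of these potentials with multiples of the same function e_{r_K}. Off K the two pairings
    agree by the symmetry of the second divided difference of f at Q g_K, Q g_B and 1. The obstacle
    is convergence. The Green series converge because their remainders are below the probability
    that a critical tree reaches depth n. On the other side, e_{r_K} must tend to e_{r_B} under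
    iteration with the larger rate r_B, so the chance of being killed by r_K must be dominated by
    that of being killed by r_B. The constant in this domination comes from the finiteness of K and
    from irreducibility of the semigroup generated by the steps, which is derived from their mean
    being zero. *)

(** * Means of bounded functions under probability mass functions *)

Definition is_pmf (R : realType) (E : choiceType) (p : E -> R) : Prop :=
  (forall e, 0 <= p e) /\ \esum_(e in [set: E]) (p e)%:E = 1%E.

(** [fine] turns an infinite sum into 0, so most rules below assume [bounded_ge0]. *)
Definition pmf_mean (R : realType) (E : choiceType) (p f : E -> R) : R :=
  fine (\esum_(e in [set: E]) (p e * f e)%:E).

Definition bounded_ge0 (R : realType) (E : Type) (f : E -> R) : Prop :=
  exists C : R, forall e, 0 <= f e <= C.

Section PmfMean.
Variables (R : realType) (E : choiceType) (p : E -> R).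
Hypothesis hp : is_pmf p.
Implicit Types f g : E -> R.

Lemma esum_pmfZ (C : R) : 0 <= C -> \esum_(e in [set: E]) (p e * C)%:E = C%:E.
Proof.
move=> C0; case: hp => p0 p1.
have h D : 0 <= D -> (\esum_(e in [set: E]) (p e * D)%:E <= D%:E)%E.
  move=> D0; apply: ge_ereal_sup => _ [X [finX XI]] <-.
  have -> : (\sum_(e \in X) (p e * D)%:E = D%:E * \sum_(e \in X) (p e)%:E)%E.
    rewrite ge0_mule_fsumr; last by move=> e; rewrite lee_fin.
    by apply: eq_fsbigr => e _; rewrite -EFinM mulrC.
  rewrite -[leRHS]mule1; apply: lee_pmul => //; first by apply: fsume_ge0 => e _; rewrite lee_fin.
  by rewrite -p1; apply: ereal_sup_ubound; exists X.
apply/eqP; rewrite eq_le h//=.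
have [<-|Cn0] := eqVneq 0 C.
  by apply: esum_ge0 => e _; rewrite mulr0.
have {}C0 : 0 < C by rewrite lt_def eq_sym Cn0.
rewrite -[leLHS]mule1 -p1 -lee_pdivlMl//.
apply: ge_ereal_sup => _ [X [finX XI]] <-.
rewrite lee_pdivlMl//.
have -> : (C%:E * \sum_(e \in X) (p e)%:E = \sum_(e \in X) (p e * C)%:E)%E.
  rewrite ge0_mule_fsumr; last by move=> e; rewrite lee_fin.
  by apply: eq_fsbigr => e _; rewrite -EFinM mulrC.
by apply: ereal_sup_ubound; exists X.
Qed.

Lemma pmf_meanE f : bounded_ge0 f ->
  \esum_(e in [set: E]) (p e * f e)%:E = (pmf_mean p f)%:E.
Proof.
move=> [C hC]; rewrite /pmf_mean fineK//.
rewrite ge0_fin_numE; last first.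
  apply: esum_ge0 => e _; rewrite lee_fin; apply: mulr_ge0; first exact: hp.1.
  by have /andP[] := hC e.
have h0 : 0 <= `|C| by [].
apply: (@le_lt_trans _ _ (`|C|%:E)); last exact: ltry.
rewrite -(esum_pmfZ h0); apply: le_esum => e _; rewrite lee_fin.
apply: ler_wpM2l; first exact: hp.1.
by have /andP[_ h] := hC e; rewrite (le_trans h)// ler_norm.
Qed.

Lemma bounded_ge0_01 f : (forall e, 0 <= f e <= 1) -> bounded_ge0 f.
Proof. by exists 1. Qed.

Lemma bounded_ge0D f g : bounded_ge0 f -> bounded_ge0 g ->
  bounded_ge0 (fun e => f e + g e).
Proof.
move=> [C hC] [D hD]; exists (C + D) => e.
by have := hC e; have := hD e; lra.
Qed.

Lemma bounded_ge0Z (c : R) f : 0 <= c -> bounded_ge0 f ->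
  bounded_ge0 (fun e => c * f e).
Proof.
move=> c0 [C hC]; exists (c * C) => e.
have /andP[h1 h2] := hC e.
by rewrite mulr_ge0//= ler_wpM2l.
Qed.

Lemma pmf_mean_ge0 f : (forall e, 0 <= f e) -> 0 <= pmf_mean p f.
Proof.
move=> f0; rewrite /pmf_mean fine_ge0// esum_ge0// => e _.
by rewrite lee_fin mulr_ge0// hp.1.
Qed.

Lemma pmf_meanD f g : bounded_ge0 f -> bounded_ge0 g ->
  pmf_mean p (fun e => f e + g e) = pmf_mean p f + pmf_mean p g.
Proof.
move=> hf hg; apply: EFin_inj; rewrite -pmf_meanE; last exact: bounded_ge0D.
rewrite EFinD -!pmf_meanE// -esumD.
- by apply: eq_esum => e _; rewrite -EFinD mulrDr.
- case: hf => C hC e _; rewrite lee_fin mulr_ge0 ?(hp.1)//.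
  by have /andP[] := hC e.
- case: hg => C hC e _; rewrite lee_fin mulr_ge0 ?(hp.1)//.
  by have /andP[] := hC e.
Qed.

Lemma pmf_mean_cst (c : R) : 0 <= c -> pmf_mean p (fun=> c) = c.
Proof. by move=> c0; rewrite /pmf_mean esum_pmfZ. Qed.

Lemma eq_pmf_mean f g : f =1 g -> pmf_mean p f = pmf_mean p g.
Proof. by move=> /funext ->. Qed.

Lemma le_pmf_mean f g : bounded_ge0 f -> bounded_ge0 g ->
  (forall e, f e <= g e) -> pmf_mean p f <= pmf_mean p g.
Proof.
move=> hf hg fg; rewrite -lee_fin -!pmf_meanE//.
apply: le_esum => e _; rewrite lee_fin ler_wpM2l// hp.1//.
Qed.

Lemma pmf_meanZ (c : R) f : 0 <= c -> bounded_ge0 f ->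
  pmf_mean p (fun e => c * f e) = c * pmf_mean p f.
Proof.
move=> c0 hf.
have [->|cn0] := eqVneq c 0.
  rewrite mul0r -[RHS](pmf_mean_cst (lexx 0)).
  by apply: eq_pmf_mean => e; rewrite mul0r.
have f0 e : 0 <= f e by case: hf => C /(_ e) /andP[].
apply: EFin_inj; rewrite -pmf_meanE; last exact: bounded_ge0Z.
rewrite EFinM -pmf_meanE//.
have h (b : R) g : 0 <= b -> (forall e, 0 <= g e) ->
    (\esum_(e in [set: E]) (p e * (b * g e))%:E <=
     b%:E * \esum_(e in [set: E]) (p e * g e)%:E)%E.
  move=> b0 g0; apply: ge_ereal_sup => _ [X [finX XI]] <-.
  have -> : (\sum_(e \in X) (p e * (b * g e))%:E =
     b%:E * \sum_(e \in X) (p e * g e)%:E)%E.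
    rewrite ge0_mule_fsumr; last by move=> e; rewrite lee_fin mulr_ge0// hp.1.
    by apply: eq_fsbigr => e _; rewrite -EFinM mulrCA.
  by rewrite lee_wpmul2l//; apply: ereal_sup_ubound; exists X.
apply/eqP; rewrite eq_le h//=.
rewrite -lee_pdivlMl ?lt_def ?cn0//.
apply: (le_trans _ (h c^-1 (fun e => c * f e) _ _)).
- by apply: le_esum => e _; rewrite mulKf.
- by rewrite invr_ge0.
- by move=> e; rewrite mulr_ge0.
Qed.

Lemma pmf_mean_le1 f : (forall e, 0 <= f e <= 1) -> pmf_mean p f <= 1.
Proof.
move=> h; rewrite -[leRHS](@pmf_mean_cst 1)//; apply: le_pmf_mean.
- exact: bounded_ge0_01.
- by apply: bounded_ge0_01 => e; rewrite ler01 lexx.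
- by move=> e; have /andP[] := h e.
Qed.

Lemma pmf_mean_ge_term f e0 : bounded_ge0 f -> p e0 * f e0 <= pmf_mean p f.
Proof.
move=> hf; rewrite -lee_fin -pmf_meanE//; apply: esum_ge.
exists [set e0]; first by split; [exact: finite_set1|].
by rewrite fsbig_set1.
Qed.

End PmfMean.

(** A child with a siblings before it and b after it belongs to a family of k = a + b + 1 children;
    the pair is recovered from k and i = b. *)
Lemma esum_pairs_total (R : realType) (h : nat -> nat -> \bar R) :
  (forall k i, (0 <= h k i)%E) ->
  \esum_(ab in [set: nat * nat]) h (ab.1 + ab.2).+1 ab.2 =
  \esum_(k in [set: nat]) \esum_(i in `I_k) h k i.
Proof.
move=> h0; rewrite esum_esum//.
rewrite [RHS](reindex_esum [set: nat * nat] _ (fun ab => ((ab.1 + ab.2).+1, ab.2)))//.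
split.
- by move=> [a b] _ /=; split=> //; rewrite /= ltnS leq_addl.
- by move=> [a b] [a' b'] _ _ /= [h1 h2]; congr (_, _); lia.
- move=> [k i] /= [_ ik]; exists ((k - i.+1)%N, i) => //=.
  by rewrite -addnS subnK.
Qed.

(** * Generating functions of a critical offspring law *)

Section RealSequences.
Variable R : realType.
Implicit Types u v : nat -> R.

Lemma nonincreasing_lim u : (forall n, u n.+1 <= u n) -> (forall n, 0 <= u n) ->
  [/\ u @ \oo --> lim (u @ \oo), forall n, lim (u @ \oo) <= u n
    & 0 <= lim (u @ \oo)].
Proof.
move=> du u0.
have mono : {homo u : n k / (n <= k)%N >-> k <= n} by exact/nonincreasing_seqP.
have lb : has_lbound (range u) by exists 0 => _ [n _ <-].
have cu : cvgn u by apply: cvgP (nonincreasing_cvgn mono lb).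
split=> //.
- by move=> n; apply: nonincreasing_cvgn_ge.
- by apply: limr_ge => //; exact: nearW.
Qed.

Lemma le_cvg u v (a b : R) : u @ \oo --> a -> v @ \oo --> b ->
  (forall n, u n <= v n) -> a <= b.
Proof.
move=> ua vb uv; rewrite -[leLHS](cvg_lim _ ua)// -[leRHS](cvg_lim _ vb)//.
by apply: ler_lim; [exact: cvgP ua|exact: cvgP vb|exact: nearW].
Qed.

Lemma cvg_le_cst u (a b : R) : u @ \oo --> a -> (forall n, u n <= b) -> a <= b.
Proof. by move=> ua ub; apply: (le_cvg ua (cvg_cst b)). Qed.

Lemma cvg_unique_real u (a b : R) : u @ \oo --> a -> u @ \oo --> b -> a = b.
Proof. by move=> ua ub; rewrite -(cvg_lim _ ua)// -(cvg_lim _ ub). Qed.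

Lemma squeeze0 u v : (forall n, 0 <= u n <= v n) -> v @ \oo --> (0 : R) ->
  u @ \oo --> (0 : R).
Proof.
move=> uv v0; apply: (squeeze_cvgr _ (cvg_cst 0) v0).
by apply: nearW => n; exact: uv.
Qed.

End RealSequences.

Section Offspring.
Variables (R : realType) (m : nat -> R).

(* Law of the numbers of siblings before and after the special child; its
   generating function is the difference quotient of pgf, see pgf_diff. *)
Definition bush_pmf (ab : nat * nat) : R := m (ab.1 + ab.2).+1.
Definition pgf (s : R) : R := pmf_mean m (fun k => s ^+ k).
Definition bush_gf (p q : R) : R :=
  pmf_mean bush_pmf (fun ab => q ^+ ab.1 * p ^+ ab.2).

Hypothesis hm : is_pmf m.
(** There are k pairs (a, b) with a + b + 1 = k, so total mass one of [bush_pmf] means that [m] has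
    mean one: this is criticality. *)
Hypothesis hnu : is_pmf bush_pmf.
(** Families of at least two children occur. The exclusion of the Dirac mass at 1 is used in this
    form, and the strict inequalities for [bush_gf] rest on it. *)
Variable k0 : nat.
Hypothesis hk0 : 0 < m k0.+2.

Lemma expr01 (s : R) n : 0 <= s <= 1 -> 0 <= s ^+ n <= 1.
Proof. by move=> /andP[s0 s1]; rewrite exprn_ge0//= exprn_ile1. Qed.

Lemma mul01 (s t : R) : 0 <= s <= 1 -> 0 <= t <= 1 -> 0 <= s * t <= 1.
Proof. by move=> /andP[s0 s1] /andP[t0 t1]; rewrite mulr_ge0//= mulr_ile1. Qed.

Let bp (s : R) : 0 <= s <= 1 -> bounded_ge0 (fun k => s ^+ k).
Proof. by move=> hs; apply: bounded_ge0_01 => k; exact: expr01. Qed.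

Let bb (p q : R) : 0 <= p <= 1 -> 0 <= q <= 1 ->
  bounded_ge0 (fun ab : nat * nat => q ^+ ab.1 * p ^+ ab.2).
Proof.
by move=> hp hq; apply: bounded_ge0_01 => k; apply: mul01; exact: expr01.
Qed.

Lemma pgf01 (s : R) : 0 <= s <= 1 -> 0 <= pgf s <= 1.
Proof.
move=> hs; apply/andP; split.
  by apply: pmf_mean_ge0 => // k; have /andP[] := expr01 k hs.
by apply: pmf_mean_le1 => // k; exact: expr01.
Qed.

Lemma pgf1 : pgf 1 = 1.
Proof.
rewrite /pgf -[RHS](@pmf_mean_cst _ _ _ hm 1)//.
by apply: eq_pmf_mean => k; rewrite expr1n.
Qed.

Lemma bush_gf01 (p q : R) : 0 <= p <= 1 -> 0 <= q <= 1 -> 0 <= bush_gf p q <= 1.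
Proof.
move=> hp hq; apply/andP; split.
  by apply: pmf_mean_ge0 => // k; have /andP[] := mul01 (expr01 k.1 hq) (expr01 k.2 hp).
by apply: pmf_mean_le1 => // k; apply: mul01; exact: expr01.
Qed.

Lemma le_bush_gf (p q p' q' : R) : 0 <= p -> p <= p' -> p' <= 1 ->
  0 <= q -> q <= q' -> q' <= 1 -> bush_gf p q <= bush_gf p' q'.
Proof.
move=> p0 pp p1 q0 qq q1; apply: le_pmf_mean => //.
- by apply: bb; apply/andP; split=> //; lra.
- by apply: bb; apply/andP; split=> //; lra.
- move=> [a b] /=; apply: ler_pM; rewrite ?exprn_ge0//.
    by apply: lerXn2r => //; rewrite nnegrE//; lra.
  by apply: lerXn2r => //; rewrite nnegrE//; lra.
Qed.

Lemma bush_gf_sym (p q : R) : bush_gf p q = bush_gf q p.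
Proof.
rewrite /bush_gf /pmf_mean.
rewrite (reindex_esum [set: nat * nat] _ (fun ab => (ab.2, ab.1)))/=; last first.
  split=> //=; first by move=> [a b] [a' b'] _ _ [-> ->].
  by move=> [a b] _; exists (b, a).
by congr fine; apply: eq_esum => -[a b] _ /=; rewrite /bush_pmf /= addnC [q ^+ b * _]mulrC.
Qed.

(** The geometric sum q^k - p^k = (q - p) sum_{i < k} q^(k-1-i) p^i, averaged over k. The order p <=
    q keeps all terms nonnegative, as sums of extended reals require. *)
Lemma pgf_diff_le (p q : R) : 0 <= p -> p <= q -> q <= 1 ->
  (q - p) * bush_gf p q = pgf q - pgf p.
Proof.
move=> p0 pq q1.
have hp : 0 <= p <= 1 by apply/andP; split=> //; lra.
have hq : 0 <= q <= 1 by apply/andP; split=> //; lra.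
have m0 := hm.1.
suff : pgf q = (q - p) * bush_gf p q + pgf p by lra.
have qp0 : 0 <= q - p by lra.
rewrite -pmf_meanZ//; last exact: bb.
apply: EFin_inj; rewrite EFinD -!pmf_meanE//; try exact: bp; last first.
  by apply: bounded_ge0Z => //; exact: bb.
transitivity (\esum_(ab in [set: nat * nat]) (bush_pmf ab * ((q - p) * (q ^+ ab.1 * p ^+ ab.2)))%:E
  + \esum_(e in [set: nat]) (m e * p ^+ e)%:E)%E; last first.
  by congr (_ + _)%E; apply: eq_esum => -[a b] _ /=; rewrite addnK.
rewrite [X in (X + _)%E](_ : _ = \esum_(ab in [set: nat * nat])
   (m (ab.1 + ab.2).+1 * ((q - p) * (q ^+ ((ab.1 + ab.2).+1.-1 - ab.2) * p ^+ ab.2)))%:E); last first.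
  by apply: eq_esum => -[a b] _ /=; rewrite addnK.
rewrite (@esum_pairs_total _ (fun k i => (m k * ((q - p) * (q ^+ (k.-1 - i) * p ^+ i)))%:E)
  ) => [|k i] //; last first.
  by rewrite lee_fin !mulr_ge0// ?exprn_ge0//; lra.
rewrite -esumD.
- apply: eq_esum => k _.
  have -> : (\esum_(i in `I_k) (m k * ((q - p) * (q ^+ (k.-1 - i) * p ^+ i)))%:E
    = (m k * (q ^+ k - p ^+ k))%:E)%E.
    rewrite esum_fset//; last first.
      by move=> i _; rewrite lee_fin !mulr_ge0// ?exprn_ge0//; lra.
    rewrite -fsbig_ord sumEFin subrXX !big_distrr/=.
    by congr EFin; apply: eq_bigr => i _; ring.
  by rewrite -EFinD; congr EFin; ring.
- move=> k _; apply: esum_ge0 => i _.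
  by rewrite lee_fin !mulr_ge0// ?exprn_ge0//; lra.
- by move=> k _; rewrite lee_fin mulr_ge0// exprn_ge0.
Qed.

Lemma pgf_diff (p q : R) : 0 <= p <= 1 -> 0 <= q <= 1 ->
  (q - p) * bush_gf p q = pgf q - pgf p.
Proof.
move=> /andP[p0 p1] /andP[q0 q1].
have [pq|/ltW qp] := leP p q; first exact: pgf_diff_le.
have := pgf_diff_le q0 qp p1; rewrite bush_gf_sym; lra.
Qed.

Lemma le_pgf (p q : R) : 0 <= p -> p <= q -> q <= 1 -> pgf p <= pgf q.
Proof.
move=> p0 pq q1; have := pgf_diff_le p0 pq q1.
have /andP[h _] : 0 <= bush_gf p q <= 1 by apply: bush_gf01; lra.
have : 0 <= (q - p) * bush_gf p q by rewrite mulr_ge0//; lra.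
lra.
Qed.

Lemma pgf_sub_le (p q : R) : 0 <= p -> p <= q -> q <= 1 -> pgf q - pgf p <= q - p.
Proof.
move=> p0 pq q1; rewrite -pgf_diff_le//.
have /andP[_ h] : 0 <= bush_gf p q <= 1 by apply: bush_gf01; lra.
by rewrite ler_piMr//; lra.
Qed.

Lemma bush_gf1_lt1 (p : R) : 0 <= p < 1 -> bush_gf p 1 < 1.
Proof.
move=> /andP[p0 p1].
have hp : 0 <= p <= 1 by lra.
pose f (ab : nat * nat) : R := 1 - 1 ^+ ab.1 * p ^+ ab.2.
have f01 ab : 0 <= f ab <= 1.
  rewrite /f expr1n mul1r; have := expr01 ab.2 hp; set x := p ^+ _.
  by move=> ?; lra.
have hf : bounded_ge0 f by exact: bounded_ge0_01.
have e : bush_gf p 1 + pmf_mean bush_pmf f = 1.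
  rewrite /bush_gf -pmf_meanD//; last first.
    by apply: bb; rewrite ?ler01 ?lexx.
  rewrite -[RHS](@pmf_mean_cst _ _ _ hnu 1)//.
  by apply: eq_pmf_mean => k; rewrite /f; ring.
(* With positive probability exactly one child follows the special one, and there [f] equals 1 - p >
   0. *)
have : 0 < bush_pmf (k0, 1%N) * f (k0, 1%N).
  rewrite mulr_gt0//; first by rewrite /bush_pmf/= addn1.
  by rewrite /f/= expr1n; lra.
have := pmf_mean_ge_term hnu (k0, 1%N) hf; lra.
Qed.

Lemma bush_gf0_gt0 (s : R) : 0 <= s <= 1 -> 0 < bush_gf s 1.
Proof.
move=> /andP[s0 s1].
apply: (@lt_le_trans _ _ (bush_gf 0 1)); last by apply: le_bush_gf => //; lra.
have h1 : (0 <= 1 :> R) && (1 <= 1 :> R) by rewrite ler01 lexx.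
have h0 : (0 <= 0 :> R) && (0 <= 1 :> R) by rewrite ler01 lexx.
(* No child after the special one: the factor is 0 ^ 0 = 1, so this term survives at p = 0. *)
have := @pmf_mean_ge_term _ _ _ hnu _ (k0.+1, 0%N) (bb h0 h1).
by rewrite /= expr1n expr0 !mulr1 /bush_pmf/= addn0; apply: lt_le_trans.
Qed.

Lemma pgf_eq1 (s : R) : 0 <= s <= 1 -> pgf s = 1 -> s = 1.
Proof.
move=> hs h1; have /andP[s0 s1] := hs.
have := pgf_diff_le s0 s1 (lexx 1); rewrite pgf1 h1 subrr => /eqP.
rewrite mulf_eq0 subr_eq0 => /orP[/eqP//|/eqP h].
by have := bush_gf0_gt0 hs; rewrite h ltxx.
Qed.

(** The slope of the chord of [pgf] from p to 1 is nondecreasing in p; when q <= p, monotonicity and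
    C >= 1 suffice. Bounds of this form carry a domination of hitting probabilities through the
    recursion of the tree. *)
Lemma pgf_comparable (C p q : R) : 1 <= C -> 0 <= p <= 1 -> 0 <= q <= 1 ->
  1 - p <= C * (1 - q) -> 1 - pgf p <= C * (1 - pgf q).
Proof.
move=> C1 hp hq h; have /andP[p0 p1] := hp; have /andP[q0 q1] := hq.
have /andP[_ h1] := pgf01 hq; have /andP[_ h2] := pgf01 hp.
have [qp|pq] := leP q p.
  have := le_pgf q0 qp p1.
  have : 1 - pgf q <= C * (1 - pgf q) by rewrite ler_peMl//; lra.
  lra.
have := pgf_diff_le p0 p1 (lexx 1); have := pgf_diff_le q0 q1 (lexx 1).
rewrite pgf1 => <- <-.
have M : bush_gf p 1 <= bush_gf q 1 by apply: le_bush_gf => //; lra.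
have := bush_gf0_gt0 hp => M0.
rewrite mulrA; apply: ler_pM => //; try lra.
Qed.

Lemma exprn_comparable (C p q : R) b : 1 <= C -> 0 <= p <= 1 -> 0 <= q <= 1 ->
  1 - p <= C * (1 - q) -> 1 - p ^+ b <= C * (1 - q ^+ b).
Proof.
move=> C1 hp hq h; have /andP[p0 p1] := hp; have /andP[q0 q1] := hq.
have /andP[_ h1] := expr01 b hq; have /andP[_ h2] := expr01 b hp.
have [qp|pq] := leP q p.
  have : q ^+ b <= p ^+ b by apply: lerXn2r => //; rewrite nnegrE; lra.
  have : 1 - q ^+ b <= C * (1 - q ^+ b) by rewrite ler_peMl//; lra.
  lra.
rewrite -[X in X - _ <= _](expr1n _ b) -[X in C * (X - _)](expr1n _ b) !subrXX.
rewrite mulrA; apply: ler_pM => //; try lra.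
  by apply: sumr_ge0 => i _; rewrite mulr_ge0// exprn_ge0.
apply: ler_sum => i _; rewrite !expr1n !mul1r; apply: lerXn2r => //; try (rewrite nnegrE; lra).
lra.
Qed.

Lemma bush_gf_comparable (C p q : R) : 1 <= C -> 0 <= p <= 1 -> 0 <= q <= 1 ->
  1 - p <= C * (1 - q) -> 1 - bush_gf p 1 <= C * (1 - bush_gf q 1).
Proof.
move=> C1 hp hq h.
have h1 : (0 <= 1 :> R) && (1 <= 1 :> R) by rewrite ler01 lexx.
suff : C * bush_gf q 1 + 1 <= bush_gf p 1 + C by lra.
have C0 : 0 <= C by lra.
rewrite -[X in _ + X <= _](@pmf_mean_cst _ _ _ hnu 1)//.
rewrite -[X in _ <= _ + X](@pmf_mean_cst _ _ _ hnu C)//.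
have bc (c : R) : 0 <= c -> bounded_ge0 (fun _ : nat * nat => c).
  by move=> c0; exists c => _; rewrite c0 lexx.
rewrite -pmf_meanZ//; last exact: bb.
have h2 : bounded_ge0 (fun ab : nat * nat => C * (1 ^+ ab.1 * q ^+ ab.2)).
  by apply: bounded_ge0Z => //; exact: bb.
rewrite -!pmf_meanD//; try exact: bb; try exact: bc.
apply: le_pmf_mean => //.
- by apply: bounded_ge0D => //; exact: bc.
- by apply: bounded_ge0D; [exact: bb|exact: bc].
- move=> [a b] /=; rewrite expr1n !mul1r.
  have := exprn_comparable b C1 hp hq h; lra.
Qed.

(** Probability that a Galton-Watson tree with offspring law [m] has a vertex at depth n. *)
Fixpoint survival (n : nat) : R :=
  if n is n'.+1 then 1 - pgf (1 - survival n') else 1.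

Lemma survival01 n : 0 <= survival n <= 1.
Proof.
elim: n => [|n ih] /=; first by rewrite ler01 lexx.
have : 0 <= pgf (1 - survival n) <= 1 by apply: pgf01; lra.
lra.
Qed.

Lemma survival_decr n : survival n.+1 <= survival n.
Proof.
elim: n => [|n ih]; first by have := survival01 1; rewrite /=; lra.
rewrite [leLHS]/= [leRHS]/=.
have h1 := survival01 n; have h2 := survival01 n.+1.
have : pgf (1 - survival n) <= pgf (1 - survival n.+1) by apply: le_pgf; lra.
rewrite /=; lra.
Qed.

(** The limit l satisfies l <= l * bush_gf (1 - l) 1, and the second factor is below 1 unless l = 0.
    Bounding the divided difference by its value at 1 - l spares a continuity argument for [pgf]. *)
Lemma survival_cvg : survival @ \oo --> (0 : R).
Proof.
have [cv ll l0] := nonincreasing_lim survival_decr (fun n => (andP (survival01 n)).1).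
set l := lim _ in cv ll l0 *.
have l1 : l <= 1 by exact: ll 0%N.
suff : l = 0 by move=> <-.
have step n : survival n.+1 <= survival n * bush_gf (1 - l) 1.
  have := survival01 n => hn.
  have e : (1 - (1 - survival n)) * bush_gf (1 - survival n) 1 = survival n.+1.
    by rewrite pgf_diff ?pgf1//; lra.
  rewrite -e [1 - (1 - survival n)](_ : _ = survival n); last by ring.
  apply: ler_wpM2l; first by lra.
  by have := ll n => ?; apply: le_bush_gf; lra.
have cv1 : survival n.+1 @[n --> \oo] --> l by rewrite cvg_shiftS.
have cv2 : survival n * bush_gf (1 - l) 1 @[n --> \oo] --> l * bush_gf (1 - l) 1.
  by apply: cvgM => //; exact: cvg_cst.
have lM : l <= l * bush_gf (1 - l) 1.
  rewrite -[leLHS](cvg_lim _ cv1)// -[leRHS](cvg_lim _ cv2)//.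
  apply: ler_lim; [exact: cvgP cv1|exact: cvgP cv2|].
  by apply: nearW => n; exact: step.
apply/eqP; apply/negPn/negP => ln0.
have lp : 0 < l by rewrite lt_def ln0.
have : bush_gf (1 - l) 1 < 1 by apply: bush_gf1_lt1; lra.
by rewrite ltNge -(ler_pM2l lp) mulr1 lM.
Qed.

End Offspring.

(** * Killed random walks and their duality *)

Section Walk.
Variables (R : realType) (d : nat) (theta : {fsfun site d -> R with 0}).
Hypothesis theta0 : forall z, 0 <= theta z.
Hypothesis theta1 : \sum_(z <- finsupp theta) theta z = 1.
Implicit Types (f g h s : site d -> R) (x y z : site d).

(** Ordinary tree edges, oriented from parent to child, give [fwd]; descending the spine runs
    against the orientation of its edges and gives [bwd]. *)
Definition fwd f y : R := \sum_(z <- finsupp theta) theta z * f (y + z).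
Definition bwd f x : R := \sum_(z <- finsupp theta) theta z * f (x - z).

Lemma fwdD f g y : fwd (fun x => f x + g x) y = fwd f y + fwd g y.
Proof. by rewrite /fwd -big_split/=; apply: eq_bigr => z _; rewrite mulrDr. Qed.

Lemma fwdB f g y : fwd (fun x => f x - g x) y = fwd f y - fwd g y.
Proof.
by rewrite /fwd -sumrN -big_split/=; apply: eq_bigr => z _; rewrite mulrBr.
Qed.

Lemma fwd_cst (c : R) y : fwd (fun=> c) y = c.
Proof. by rewrite /fwd -mulr_suml theta1 mul1r. Qed.

Lemma le_fwd f g y : (forall x, f x <= g x) -> fwd f y <= fwd g y.
Proof. by move=> fg; apply: ler_sum => z _; rewrite ler_wpM2l. Qed.

Lemma fwd_ge0 f y : (forall x, 0 <= f x) -> 0 <= fwd f y.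
Proof. by move=> f0; apply: sumr_ge0 => z _; rewrite mulr_ge0. Qed.

Lemma fwd01 f y : (forall x, 0 <= f x <= 1) -> 0 <= fwd f y <= 1.
Proof.
move=> f01; rewrite fwd_ge0/=; last by move=> x; have /andP[] := f01 x.
by rewrite -[leRHS](fwd_cst 1 y); apply: le_fwd => x; have /andP[] := f01 x.
Qed.

Lemma fwdZ (c : R) f y : fwd (fun x => c * f x) y = c * fwd f y.
Proof. by rewrite /fwd mulr_sumr; apply: eq_bigr => z _; rewrite mulrCA. Qed.

Lemma bwdB f g y : bwd (fun x => f x - g x) y = bwd f y - bwd g y.
Proof.
by rewrite /bwd -sumrN -big_split/=; apply: eq_bigr => z _; rewrite mulrBr.
Qed.

Lemma bwd_cst (c : R) y : bwd (fun=> c) y = c.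
Proof. by rewrite /bwd -mulr_suml theta1 mul1r. Qed.

Lemma le_bwd f g y : (forall x, f x <= g x) -> bwd f y <= bwd g y.
Proof. by move=> fg; apply: ler_sum => z _; rewrite ler_wpM2l. Qed.

Lemma bwd_ge0 f y : (forall x, 0 <= f x) -> 0 <= bwd f y.
Proof. by move=> f0; apply: sumr_ge0 => z _; rewrite mulr_ge0. Qed.

Lemma bwd01 f y : (forall x, 0 <= f x <= 1) -> 0 <= bwd f y <= 1.
Proof.
move=> f01; rewrite bwd_ge0/=; last by move=> x; have /andP[] := f01 x.
by rewrite -[leRHS](bwd_cst 1 y); apply: le_bwd => x; have /andP[] := f01 x.
Qed.

Lemma bwdZ (c : R) f y : bwd (fun x => c * f x) y = c * bwd f y.
Proof. by rewrite /bwd mulr_sumr; apply: eq_bigr => z _; rewrite mulrCA. Qed.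

Lemma cvg_bigsum (I : Type) (r : seq I) (u : nat -> I -> R) (l : I -> R) :
  (forall i, u ^~ i @ \oo --> l i) ->
  (fun n => \sum_(i <- r) u n i) @ \oo --> \sum_(i <- r) l i.
Proof.
move=> h; elim: r => [|i r ih].
  by rewrite big_nil; under eq_fun do rewrite big_nil; exact: cvg_cst.
rewrite big_cons; under eq_fun do rewrite big_cons.
by apply: cvgD.
Qed.

Lemma cvg_fwd (u : nat -> site d -> R) f y :
  (forall x, u ^~ x @ \oo --> f x) -> (fun n => fwd (u n) y) @ \oo --> fwd f y.
Proof.
move=> h; apply: (@cvg_bigsum _ _ (fun n z => theta z * u n (y + z))) => z.
by apply: cvgM; [exact: cvg_cst|exact: h].
Qed.

Lemma cvg_bwd (u : nat -> site d -> R) f y :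
  (forall x, u ^~ x @ \oo --> f x) -> (fun n => bwd (u n) y) @ \oo --> bwd f y.
Proof.
move=> h; apply: (@cvg_bigsum _ _ (fun n z => theta z * u n (y - z))) => z.
by apply: cvgM; [exact: cvg_cst|exact: h].
Qed.

(** The killing acts on arrival for the reversed walk and before departure for the forward one; with
    these conventions the two operators are adjoint for the counting measure. *)
Definition bwd_killed s f x : R := bwd (fun y => s y * f y) x.
Definition fwd_killed s f y : R := s y * fwd f y.

Lemma bwd_killedB s f g x :
  bwd_killed s (fun y => f y - g y) x = bwd_killed s f x - bwd_killed s g x.
Proof.
rewrite /bwd_killed -bwdB; congr bwd; apply/funext => y; exact: mulrBr.
Qed.

Lemma iter_bwd_killedB s n f g x :
  iter n (bwd_killed s) (fun y => f y - g y) x =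
  iter n (bwd_killed s) f x - iter n (bwd_killed s) g x.
Proof.
elim: n x => //= n ih x; rewrite -bwd_killedB; congr bwd_killed.
exact/funext.
Qed.

Lemma le_bwd_killed s s' f g x : (forall y, 0 <= s y <= s' y) ->
  (forall y, 0 <= f y <= g y) -> 0 <= bwd_killed s f x <= bwd_killed s' g x.
Proof.
move=> hs hf; rewrite bwd_ge0/=; last first.
  move=> y; have := hs y; have := hf y => /andP[? _] /andP[? _].
  exact: mulr_ge0.
apply: le_bwd => y; have := hs y; have := hf y => /andP[? ?] /andP[? ?].
exact: ler_pM.
Qed.

Lemma le_iter_bwd_killed s s' n f g x : (forall y, 0 <= s y <= s' y) ->
  (forall y, 0 <= f y <= g y) ->
  0 <= iter n (bwd_killed s) f x <= iter n (bwd_killed s') g x.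
Proof.
by move=> hs hf; elim: n x => //= n ih x; apply: le_bwd_killed.
Qed.

Lemma bwd_killed_mono s f g x : (forall y, 0 <= s y) ->
  (forall y, f y <= g y) -> bwd_killed s f x <= bwd_killed s g x.
Proof. by move=> hs hf; apply: le_bwd => y; exact: ler_wpM2l. Qed.

Lemma iter_bwd_killed_mono s n f g x : (forall y, 0 <= s y) ->
  (forall y, f y <= g y) ->
  iter n (bwd_killed s) f x <= iter n (bwd_killed s) g x.
Proof.
by move=> hs hf; elim: n x => //= n ih x; apply: bwd_killed_mono.
Qed.

Lemma bwd_killed01 s f x : (forall y, 0 <= s y <= 1) ->
  (forall y, 0 <= f y <= 1) -> 0 <= bwd_killed s f x <= 1.
Proof. by move=> hs hf; apply: bwd01 => y; exact: mul01. Qed.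

Lemma iter_bwd_killed01 s n f x : (forall y, 0 <= s y <= 1) ->
  (forall y, 0 <= f y <= 1) -> 0 <= iter n (bwd_killed s) f x <= 1.
Proof. by move=> hs hf; elim: n x => //= n ih x; apply: bwd_killed01. Qed.

Lemma iter_bwd_killed_ge0 s n f x : (forall y, 0 <= s y) ->
  (forall y, 0 <= f y) -> 0 <= iter n (bwd_killed s) f x.
Proof.
move=> hs hf; elim: n x => //= n ih x.
by apply: bwd_ge0 => y; rewrite mulr_ge0.
Qed.

(** The starting point is exempt from killing, just as the root of the tree is not part of its
    past. *)
Definition escape_upto s n x : R := iter n (bwd_killed s) (fun=> 1) x.
Definition escape s x : R := lim (escape_upto s n x @[n --> \oo]).

Section Escape.
Variable s : site d -> R.
Hypothesis s01 : forall y, 0 <= s y <= 1.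

Lemma escape_upto01 n x : 0 <= escape_upto s n x <= 1.
Proof. by apply: iter_bwd_killed01 => // y; rewrite ler01 lexx. Qed.

Lemma escape_upto_decr n x : escape_upto s n.+1 x <= escape_upto s n x.
Proof.
rewrite /escape_upto iterSr; apply: iter_bwd_killed_mono => y.
  by have /andP[] := s01 y.
suff /andP[] : 0 <= bwd_killed s (fun=> 1) y <= 1 by [].
by apply: bwd_killed01 => // z; rewrite ler01 lexx.
Qed.

Lemma escape_limit x : [/\ escape_upto s n x @[n --> \oo] --> escape s x,
  forall n, escape s x <= escape_upto s n x & 0 <= escape s x].
Proof.
apply: (@nonincreasing_lim _ (fun n => escape_upto s n x)) => n.
  exact: escape_upto_decr.
by have /andP[] := escape_upto01 n x.
Qed.

Lemma escape_cvg x : escape_upto s n x @[n --> \oo] --> escape s x.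
Proof. by have [] := escape_limit x. Qed.

Lemma escape01 x : 0 <= escape s x <= 1.
Proof. by have [_ /(_ 0%N) le0 ->] := escape_limit x. Qed.

Lemma escapeE x : escape s x = bwd_killed s (escape s) x.
Proof.
apply: (@cvg_unique_real _ (fun n => escape_upto s n.+1 x)).
  by rewrite (cvg_shiftS (fun n => escape_upto s n x)); exact: escape_cvg.
apply: (@cvg_bwd (fun n y => s y * escape_upto s n y)) => y.
by apply: cvgM; [exact: cvg_cst|exact: escape_cvg].
Qed.

Lemma iter_escape n x : iter n (bwd_killed s) (escape s) x = escape s x.
Proof.
elim: n x => //= n ih x; rewrite [RHS]escapeE; congr bwd_killed.
exact/funext.
Qed.

(** The iterate is the probability of surviving n steps and being killed later. *)
Lemma iter_hit_cvg0 x :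
  iter n (bwd_killed s) (fun y => 1 - escape s y) x @[n --> \oo] --> 0.
Proof.
under eq_fun do rewrite iter_bwd_killedB iter_escape.
rewrite -(subrr (escape s x)); apply: cvgB; last exact: cvg_cst.
exact: escape_cvg.
Qed.

End Escape.

(* For a killing function s' >= s the tail of the s'-walk forgets the
   difference between s and s' only if hitting for s is controlled by hitting
   for s'; this is where domination by a multiple is used. *)
Lemma iter_escape_cvg s s' (C : R) x : 0 <= C ->
  (forall y, 0 <= s y <= 1) -> (forall y, 0 <= s' y <= 1) ->
  (forall y, 1 - escape s y <= C * (1 - escape s' y)) ->
  iter n (bwd_killed s') (escape s) x @[n --> \oo] --> escape s' x.
Proof.
move=> C0 s01 s'01 h.
have e n : iter n (bwd_killed s') (escape s) x = escape_upto s' n x -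
    iter n (bwd_killed s') (fun y => 1 - escape s y) x.
  by rewrite iter_bwd_killedB /escape_upto; ring.
under eq_fun do rewrite e.
rewrite -(subr0 (escape s' x)); apply: cvgB; first exact: escape_cvg.
have s'0 y : 0 <= s' y by have /andP[] := s'01 y.
apply: (@squeeze0 _ _ (fun n => C * iter n (bwd_killed s') (fun y => 1 - escape s' y) x)).
  move=> n; apply/andP; split.
    apply: iter_bwd_killed_ge0 => // y.
    by rewrite subr_ge0; have /andP[] := escape01 s01 y.
  have -> : C * iter n (bwd_killed s') (fun y => 1 - escape s' y) x =
     iter n (bwd_killed s') (fun y => C * (1 - escape s' y)) x.
    elim: n x {e} => //= n ih x; rewrite -bwdZ; congr bwd; apply/funext => y.
    by rewrite mulrCA ih.
  exact: iter_bwd_killed_mono.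
rewrite -(mulr0 C); apply: cvgM; [exact: cvg_cst|exact: iter_hit_cvg0].
Qed.

Lemma iter_escape_cvg_le s s' x : (forall y, 0 <= s y <= 1) ->
  (forall y, 0 <= s' y <= s y) ->
  iter n (bwd_killed s') (escape s) x @[n --> \oo] --> escape s' x.
Proof.
move=> s01 s's.
have s'01 y : 0 <= s' y <= 1.
  by have := s01 y; have := s's y; lra.
apply: (@iter_escape_cvg s s' 1) => // y; rewrite mul1r lerB//.
apply: (le_cvg (@escape_cvg _ s'01 y) (@escape_cvg _ s01 y)) => n.
suff /andP[] : 0 <= escape_upto s' n y <= escape_upto s n y by [].
by apply: le_iter_bwd_killed => // z; rewrite ler01 lexx.
Qed.

(** A minimum principle: [D] is superharmonic for the walk killed by [s], and its iterates are
    bounded below by minus the probability of surviving n steps and being killed later, which tends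
    to 0. *)
Lemma hit_comparable s s' (C : R) : 1 <= C ->
  (forall y, 0 <= s y <= s' y) -> (forall y, s' y <= 1) ->
  (forall y, 1 - s y <= C * (1 - s' y)) ->
  forall x, 1 - escape s x <= C * (1 - escape s' x).
Proof.
move=> C1 ss s'1 h x.
have s01 y : 0 <= s y <= 1 by have := ss y; have := s'1 y; lra.
have s'01 y : 0 <= s' y <= 1 by have := ss y; have := s'1 y; lra.
pose D y := C * (1 - escape s' y) - (1 - escape s y).
have s0 y : 0 <= s y by have /andP[] := s01 y.
have DD y : bwd_killed s D y <= D y.
  have e t (t01 : forall y, 0 <= t y <= 1) : 1 - escape t y =
      bwd (fun z => 1 - t z + t z * (1 - escape t z)) y.
    rewrite {1}escapeE// -[X in X - _](bwd_cst 1 y) -bwdB; congr bwd.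
    by apply/funext => z; ring.
  rewrite {2}/D !e// -bwdZ -bwdB; apply: le_bwd => z; rewrite /D.
  have := h z; have := escape01 s'01 z; have := ss z; have := escape01 s01 z.
  set a := escape s z; set b := escape s' z => h1 h2 h3 h4.
  rewrite -subr_ge0.
  rewrite [X in 0 <= X](_ : _ = (C * (1 - s' z) - (1 - s z)) + C * ((s' z - s z) * (1 - b))); last by ring.
  by rewrite addr_ge0 ?mulr_ge0//; lra.
have DN n : iter n (bwd_killed s) D x <= D x.
  elim: n => //= n ih; apply: le_trans ih; rewrite -iterS iterSr.
  exact: iter_bwd_killed_mono.
have lo n : - iter n (bwd_killed s) (fun y => 1 - escape s y) x <= D x.
  apply: le_trans (DN n); rewrite /D [leRHS]iter_bwd_killedB lerDr.
  apply: iter_bwd_killed_ge0 => // y; rewrite mulr_ge0//; first by lra.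
  by rewrite subr_ge0; have /andP[] := escape01 s'01 y.
have : - 0 <= D x by apply: cvg_le_cst lo; apply: cvgN; exact: iter_hit_cvg0.
by rewrite oppr0 subr_ge0.
Qed.

(** The inner product for the counting measure, kept in the extended reals because its finiteness
    for Green potentials is a conclusion and not known beforehand. *)
Definition pairing f g : \bar R := \esum_(z in [set: site d]) (f z * g z)%:E.

Lemma pairing_adjoint f g : (forall y, 0 <= f y) -> (forall y, 0 <= g y) ->
  pairing (fwd f) g = pairing f (bwd g).
Proof.
move=> f0 g0; rewrite /pairing.
under eq_esum do rewrite /fwd mulr_suml -sumEFin.
under [RHS]eq_esum do rewrite /bwd mulr_sumr -sumEFin.
rewrite !esum_sum; try by move=> i j _ _; rewrite lee_fin !mulr_ge0.
apply: eq_bigr => z _.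
rewrite (reindex_esum [set: site d] _ (fun y => y - z)).
  by apply: eq_esum => y _; rewrite subrK; congr EFin; ring.
split=> //; first by move=> a b _ _ /addIr.
by move=> y _; exists (y + z); rewrite ?addrK.
Qed.

Lemma pairing_iter s n f g : (forall y, 0 <= s y) ->
  (forall y, 0 <= f y) -> (forall y, 0 <= g y) ->
  pairing (fwd (iter n (fwd_killed s) f)) g =
  pairing f (iter n (bwd_killed s) (bwd g)).
Proof.
move=> s0; elim: n f => [|n ih] f f0 g0; first by rewrite pairing_adjoint.
rewrite iterSr ih//; last by move=> y; rewrite mulr_ge0// fwd_ge0.
rewrite /= /bwd_killed -pairing_adjoint//.
  by rewrite /pairing; apply: eq_esum => z _; rewrite /fwd_killed; congr EFin; ring.
move=> y; rewrite mulr_ge0//; apply: iter_bwd_killed_ge0 => // z.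
exact: bwd_ge0.
Qed.

Lemma pairing_fset (A : {fset site d}) f g : (forall y, 0 <= f y) ->
  (forall y, 0 <= g y) -> (forall y, y \notin A -> f y = 0) ->
  pairing f g = (\sum_(y <- A) f y * g y)%:E.
Proof.
move=> f0 g0 fA; rewrite /pairing (esumID [set` A])//; last first.
  by move=> y _; rewrite lee_fin mulr_ge0.
rewrite !setTI [X in (_ + X)%E]esum1 ?adde0; last first.
  by move=> y /negP yA; rewrite fA// mul0r.
rewrite esum_fset//; last by move=> y _; rewrite lee_fin mulr_ge0.
by rewrite fsbig_finite//= set_fsetK sumEFin.
Qed.

(** [h] is the Green potential of [f] for the walk killed by [s]. Adjointness moves its partial sums
    to the other side, where the finite support of [f] leaves a finite sum; monotonicity in N then
    identifies the pairing with the limit. *)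
Lemma pairing_series s (A : {fset site d}) f h g (c : R) :
  (forall y, 0 <= s y) -> (forall y, 0 <= f y) -> (forall y, 0 <= g y) ->
  (forall y, y \notin A -> f y = 0) ->
  (forall y, (fun N => \sum_(0 <= n < N) iter n (fwd_killed s) f y) @ \oo --> h y) ->
  (fun N => \sum_(0 <= n < N) \sum_(y <- A) f y * iter n (bwd_killed s) (bwd g) y)
     @ \oo --> c ->
  pairing (fwd h) g = c%:E.
Proof.
move=> s0 f0 g0 fA hh cc.
pose hN N y := \sum_(0 <= n < N) iter n (fwd_killed s) f y.
have i0 n y : 0 <= iter n (fwd_killed s) f y.
  by elim: n y => //= n ih y; rewrite mulr_ge0// fwd_ge0.
have b0 n y : 0 <= iter n (bwd_killed s) (bwd g) y.
  elim: n y => [|n ih] y; first by rewrite bwd_ge0.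
  by rewrite /= bwd_ge0// => z; rewrite mulr_ge0.
have hN0 N y : 0 <= hN N y by apply: sumr_ge0.
have hNh N y : hN N y <= h y.
  have nd : nondecreasing_seq (hN^~ y).
    by apply/nondecreasing_seqP => n; rewrite /hN big_nat_recr//= lerDl.
  by rewrite -(cvg_lim _ (hh y))//; apply: nondecreasing_cvgn_le => //; exact: cvgP (hh y).
have h0 y : 0 <= h y by apply: le_trans (hN0 0%N y) (hNh 0%N y).
have eN N : pairing (fwd (hN N)) g = (\sum_(0 <= n < N) \sum_(y <- A) f y * iter n (bwd_killed s) (bwd g) y)%:E.
  have -> : pairing (fwd (hN N)) g = (\sum_(0 <= n < N) pairing (fwd (iter n (fwd_killed s) f)) g)%E.
    rewrite /pairing -esum_sum; last by move=> i j _ _; rewrite lee_fin mulr_ge0// fwd_ge0.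
    apply: eq_esum => z _; rewrite sumEFin -mulr_suml; congr (_ * _)%:E.
    rewrite /fwd exchange_big/=; apply: eq_bigr => y _.
    by rewrite /hN mulr_sumr.
  rewrite -sumEFin; apply: eq_bigr => n _.
  by rewrite pairing_iter// (pairing_fset (A := A)).
have leN N : (pairing (fwd (hN N)) g <= pairing (fwd h) g)%E.
  by apply: le_esum => z _; rewrite lee_fin ler_wpM2r// le_fwd.
have nd : nondecreasing_seq
    (fun N => \sum_(0 <= n < N) \sum_(y <- A) f y * iter n (bwd_killed s) (bwd g) y).
  apply/nondecreasing_seqP => n; rewrite big_nat_recr//= lerDl.
  by apply: sumr_ge0 => y _; rewrite mulr_ge0.
have lec N : (pairing (fwd (hN N)) g <= c%:E)%E.
  rewrite eN lee_fin -(cvg_lim _ cc)//.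
  by apply: nondecreasing_cvgn_le => //; exact: cvgP cc.
apply/eqP; rewrite eq_le; apply/andP; split.
  (* The upper bound is checked on finite sets of sites, where the limit in N passes through the
     sum. *)
  apply: ge_ereal_sup => _ [X [finX _] <-].
  rewrite fsbig_finite//= sumEFin lee_fin.
  apply: (@cvg_le_cst _ (fun N => \sum_(z <- fset_set X) fwd (hN N) z * g z)).
    apply: (@cvg_bigsum _ _ (fun N z => fwd (hN N) z * g z)) => z.
    by apply: cvgM; [exact: cvg_fwd|exact: cvg_cst].
  move=> N; rewrite -lee_fin -sumEFin; apply: le_trans (lec N).
  rewrite -fsbig_finite//.
  by apply: ereal_sup_ubound; exists X.
have := leN; case: (pairing (fwd h) g) (leN 0%N) => [r| |] l0 lN; last 2 first.
- by rewrite leey.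
- move: l0; rewrite leeNy_eq => /eqP l0.
  by have := eN 0%N; rewrite l0.
rewrite lee_fin; apply: (cvg_le_cst cc) => N.
by rewrite -lee_fin -eN.
Qed.

End Walk.

(** * Avoidance probabilities and the escape identity *)

Section Irreducibility.
Variables (R : realType) (d : nat) (theta : {fsfun site d -> R with 0}).
Hypothesis htheta : step_distribution theta.

Let theta_gt0 z : z \in finsupp theta -> 0 < theta z.
Proof.
case: htheta => t0 _ _ _; rewrite mem_finsupp => zn.
by rewrite lt_def zn t0.
Qed.

(* Simultaneous Diophantine approximation of the weights: by pigeonhole some
   multiple of theta is so close to an integer vector that the integer
   combination of the steps has all its coordinates of modulus < 1. *)
Lemma positive_relation : exists n : site d -> nat,
  (forall z, z \in finsupp theta -> (0 < n z)%N) /\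
  \sum_(z <- finsupp theta) z *+ n z = 0.
Proof.
have [t0 _ tm _] := htheta.
(* Two demands are made on [Q] > [S]: 1/Q is below every weight, so that the integer multiplicities
   are positive, and 1/Q times the sum of the moduli of the coordinates is below 1, so that the
   total rounding error is too small for a nonzero integer. *)
pose S := \sum_(z <- finsupp theta) ((theta z)^-1 + \sum_(i < d) `|(z ord0 i)%:~R : R|).
have S0 z : 0 <= (theta z)^-1 + \sum_(i < d) `|(z ord0 i)%:~R : R|.
  by rewrite addr_ge0 ?invr_ge0 ?sumr_ge0.
pose Q := (Num.truncn S).+1.
have SQ : S < Q%:R by apply: truncnS_gt.
have Q0 : 0 < Q%:R :> R by rewrite ltr0n.
have frac01 (x : R) : 0 <= Q%:R * (x - (Num.floor x)%:~R) < Q%:R.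
  have /andP[h1 h2] := floor_itv x.
  rewrite intrD in h2.
  by rewrite mulr_ge0//=; last lra; rewrite gtr_pMr//; lra.
pose T := {ffun finsupp theta -> 'I_Q}.
have trQ (x : R) : (Num.truncn (Q%:R * (x - (Num.floor x)%:~R)) < Q)%N.
  have /andP[h1 h2] := frac01 x.
  by rewrite -(ltr_nat R); apply: le_lt_trans h2; rewrite truncn_le.
pose c (k : 'I_(#|T|.+1)) : T := [ffun z : finsupp theta =>
  Ordinal (trQ (k%:R * theta (val z)))].
(* Pigeonhole on the cells of width 1/Q that contain the fractional parts of k * theta z. *)
have : ~~ injectiveb c.
  apply/negP => /injectiveP /leq_card.
  by rewrite card_ord ltnn.
case/injectivePn => k [k' kk' ck].
wlog {kk'} kk' : k k' ck / (k < k')%N.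
  move=> H; case: (ltngtP k k') => h; first exact: (H k k').
    by apply: (H k' k).
  by move: kk'; rewrite (ord_inj h) eqxx.
pose fl (j : nat) z := Num.floor (j%:R * theta z).
pose dl z : R := (fl k' z - fl k z)%:~R - (k' - k)%:R * theta z.
have dlQ z : z \in finsupp theta -> `|dl z| < Q%:R^-1.
  move=> zs; have := congr1 (fun f : T => nat_of_ord (f [` zs]%fset)) ck.
  rewrite !ffunE/=.
  set x := Q%:R * _; set x' := Q%:R * _ => xx.
  have /andP[x0 _] := frac01 (k%:R * theta z).
  have /andP[x'0 _] := frac01 (k'%:R * theta z).
  have /andP[a1 a2] := truncn_itv x0; have /andP[b1 b2] := truncn_itv x'0.
  have {}xx : Num.truncn x' = Num.truncn x by rewrite xx.
  move: a1 a2 b1 b2; rewrite -/x -/x' xx -addn1 natrD; set t : R := (Num.truncn x)%:R => a1 a2 b1 b2.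
  have e : dl z = Q%:R^-1 * (x - x').
    rewrite /dl /x /x' /fl intrB natrB; last exact: ltnW.
    by rewrite -mulrBr mulKf ?lt0r_neq0//; ring.
  rewrite e normrM ger0_norm ?invr_ge0 ?ler0n// gtr_pMr ?invr_gt0// ltr_norml.
  by apply/andP; split; lra.
have Sz z : z \in finsupp theta -> (theta z)^-1 + \sum_(i < d) `|(z ord0 i)%:~R : R| <= S.
  move=> zs; rewrite /S (big_fsetD1 z)//= lerDl; exact: sumr_ge0.
have n0 z : z \in finsupp theta -> 0 < fl k' z - fl k z.
  move=> zs; rewrite -(ltr0z R).
  have := dlQ _ zs; rewrite ltr_norml /dl => /andP[h _].
  have tz := theta_gt0 zs.
  have : Q%:R^-1 < theta z.
    rewrite -[ltRHS]invrK ltf_pV2 ?posrE ?invr_gt0//.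
    apply: le_lt_trans SQ; apply: le_trans (Sz _ zs).
    by rewrite lerDl sumr_ge0.
  have : theta z <= (k' - k)%:R * theta z.
    by rewrite ler_peMl// ler1n subn_gt0.
  lra.
exists (fun z => `|fl k' z - fl k z|%N); split=> [z /n0 h|].
  by rewrite absz_gt0 gt_eqF.
apply/rowP => i; rewrite mxE summxE.
pose a := \sum_(z <- finsupp theta) (fl k' z - fl k z) * z ord0 i.
have -> : \sum_(z <- finsupp theta) (z *+ `|fl k' z - fl k z|%N) ord0 i = a.
  rewrite /a !big_seq; apply: eq_bigr => z zs.
  by rewrite mulmxnE -[in RHS](gez0_abs (ltW (n0 _ zs))) -natz mulr_natl.
suff al : `|a%:~R : R| < 1.
  apply/eqP; move: al; rewrite -intr_norm (ltr_int R _ 1) ltNge; apply: contraNT.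
  by rewrite -normr_gt0 gtz0_ge1.
(* Mean zero removes the multiple k' - k of theta; only the rounding errors remain. *)
have -> : a%:~R = \sum_(z <- finsupp theta) dl z * (z ord0 i)%:~R :> R.
  have /(congr1 (fun x => (k' - k)%:R * x)) := tm i.
  rewrite mulr0 mulr_sumr => tm'.
  transitivity (\sum_(z <- finsupp theta) dl z * (z ord0 i)%:~R +
     \sum_(z <- finsupp theta) (k' - k)%:R * (theta z * (z ord0 i)%:~R)).
    rewrite -big_split/= /a rmorph_sum/=.
    by apply: eq_bigr => z _; rewrite /dl intrM; ring.
  by rewrite tm' addr0.
have [d0|dn] := eqVneq (finsupp theta) fset0.
  by rewrite d0 big_seq_fset0 normr0.
apply: (le_lt_trans (ler_norm_sum _ _ _)).
apply: (@le_lt_trans _ _ (Q%:R^-1 * S)); last first.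
  by rewrite mulrC ltr_pdivrMr// mul1r.
rewrite mulr_sumr big_seq [leRHS]big_seq; apply: ler_sum => z zs.
rewrite normrM; apply: ler_pM => //; first exact/ltW/dlQ.
rewrite (bigD1 i)//= addrCA lerDl addr_ge0 ?invr_ge0//.
exact: sumr_ge0.
Qed.

(** A vanishing combination with positive multiplicities writes the opposite of a step as a sum of
    steps, so the displacements preserving [S] in both directions form a subgroup that contains the
    support. *)
Lemma step_closed_full (S : site d -> Prop) y0 :
  S y0 -> (forall y z, S y -> z \in finsupp theta -> S (y + z)) ->
  forall y, S y.
Proof.
move=> Sy0 hS y.
pose N v := forall y, S y -> S (y + v).
have N0 : N 0 by move=> v; rewrite addr0.
have ND u v : N u -> N v -> N (u + v).
  by move=> hu hv w Sw; rewrite addrA; apply/hv/hu.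
have NM u n : N u -> N (u *+ n).
  by move=> hu; elim: n => [|n ih]; rewrite ?mulr0n// mulrS; exact: ND.
have Nt z : z \in finsupp theta -> N z by move=> zs v Sv; exact: hS.
have Nopp z : z \in finsupp theta -> N (- z).
  move=> zs; have [n [n0]] := positive_relation.
  rewrite (big_fsetD1 z)//= => e.
  have -> : - z = z *+ (n z).-1 + \sum_(i <- (finsupp theta `\ z)%fset) i *+ n i.
    apply/eqP; rewrite eq_sym -subr_eq0 opprK addrAC -mulrSr prednK ?n0//.
    exact/eqP.
  apply: (@ND); first exact/NM/Nt.
  rewrite big_seq; apply: (big_ind N N0 ND) => i /fsetD1P[_ iz].
  exact/NM/Nt.
pose H : {pred site d} := [pred v | `[< N v >] && `[< N (- v) >]].
have [_ _ _ hH] := htheta.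
have : (y - y0) \in H.
  rewrite hH//.
    split=> [|u v].
      by rewrite inE; apply/andP; split; apply/asboolP; rewrite ?oppr0.
    rewrite !inE => /andP[/asboolP u1 /asboolP u2] /andP[/asboolP v1 /asboolP v2].
    apply/andP; split; apply/asboolP; first exact: ND.
    by rewrite opprB; exact: ND.
  by move=> z zs; rewrite inE; apply/andP; split; apply/asboolP; [exact: Nt|exact: Nopp].
by rewrite inE => /andP[/asboolP /(_ _ Sy0)]; rewrite addrC subrK.
Qed.

End Irreducibility.

Section Avoidance.
Variables (R : realType) (d : nat) (theta : {fsfun site d -> R with 0}).
Variable m : nat -> R.
Hypothesis htheta : step_distribution theta.
Hypothesis hm : is_pmf m.
Hypothesis hnu : is_pmf (bush_pmf m).
Variable k0 : nat.
Hypothesis hk0 : 0 < m k0.+2.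
Implicit Types (K B : {fset site d}) (x y : site d).

Let theta0 z : 0 <= theta z. Proof. by case: htheta. Qed.
Let theta1 : \sum_(z <- finsupp theta) theta z = 1. Proof. by case: htheta. Qed.
Local Notation Q := (fwd theta).

(* Generating function, at depth n, of the walk indexed by a Galton-Watson tree
   stopped at its first visits to K, a visit at y having weight alpha y and an
   unstopped vertex at depth n having weight c. *)
Fixpoint stopped_gf K (alpha : site d -> R) (c : R) n y : R :=
  if n is n'.+1 then
    if y \in K then alpha y else pgf m (Q (stopped_gf K alpha c n') y)
  else c.

Definition avoid_prob B y : R :=
  lim (stopped_gf B (fun=> 0) 1 n y @[n --> \oo]).

Lemma stopped_gf01 K alpha c n y : (forall z, 0 <= alpha z <= 1) ->
  0 <= c <= 1 -> 0 <= stopped_gf K alpha c n y <= 1.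
Proof.
move=> a01 c01; elim: n y => //= n ih y; case: ifP => // _.
by apply: pgf01 => //; apply: fwd01.
Qed.

Let i00 (z : site d) : (0 <= 0 :> R) && (0 <= 1 :> R).
Proof. by rewrite ler01 lexx. Qed.
Let i11 : (0 <= 1 :> R) && (1 <= 1 :> R).
Proof. by rewrite ler01 lexx. Qed.

Lemma avoid_upto01 B n y : 0 <= stopped_gf B (fun=> 0) 1 n y <= 1.
Proof. exact: stopped_gf01. Qed.

Lemma stopped_gf_decr K alpha n y : (forall z, 0 <= alpha z <= 1) ->
  stopped_gf K alpha 1 n.+1 y <= stopped_gf K alpha 1 n y.
Proof.
move=> a01; have gf01 k z := stopped_gf01 K k z a01 i11.
elim: n y => [|n ih] y; first by have /andP[] := gf01 1%N y.
rewrite [leLHS]/= [leRHS]/=; case: ifP => // _.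
have /andP[h0 h1] := fwd01 theta0 theta1 y (gf01 n).
have /andP[g0 g1] := fwd01 theta0 theta1 y (gf01 n.+1).
by apply: le_pgf => //; exact: le_fwd.
Qed.

Lemma avoid_limit B y :
  [/\ stopped_gf B (fun=> 0) 1 n y @[n --> \oo] --> avoid_prob B y,
      forall n, avoid_prob B y <= stopped_gf B (fun=> 0) 1 n y
    & 0 <= avoid_prob B y].
Proof.
apply: (@nonincreasing_lim _ (fun n => stopped_gf B (fun=> 0) 1 n y)) => n.
  exact: stopped_gf_decr.
by have /andP[] := avoid_upto01 B n y.
Qed.

Lemma avoid_cvg B y :
  stopped_gf B (fun=> 0) 1 n y @[n --> \oo] --> avoid_prob B y.
Proof. by have [] := avoid_limit B y. Qed.

Lemma avoid_le B n y : avoid_prob B y <= stopped_gf B (fun=> 0) 1 n y.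
Proof. by have [] := avoid_limit B y. Qed.

Lemma avoid01 B y : 0 <= avoid_prob B y <= 1.
Proof. by have [_ /(_ 0%N) le0 ->] := avoid_limit B y. Qed.

Lemma fwd_avoid01 B y : 0 <= Q (avoid_prob B) y <= 1.
Proof. by apply: fwd01 => // z; exact: avoid01. Qed.

Lemma avoidE B y :
  avoid_prob B y = if y \in B then 0 else pgf m (Q (avoid_prob B) y).
Proof.
apply: (@cvg_unique_real _ (fun n => stopped_gf B (fun=> 0) 1 n.+1 y)).
  rewrite (cvg_shiftS (fun n => stopped_gf B (fun=> 0) 1 n y)).
  exact: avoid_cvg.
rewrite /=; case: ifP => yB; first exact: cvg_cst.
rewrite -[X in _ --> X]addr0.
pose a n := Q (stopped_gf B (fun=> 0) 1 n) y.
have ac : a @ \oo --> Q (avoid_prob B) y.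
  by apply: cvg_fwd => x; exact: avoid_cvg.
have e n : pgf m (a n) = pgf m (Q (avoid_prob B) y) +
    (pgf m (a n) - pgf m (Q (avoid_prob B) y)) by rewrite addrC subrK.
under eq_fun do rewrite -/(a _) e.
apply: cvgD; first exact: cvg_cst.
apply: (@squeeze0 _ _ (fun n => a n - Q (avoid_prob B) y)); last first.
  by rewrite -(subrr (Q (avoid_prob B) y)); apply: cvgB => //; exact: cvg_cst.
move=> n.
have /andP[h0 h1] := fwd01 theta0 theta1 y (avoid_upto01 B n).
have /andP[g0 g1] := fwd_avoid01 B y.
have le_a : Q (avoid_prob B) y <= a n by apply: le_fwd => // z; exact: avoid_le.
by rewrite subr_ge0 le_pgf//= pgf_sub_le.
Qed.

Lemma avoid_in B y : y \in B -> avoid_prob B y = 0.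
Proof. by rewrite avoidE => ->. Qed.

Lemma avoid_notin B y : y \notin B -> avoid_prob B y = pgf m (Q (avoid_prob B) y).
Proof. by rewrite {1}avoidE => /negbTE ->. Qed.

Lemma avoid_fset0 y : avoid_prob fset0 y = 1.
Proof.
have e n x : stopped_gf fset0 (fun=> 0) 1 n x = 1.
  elim: n x => //= n ih x.
  have -> : Q (stopped_gf fset0 (fun=> 0) 1 n) x = Q (fun=> 1) x.
    by congr fwd; exact/funext.
  by rewrite fwd_cst// pgf1.
apply: (@cvg_unique_real _ (fun n => stopped_gf fset0 (fun=> 0) 1 n y)); first exact: avoid_cvg.
by under eq_fun do rewrite e; exact: cvg_cst.
Qed.

Lemma avoid_anti B K y : (B `<=` K)%fset -> avoid_prob K y <= avoid_prob B y.
Proof.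
move=> BK; apply: (@le_cvg _ (fun n => stopped_gf K (fun=> 0) 1 n y)
  (fun n => stopped_gf B (fun=> 0) 1 n y)) => [||n]; try exact: avoid_cvg.
elim: n y => //= n ih y.
have [yB|yB] := boolP (y \in B); first by rewrite (fsubsetP BK _ yB).
case: ifP => yK.
  by have /andP[] := pgf01 hm (fwd01 theta0 theta1 y (avoid_upto01 B n)).
have /andP[h0 h1] := fwd01 theta0 theta1 y (avoid_upto01 B n).
have /andP[g0 g1] := fwd01 theta0 theta1 y (avoid_upto01 K n).
by apply: le_pgf => //; exact: le_fwd.
Qed.

(** Convexity: among the increments over intervals of length t in [0, 1], the one ending at 1 is the
    largest. *)
Lemma pgf_add_le (s t : R) : 0 <= s -> 0 <= t -> s + t <= 1 ->
  pgf m (s + t) - pgf m s <= 1 - pgf m (1 - t).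
Proof.
move=> s0 t0 st1.
have e1 := @pgf_diff _ _ hm hnu s (s + t); have e2 := @pgf_diff _ _ hm hnu (1 - t) 1.
rewrite pgf1// in e2; rewrite -e1 -?e2; try (apply/andP; split; lra).
have -> : s + t - s = t by ring.
have -> : 1 - (1 - t) = t by ring.
by rewrite ler_wpM2l// le_bush_gf//; lra.
Qed.

(** Stopping at K and paying [avoid_prob B] there is consistent: beyond a first visit to K there is
    a fresh tree. The error at depth n is at most the probability that the tree reaches depth n. *)
Lemma stopped_gf_cvg B K y : (B `<=` K)%fset ->
  stopped_gf K (avoid_prob B) 1 n y @[n --> \oo] --> avoid_prob B y.
Proof.
move=> BK.
have s01 n x : 0 <= stopped_gf K (avoid_prob B) 1 n x <= 1.
  by apply: stopped_gf01 => // z; exact: avoid01.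
have h n x : avoid_prob B x <= stopped_gf K (avoid_prob B) 1 n x <=
    avoid_prob B x + survival m n.
  elim: n x => [|n ih] x.
    by rewrite /=; have := avoid01 B x; lra.
  have sv := survival01 hm n; have sv1 := survival01 hm n.+1.
  rewrite [stopped_gf _ _ _ _ _]/=; case: ifP => xK.
    by move: sv1; lra.
  have xB : x \notin B by apply/negP => /(fsubsetP BK); rewrite xK.
  rewrite (avoid_notin xB).
  have /andP[g0 g1] := fwd_avoid01 B x.
  have /andP[h0 h1] := fwd01 theta0 theta1 x (s01 n).
  have le1 : Q (avoid_prob B) x <= Q (stopped_gf K (avoid_prob B) 1 n) x.
    by apply: le_fwd => // z; have /andP[] := ih z.
  have le2 : Q (stopped_gf K (avoid_prob B) 1 n) x <= Q (avoid_prob B) x + survival m n.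
    rewrite -[X in _ + X](fwd_cst theta1 _ x) -fwdD.
    by apply: le_fwd => // z; have /andP[] := ih z.
  rewrite le_pgf//=.
  pose t := Q (stopped_gf K (avoid_prob B) 1 n) x - Q (avoid_prob B) x.
  have t0 : 0 <= t by rewrite subr_ge0.
  have := @pgf_add_le (Q (avoid_prob B) x) t g0 t0.
  rewrite /t [_ + (_ - _)]addrC subrK -/t => /(_ h1).
  have : pgf m (1 - survival m n) <= pgf m (1 - t) by apply: le_pgf => //; rewrite /t; lra.
  lra.
rewrite -[X in _ --> X]addr0.
have e n : stopped_gf K (avoid_prob B) 1 n y = avoid_prob B y +
    (stopped_gf K (avoid_prob B) 1 n y - avoid_prob B y) by rewrite addrC subrK.
under eq_fun do rewrite e.
apply: cvgD; first exact: cvg_cst.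
apply: (@squeeze0 _ _ (survival m)) => [n|]; last exact: survival_cvg hk0.
by have := h n y; lra.
Qed.

(** Without stopping and with weight 0 at depth n, only trees with no vertex at that depth count. *)
Lemma stopped_gf_survival n y :
  stopped_gf fset0 (fun=> 0) 0 n y = 1 - survival m n.
Proof.
elim: n y => [|n ih] y; first by rewrite /= subrr.
rewrite /=.
have -> : Q (stopped_gf fset0 (fun=> 0) 0 n) y = Q (fun=> 1 - survival m n) y.
  by congr fwd; exact/funext.
by rewrite fwd_cst//; ring.
Qed.

(** Where the value is 1 it is 1 at all sites one step away; by irreducibility it would be 1
    everywhere, yet it is 0 on B. *)
Lemma avoid_lt1 B y : B != fset0 -> avoid_prob B y < 1.
Proof.
move=> /fset0Pn[b bB]; have /andP[_ h1] := avoid01 B y.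
rewrite lt_def h1 andbT; apply/negP => /eqP /esym y1.
have : avoid_prob B b = 1.
  move: b {bB}; apply: (step_closed_full htheta (S := fun x => avoid_prob B x = 1)) y1 _.
  move=> x z x1 zs.
  have xB : x \notin B.
    by apply/negP => /avoid_in; rewrite x1 => /eqP; rewrite oner_eq0.
  move: x1; rewrite avoid_notin// => /(pgf_eq1 hm hnu hk0 (fwd_avoid01 B x)) /eqP.
  rewrite eq_sym -subr_eq0 -[X in X - _](fwd_cst theta1 1 x) -fwdB /fwd.
  rewrite psumr_eq0; last first.
    by move=> w _; rewrite mulr_ge0// subr_ge0; have /andP[] := avoid01 B (x + w).
  move=> /allP /(_ _ zs) /=; rewrite mulf_eq0 subr_eq0 => /orP[|/eqP//].
  by move: zs; rewrite mem_finsupp => /negbTE ->.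
by rewrite avoid_in// => /eqP; rewrite eq_sym oner_eq0.
Qed.

(** [f] weighs the children after the special one and [g] those before it. *)
Definition spine_rate K (f g : site d -> R) y : R :=
  if y \in K then 0 else bush_gf m (Q f y) (Q g y).

Lemma spine_rate01 K (f g : site d -> R) y :
  (forall z, 0 <= f z <= 1) -> (forall z, 0 <= g z <= 1) ->
  0 <= spine_rate K f g y <= 1.
Proof.
move=> f01 g01; rewrite /spine_rate; case: ifP => _; first by rewrite lexx ler01.
by apply: bush_gf01 => //; apply: fwd01.
Qed.

(* r K B y is the probability that the spine vertex at y avoids K, its subtrees
   of the past avoid K and its other subtrees avoid B. *)
Local Notation r K B := (spine_rate K (avoid_prob K) (avoid_prob B)).

Let r01 K B y : 0 <= r K B y <= 1.
Proof. by apply: spine_rate01 => z; exact: avoid01. Qed.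

(** The rate [s] is below the divided difference of [pgf] between 1 - Q w and 1. If [survival m n]
    <= Q w, that quotient is below the one between 1 - [survival m n] and 1, and the recursion of
    [survival] closes. Otherwise bounding the iterate by the supersolution [w] already gives 1 - pgf
    (1 - Q w), which is below the next survival probability. *)
Lemma iter_fwd_killed_le_survival (s u w : site d -> R) n y :
  (forall z, 0 <= s z) -> (forall z, 0 <= u z <= w z) -> (forall z, w z <= 1) ->
  (forall z, s z * Q w z <= w z) ->
  (forall z, s z <= bush_gf m (1 - Q w z) 1) ->
  0 <= iter n (fwd_killed theta s) u y <= survival m n.
Proof.
move=> s0 uw w1 sw sM.
have w0 z : 0 <= w z by have /andP[] := uw z; exact: le_trans.
have Qw z : 0 <= Q w z <= 1 by apply: fwd01 => // x; rewrite w0 w1.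
suff : forall n z, (0 <= iter n (fwd_killed theta s) u z <= w z) &&
    (iter n (fwd_killed theta s) u z <= survival m n).
  by move=> /(_ n y) /andP[/andP[-> _] ->].
elim=> {n y} [|n ih] y.
  by rewrite uw/=; have /andP[_ h] := uw y; exact: le_trans h (w1 y).
rewrite iterS {1 2 3}/fwd_killed.
set v := iter n _ u in ih *.
have v0 z : 0 <= v z by have /andP[/andP[]] := ih z.
have vw z : v z <= w z by have /andP[/andP[]] := ih z.
have vs z : v z <= survival m n by have /andP[] := ih z.
have Qv0 : 0 <= Q v y by exact: fwd_ge0.
have Qvw : Q v y <= Q w y by exact: le_fwd.
have Qvs : Q v y <= survival m n.
  by rewrite -[leRHS](fwd_cst theta1 _ y); exact: le_fwd.
rewrite mulr_ge0//= (le_trans _ (sw y)) ?ler_wpM2l//=.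
have sv := survival01 hm n; have Qw1 := Qw y.
have e (p : R) : 0 <= p <= 1 -> bush_gf m (1 - p) 1 * p = 1 - pgf m (1 - p).
  move=> p01; have := @pgf_diff _ _ hm hnu (1 - p) 1.
  rewrite pgf1// => <-; try (apply/andP; split; lra).
  by rewrite [in RHS]mulrC; congr (_ * _); ring.
have [pq|qp] := leP (survival m n) (Q w y).
- rewrite -e//; apply: ler_pM => //; apply: le_trans (sM y) _.
  by apply: le_bush_gf => //; lra.
- apply: (@le_trans _ _ (1 - pgf m (1 - Q w y))).
    by rewrite -e//; apply: ler_pM.
  rewrite lerB//; apply: le_pgf => //; lra.
Qed.

(** Iterating h = f + s Q h leaves an iterate of [h] as remainder, which is below [survival] and so
    tends to 0. *)
Lemma fwd_killed_series (s f h w : site d -> R) y :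
  (forall z, 0 <= s z) -> (forall z, 0 <= h z <= w z) -> (forall z, w z <= 1) ->
  (forall z, s z * Q w z <= w z) ->
  (forall z, s z <= bush_gf m (1 - Q w z) 1) ->
  (forall z, h z = f z + s z * Q h z) ->
  \sum_(0 <= n < N) iter n (fwd_killed theta s) f y @[N --> \oo] --> h y.
Proof.
move=> s0 hw w1 sw sM hh.
have e N z : \sum_(0 <= n < N) iter n (fwd_killed theta s) f z =
    h z - iter N (fwd_killed theta s) h z.
  elim: N z => [|N ih] z; first by rewrite big_nil subrr.
  rewrite big_nat_recl//.
  have -> : \sum_(0 <= i < N) iter i.+1 (fwd_killed theta s) f z =
     s z * Q (fun x => \sum_(0 <= i < N) iter i (fwd_killed theta s) f x) z.
    rewrite [in RHS]/fwd; under [X in _ * X]eq_bigr do rewrite mulr_sumr.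
    by rewrite exchange_big/= mulr_sumr.
  rewrite -[X in _ + s z * X](_ : Q h z - Q (iter N (fwd_killed theta s) h) z = _).
    have -> : iter N.+1 (fwd_killed theta s) h z =
      s z * Q (iter N (fwd_killed theta s) h) z by [].
    by rewrite [h z]hh /=; ring.
  rewrite -fwdB; congr fwd; apply/funext => x; exact/esym.
rewrite -[X in _ --> X]subr0; under eq_fun do rewrite e.
apply: cvgB; first exact: cvg_cst.
apply: (@squeeze0 _ _ (survival m)) => [n|]; last exact: survival_cvg hk0.
exact: (iter_fwd_killed_le_survival (w := w)).
Qed.

Section Identity.
Variables B K : {fset site d}.
Hypothesis BK : (B `<=` K)%fset.
Hypothesis Bn0 : B != fset0.

Local Notation gB := (avoid_prob B).
Local Notation gK := (avoid_prob K).
Local Notation rK := (r K fset0).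
Local Notation rB := (r B fset0).
Local Notation rKB := (r K B).
Local Notation e := (escape theta).

Let Qg0 y : Q (avoid_prob fset0) y = 1.
Proof.
rewrite -[RHS](fwd_cst theta1 1 y); congr fwd; apply/funext => z.
exact: avoid_fset0.
Qed.

Let rKB_le y : 0 <= rKB y <= rK y.
Proof.
have := r01 K B y; rewrite /spine_rate Qg0; case: ifP => _; first by rewrite lexx.
move=> /andP[-> _] /=; have /andP[? ?] := fwd_avoid01 B y.
by have /andP[? ?] := fwd_avoid01 K y; apply: le_bush_gf.
Qed.

Let Qg_le y : Q gK y <= Q gB y.
Proof. by apply: le_fwd => // z; exact: avoid_anti. Qed.

Let rK_le y : 0 <= rK y <= rB y.
Proof.
have := r01 K fset0 y; have := r01 B fset0 y; rewrite /spine_rate Qg0.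
have [yB|yB] := boolP (y \in B); first by rewrite (fsubsetP BK _ yB) lexx.
case: ifP => _; first by rewrite lexx => /andP[].
move=> _ /andP[-> _] /=; have /andP[? ?] := fwd_avoid01 B y.
by have /andP[? ?] := fwd_avoid01 K y; apply: le_bush_gf.
Qed.

Let rB_lt1 y : rB y < 1.
Proof.
rewrite /spine_rate Qg0; case: ifP => _; first exact: ltr01.
have /andP[h0 h1] := fwd_avoid01 B y.
apply: (bush_gf1_lt1 hnu hk0); rewrite h0/=.
rewrite -subr_gt0 -[X in X - _](fwd_cst theta1 1 y) -fwdB /fwd.
have : 0 < \sum_(z <- finsupp theta) theta z by rewrite theta1.
apply: contraTT; rewrite -!leNgt => h.
rewrite le_eqVlt; apply/orP; left; apply/eqP.
rewrite big_seq big1// => z zs.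
have gz : 0 < 1 - gB (y + z) by rewrite subr_gt0; exact: avoid_lt1.
have : \sum_(z <- finsupp theta) theta z * (1 - gB (y + z)) = 0.
  apply/eqP; rewrite eq_le h sumr_ge0// => w _.
  by rewrite mulr_ge0// subr_ge0; have /andP[] := avoid01 B (y + w).
move=> /eqP; rewrite psumr_eq0; last first.
  by move=> w _; rewrite mulr_ge0// subr_ge0; have /andP[] := avoid01 B (y + w).
move=> /allP /(_ _ zs) /=; rewrite mulf_eq0 => /orP[/eqP//|/eqP h0'].
by move: gz; rewrite h0' ltxx.
Qed.

(** On the finite set K both 1 - gB and 1 - rB are positive, and the sum of their inverses provides
    C; off K the bound is inherited through the recursion of the tree. *)
Let comparable_const : exists C : R, [/\ 1 <= C,
  forall y, 1 - gK y <= C * (1 - gB y) & forall y, 1 - rK y <= C * (1 - rB y)].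
Proof.
pose C : R := 1 + \sum_(y <- K) ((1 - gB y)^-1 + (1 - rB y)^-1).
have gp y : 0 < 1 - gB y by rewrite subr_gt0; exact: avoid_lt1.
have rp y : 0 < 1 - rB y by rewrite subr_gt0.
have tp y : 0 <= (1 - gB y)^-1 + (1 - rB y)^-1.
  by rewrite addr_ge0// invr_ge0 ltW.
have C1 : 1 <= C by rewrite lerDl sumr_ge0.
have CK y : y \in K -> (1 - gB y)^-1 + (1 - rB y)^-1 <= C.
  move=> yK; rewrite /C (big_fsetD1 y)//= addrCA lerDl addr_ge0//.
  exact: sumr_ge0.
have Cg y : y \in K -> 1 <= C * (1 - gB y).
  move=> yK; rewrite -ler_pdivrMr// mul1r; apply: le_trans (CK _ yK).
  by rewrite lerDl invr_ge0 ltW.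
have Cr y : y \in K -> 1 <= C * (1 - rB y).
  move=> yK; rewrite -ler_pdivrMr// mul1r; apply: le_trans (CK _ yK).
  by rewrite lerDr invr_ge0 ltW.
have hg y : 1 - gK y <= C * (1 - gB y).
  suff h n z : 1 - stopped_gf K (fun=> 0) 1 n z <= C * (1 - gB z).
    apply: (@cvg_le_cst _ (fun n => 1 - stopped_gf K (fun=> 0) 1 n y)) => //.
    by apply: cvgB; [exact: cvg_cst|exact: avoid_cvg].
  elim: n z => [|n ih] z.
    by rewrite /= subrr mulr_ge0//; [lra|exact: ltW].
  rewrite /=; have [zK|zK] := boolP (z \in K); first by rewrite subr0 Cg.
  have zB : z \notin B by apply/negP => /(fsubsetP BK); exact/negP.
  rewrite avoid_notin//; apply: (pgf_comparable hm hnu hk0) => //.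
  - by apply: fwd01 => // x; exact: avoid_upto01.
  - exact: fwd_avoid01.
  - rewrite -[X in X - _ <= _](fwd_cst theta1 1 z) -[X in C * (X - _)](fwd_cst theta1 1 z).
    by rewrite -!fwdB -fwdZ; apply: le_fwd.
exists C; split=> // y; have [yK|yK] := boolP (y \in K).
  by rewrite /spine_rate yK subr0 -/(spine_rate _ _ _ _) Cr.
have yB : y \notin B by apply/negP => /(fsubsetP BK); exact/negP.
rewrite /spine_rate (negbTE yK) (negbTE yB) Qg0.
apply: bush_gf_comparable => //; try exact: fwd_avoid01.
rewrite -[X in X - _ <= _](fwd_cst theta1 1 y) -[X in C * (X - _)](fwd_cst theta1 1 y).
by rewrite -!fwdB -fwdZ; apply: le_fwd.
Qed.

Let e01 (s : site d -> R) y : (forall z, 0 <= s z <= 1) -> 0 <= e s y <= 1.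
Proof. by move=> s01; apply: escape01. Qed.

(** A resolvent identity: [e rK] is fixed by the step killed with rK, so a step killed with [s]
    instead changes it by the reversed step of (rK - s) e rK. *)
Let telescope s N x : e rK x - iter N (bwd_killed theta s) (e rK) x =
  \sum_(0 <= n < N) iter n (bwd_killed theta s)
     (bwd theta (fun y => (rK y - s y) * e rK y)) x.
Proof.
elim: N => [|N ih]; first by rewrite big_nil subrr.
rewrite big_nat_recr//= -ih -iterS iterSr.
have -> : (bwd theta (fun y => (rK y - s y) * e rK y)) =
    (fun y => e rK y - bwd_killed theta s (e rK) y).
  apply/funext => y; rewrite [X in _ = X - _](escapeE theta0 theta1 (r01 K fset0)).
  rewrite /bwd_killed -bwdB; congr bwd; apply/funext => z; ring.
by rewrite iter_bwd_killedB; ring.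
Qed.

Let seriesB y : \sum_(0 <= n < N) iter n (fwd_killed theta rB)
  (fun z => (z \in B)%:R) y @[N --> \oo] --> 1 - gB y.
Proof.
apply: (@fwd_killed_series _ _ (fun z => 1 - gB z) (fun z => 1 - gB z)).
- by move=> z; have /andP[] := r01 B fset0 z.
- by move=> z; rewrite lexx andbT; have := avoid01 B z; lra.
- by move=> z; have := avoid01 B z; lra.
- move=> z; rewrite fwdB fwd_cst// /spine_rate Qg0.
  case: ifP => zB; first by rewrite mul0r; have := avoid01 B z; lra.
  rewrite mulrC pgf_diff//; try exact: fwd_avoid01.
  by rewrite pgf1// (avoid_notin (negbT zB)).
- move=> z; rewrite fwdB fwd_cst// /spine_rate Qg0 opprB addrC subrK.
  by case: ifP => // _; have := fwd_avoid01 B z => /bush_gf01 -/(_ _ hnu _ i11) /andP[].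
- move=> z; rewrite fwdB fwd_cst// /spine_rate Qg0.
  case: ifP => zB; first by rewrite avoid_in// mul0r subr0 addr0.
  rewrite add0r mulrC pgf_diff//; try exact: fwd_avoid01.
  by rewrite pgf1// (avoid_notin (negbT zB)).
Qed.

Let seriesKB y : \sum_(0 <= n < N) iter n (fwd_killed theta rKB)
  (fun z => (z \in K)%:R * gB z) y @[N --> \oo] --> gB y - gK y.
Proof.
(* The supersolution is 1 - gK, for which the larger rate rK is the exact divided difference off
   K. *)
apply: (@fwd_killed_series _ _ (fun z => gB z - gK z) (fun z => 1 - gK z)).
- by move=> z; have /andP[] := r01 K B z.
- move=> z; rewrite subr_ge0 avoid_anti//=.
  by rewrite lerB//; have /andP[] := avoid01 B z.
- by move=> z; have := avoid01 K z; lra.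
- move=> z; apply: (@le_trans _ _ (rK z * Q (fun x => 1 - gK x) z)).
    rewrite ler_wpM2r//; last by have /andP[] := rKB_le z.
    by apply: fwd_ge0 => // x; have := avoid01 K x; lra.
  rewrite fwdB fwd_cst// /spine_rate Qg0.
  case: ifP => zK; first by rewrite mul0r; have := avoid01 K z; lra.
  rewrite mulrC pgf_diff//; try exact: fwd_avoid01.
  by rewrite pgf1// (avoid_notin (negbT zK)).
- move=> z; apply: (@le_trans _ _ (rK z)); first by have /andP[] := rKB_le z.
  rewrite fwdB fwd_cst// /spine_rate Qg0 opprB addrC subrK.
  by case: ifP => // _; have := fwd_avoid01 K z => /bush_gf01 -/(_ _ hnu _ i11) /andP[].
- move=> z; rewrite fwdB /spine_rate.
  case: ifP => zK; first by rewrite (avoid_in zK) mul1r mul0r subr0 addr0.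
  have zB : z \notin B by apply/negP => /(fsubsetP BK); rewrite zK.
  rewrite mul0r add0r mulrC pgf_diff//; try exact: fwd_avoid01.
  by rewrite (avoid_notin (negbT zK)) (avoid_notin zB).
Qed.

(** With a = Q gK and b = Q gB, both sides equal (b - a)(1 - b) times the second divided difference
    of [pgf] at a, b, 1. *)
Let key y : y \notin K ->
  (rK y - rKB y) * (Q gB y - Q gK y) = (rB y - rK y) * (1 - Q gB y).
Proof.
move=> yK; have yB : y \notin B by apply/negP => /(fsubsetP BK); exact/negP.
rewrite /spine_rate (negbTE yK) (negbTE yB) Qg0.
have h1 := pgf_diff hm hnu (fwd_avoid01 K y) (fwd_avoid01 B y).
have h2 := pgf_diff hm hnu (fwd_avoid01 K y) i11.
have h3 := pgf_diff hm hnu (fwd_avoid01 B y) i11.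
by move: h1 h2 h3; rewrite pgf1//; nra.
Qed.

(* Both sides compute the rate of trajectories hitting B, rooted at the first
   visit to K on the left and at the first visit to B on the right. *)
Lemma escape_identity :
  \sum_(x <- K) (e rK x - gB x * e rKB x) = \sum_(x <- B) e rB x.
Proof.
have [C [C1 Cg Cr]] := comparable_const.
have C0 : 0 <= C by lra.
pose F1 y := (rK y - rKB y) * e rK y.
pose F2 y := (rB y - rK y) * e rK y.
have eK0 y : 0 <= e rK y by have /andP[] := e01 y (r01 K fset0).
have gB0 y : 0 <= gB y by have /andP[] := avoid01 B y.
have F10 y : 0 <= F1 y by rewrite mulr_ge0// subr_ge0; have /andP[] := rKB_le y.
have F20 y : 0 <= F2 y by rewrite mulr_ge0// subr_ge0; have /andP[] := rK_le y.
(* Telescoping with the rate rKB <= rK, where monotonicity alone makes the tail converge to e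
   rKB. *)
have P1 : pairing (Q (fun y => gB y - gK y)) F1 =
    (\sum_(x <- K) gB x * (e rK x - e rKB x))%:E.
  apply: (@pairing_series _ _ _ theta0 rKB K (fun z => (z \in K)%:R * gB z)) => //.
  - by move=> y; have /andP[] := r01 K B y.
  - by move=> y; rewrite mulr_ge0.
  - by move=> y /negbTE ->; rewrite mul0r.
  have E N : \sum_(0 <= n < N) \sum_(y <- K) (y \in K)%:R * gB y * iter n (bwd_killed theta rKB) (bwd theta F1) y
      = \sum_(y <- K) gB y * (e rK y - iter N (bwd_killed theta rKB) (e rK) y).
    rewrite exchange_big/= big_seq [RHS]big_seq; apply: eq_bigr => y yK.
    by rewrite telescope mulr_sumr; apply: eq_bigr => n _; rewrite yK mul1r.
  under eq_fun do rewrite E.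
  apply: (@cvg_bigsum _ _ _ (fun N y => gB y * (e rK y - iter N (bwd_killed theta rKB) (e rK) y))) => y.
  apply: cvgM; first exact: cvg_cst.
  apply: cvgB; first exact: cvg_cst.
  exact: iter_escape_cvg_le.
(* Here the rate rB is the larger one, and the convergence of the tail to e rB rests on the
   domination by [C]. *)
have P2 : pairing (Q (fun y => 1 - gB y)) F2 = (\sum_(x <- B) (e rB x - e rK x))%:E.
  apply: (@pairing_series _ _ _ theta0 rB B (fun z => (z \in B)%:R)) => //.
  - by move=> y; have /andP[] := r01 B fset0 y.
  - by move=> y /negbTE ->.
  have E N : \sum_(0 <= n < N) \sum_(y <- B) (y \in B)%:R * iter n (bwd_killed theta rB) (bwd theta F2) y
      = \sum_(y <- B) (iter N (bwd_killed theta rB) (e rK) y - e rK y).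
    rewrite exchange_big/= big_seq [RHS]big_seq; apply: eq_bigr => y yK.
    rewrite -opprB telescope -sumrN; apply: eq_bigr => n _; rewrite yK mul1r.
    elim: n y {yK} => [|n ih] y /=.
      by rewrite -[RHS]sub0r -(bwd_cst theta1 0 y) -bwdB; congr bwd; apply/funext => z; rewrite /F2; ring.
    rewrite -[RHS]sub0r -(bwd_cst theta1 0 y) -bwdB; congr bwd; apply/funext => z.
    by rewrite ih; ring.
  under eq_fun do rewrite E.
  apply: (@cvg_bigsum _ _ _ (fun N y => iter N (bwd_killed theta rB) (e rK) y - e rK y)) => y.
  apply: cvgB; last exact: cvg_cst.
  apply: (@iter_escape_cvg _ _ _ theta0 theta1 rK rB C y C0) => // z.
  apply: hit_comparable => //.
  by move=> w; have /andP[] := r01 B fset0 w.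
have gE y : y \in K -> rB y * (1 - Q gB y) = 1 - gB y - (y \in B)%:R.
  move=> yK; rewrite /spine_rate Qg0; case: ifP => yB.
    by rewrite avoid_in// mul0r /= mulr1n subr0 subrr.
  rewrite mulrC pgf_diff//; try exact: fwd_avoid01.
  by rewrite pgf1// -(avoid_notin (negbT yB)) mulr0n subr0.
(* Off K the integrands agree by [key]. On K both rK and rKB vanish, so the pairing with [F1] has no
   mass there, and the sum over K is the contribution of the pairing with [F2]. *)
have P3 : pairing (Q (fun y => 1 - gB y)) F2 =
   (pairing (Q (fun y => gB y - gK y)%R) F1 +
    (\sum_(x <- K) (1 - gB x - (x \in B)%:R) * e rK x)%R%:E)%E.
  pose H (y : site d) : R := if y \in K then 1 - gB y - (y \in B)%:R else 0.
  have H0 y : 0 <= H y.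
    rewrite /H; case: ifP => // yK; case: (boolP (y \in B)) => yB.
      by rewrite avoid_in//= subr0 mulr1n subrr.
    by rewrite mulr0n subr0 subr_ge0; have /andP[] := avoid01 B y.
  have -> : (\sum_(x <- K) (1 - gB x - (x \in B)%:R) * e rK x)%:E = pairing H (e rK).
    rewrite (pairing_fset (A := K))//; last by move=> y; rewrite /H => /negbTE ->.
    by congr EFin; rewrite big_seq [RHS]big_seq; apply: eq_bigr => y yK; rewrite /H yK.
  rewrite /pairing -esumD.
  - apply: eq_esum => z _; rewrite -EFinD; congr EFin.
    rewrite !fwdB fwd_cst// /F1 /F2 /H.
    case: ifP => zK; last first.
      rewrite mul0r addr0 mulrA [(1 - _) * _]mulrC -key ?zK//; ring.
    rewrite -gE//.
    have -> : rK z = 0 by rewrite /spine_rate zK.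
    have -> : rKB z = 0 by rewrite /spine_rate zK.
    ring.
  - move=> y _; rewrite lee_fin mulr_ge0//.
    by apply: fwd_ge0 => // z; rewrite subr_ge0 avoid_anti.
  - by move=> y _; rewrite lee_fin mulr_ge0.
have E3 := EFin_inj (etrans (esym P2) (etrans P3 (congr1 (fun t => t + _)%E P1))).
have -> : \sum_(x <- B) e rB x = \sum_(x <- B) (e rB x - e rK x) + \sum_(x <- B) e rK x.
  by rewrite -big_split/=; apply: eq_bigr => x _; rewrite subrK.
rewrite E3.
have -> : \sum_(x <- B) e rK x = \sum_(x <- K) (x \in B)%:R * e rK x.
  rewrite -(big_fset_incl _ BK); last by move=> x _ /negbTE ->; rewrite mul0r.
  by rewrite big_seq [RHS]big_seq; apply: eq_bigr => x ->; rewrite mul1r.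
rewrite -!big_split/=; apply: eq_bigr => x _.
move: ((x \in B)%:R) (e rK x) (e rKB x) (gB x) => a b c g; ring.
Qed.

End Identity.

End Avoidance.

(** * Independence *)

Section Independence.
Context (R : realType) (dO : measure_display) (Om : measurableType dO).
Variables (P : probability Om R) (I : choiceType) (F : I -> set (set Om)).
Hypothesis FT : forall i, F i setT.
Hypothesis FI : forall i, setI_closed (F i).
Hypothesis Fm : forall i A, F i A -> measurable A.
Hypothesis indepF : mutually_independent P F.
Implicit Types J : set I.

Definition cylinder J : set (set Om) := [set X | exists (S : {fset I}) (A : I -> set Om),
  (forall i, i \in S -> J i /\ F i (A i)) /\ X = \bigcap_(i in [set` S]) A i].

Definition sigma_of J : set (set Om) := <<s cylinder J >>.

(** Phrased as measurability on the generated measurable type, so that closure under products and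
    limits is inherited. *)
Definition adapted J (f : Om -> R) : Prop :=
  measurable_fun setT (f : g_sigma_algebraType (cylinder J) -> R).

Lemma cylinder_setT J : cylinder J setT.
Proof.
exists fset0, (fun=> setT); split=> //.
by apply/seteqP; split=> // w _ i.
Qed.

Lemma cylinder_setI J : setI_closed (cylinder J).
Proof.
move=> _ _ [S [A [hA ->]]] [S' [A' [hA' ->]]].
exists (S `|` S')%fset, (fun i => (if i \in S then A i else setT) `&`
                                  (if i \in S' then A' i else setT)); split.
  move=> i; rewrite in_fsetU => iS; split.
    by case/orP: iS => [/hA[]|/hA'[]].
  apply: FI; case: ifP => // iS'; first by have [] := hA _ iS'.
  by have [] := hA' _ iS'.
apply/seteqP; split=> w /=.
  move=> [h h'] i /=; rewrite in_fsetU => /orP[iS|iS]; split; case: ifP => // iS'.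
  - exact: h.
  - exact: h'.
  - exact: h.
  - exact: h'.
move=> h; split=> i /= iS.
  by have := h i; rewrite /= in_fsetU iS => /(_ isT)[].
by have := h i; rewrite /= in_fsetU iS orbT => /(_ isT)[].
Qed.

Lemma cylinder_measurable J : cylinder J `<=` measurable.
Proof.
move=> _ [S [A [hA ->]]]; apply: fin_bigcap_measurable => [|i /= iS].
  exact: finite_fset.
by have [_ /Fm] := hA _ iS.
Qed.

Lemma sigma_of_measurable J A : sigma_of J A -> measurable A.
Proof.
move=> h; apply: h; split; last exact: cylinder_measurable.
exact: sigma_algebra_measurable.
Qed.

Lemma sigma_ofS J J' : J `<=` J' -> sigma_of J `<=` sigma_of J'.
Proof.
move=> JJ; apply: sub_sigma_algebra2 => _ [S [A [hA ->]]]; exists S, A; split=> // i /hA[Ji Fi]; split=> //.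
exact: JJ.
Qed.

Lemma sigma_of_gen J i A : J i -> F i A -> sigma_of J A.
Proof.
move=> Ji Fi; apply: sub_sigma_algebra; exists [fset i]%fset, (fun=> A); split.
  by move=> k; rewrite inE => /eqP ->.
apply/seteqP; split=> w /= => [Aw k _ //|h].
by apply: (h i); rewrite /= inE.
Qed.

Lemma cylinder_indep J J' : J `&` J' = set0 -> forall A B,
  cylinder J A -> cylinder J' B -> P (A `&` B) = (P A * P B)%E.
Proof.
move=> JJ _ _ [S [A [hA ->]]] [S' [B [hB ->]]].
have SS : [disjoint S & S']%fset.
  apply/fdisjointP => i iS; apply/negP => iS'.
  have [Ji _] := hA _ iS; have [J'i _] := hB _ iS'.
  by have : (J `&` J') i by []; rewrite JJ.
pose C i := if i \in S then A i else B i.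
have eA : \bigcap_(i in [set` S]) A i = \bigcap_(i in [set` S]) C i.
  by apply: eq_bigcapr => i /= iS; rewrite /C iS.
have eB : \bigcap_(i in [set` S']) B i = \bigcap_(i in [set` S']) C i.
  apply: eq_bigcapr => i /= iS; rewrite /C.
  by case: ifP => // /(fdisjointP SS); rewrite iS.
have hC i : i \in (S `|` S')%fset -> F i (C i).
  rewrite in_fsetU /C; case: ifP => [/hA[]//|_ /= /hB[]//].
rewrite eA eB -bigcap_setU.
rewrite (_ : [set` S] `|` [set` S'] = [set` (S `|` S')%fset]); last first.
  by apply/seteqP; split=> i /=; rewrite in_fsetU => /orP.
rewrite !indepF//.
- rewrite (perm_big (S ++ S'))/=; first by rewrite big_cat.
  apply: uniq_perm => //; first by rewrite cat_uniq !fset_uniq andbT /=;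
    apply/hasPn => i iS' /=; apply: contraTN iS' => /(fdisjointP SS).
  by move=> i; rewrite mem_cat in_fsetU.
- by move=> i iS; apply: hC; rewrite in_fsetU iS orbT.
- by move=> i iS; apply: hC; rewrite in_fsetU iS.
Qed.

(** P restricted to B and P scaled by the mass of B are finite measures that agree on a pi-system,
    hence on the sigma-algebra it generates. *)
Let extend_indep (G : set (set Om)) (B : set Om) : setI_closed G -> G setT ->
  G `<=` measurable -> measurable B ->
  (forall A, G A -> P (A `&` B) = (P A * P B)%E) ->
  forall A, <<s G >> A -> P (A `&` B) = (P A * P B)%E.
Proof.
move=> GI GT Gm mB h A sA.
have fB : P B \is a fin_num by exact: fin_num_measure.
have pB : (0 <= fine (P B)) by rewrite fine_ge0.
pose m1 := mrestr P mB.
pose m2 := mscale (NngNum pB) P.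
have m2E X : m2 X = (P X * P B)%E by rewrite /m2 /mscale/= fineK// muleC.
rewrite -m2E -[LHS]/(m1 A).
apply: (g_sigma_algebra_measure_unique G Gm (fun=> setT)) => //.
- by rewrite bigcup_const//; exists 0%N.
- by move=> X GX; apply: etrans (h _ GX) (esym (m2E X)).
- by move=> _; rewrite /m1/= /mrestr setTI ltey_eq fB.
Qed.

Lemma sigma_of_indep J J' : J `&` J' = set0 -> forall A B,
  sigma_of J A -> sigma_of J' B -> P (A `&` B) = (P A * P B)%E.
Proof.
move=> JJ A B sA sB.
apply: (extend_indep (@cylinder_setI J) (cylinder_setT J) (@cylinder_measurable J)) sA.
  exact: sigma_of_measurable sB.
move=> {}A cA; rewrite setIC muleC.
apply: (extend_indep (@cylinder_setI J') (cylinder_setT J') (@cylinder_measurable J')) sB.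
  exact: cylinder_measurable cA.
by move=> {}B cB; rewrite setIC muleC; apply: cylinder_indep JJ _ _ cA cB.
Qed.

Lemma adaptedP J f : adapted J f <-> forall B, measurable B -> sigma_of J (f @^-1` B).
Proof.
split=> [h B mB|h _ B mB]; last by rewrite setTI; exact: h.
by have := h measurableT B mB; rewrite setTI.
Qed.

Lemma adapted_measurable J f : adapted J f -> measurable_fun setT f.
Proof.
move=> /adaptedP h _ B mB; rewrite setTI; apply: (@sigma_of_measurable J).
exact: h.
Qed.

Lemma adaptedS J J' f : J `<=` J' -> adapted J f -> adapted J' f.
Proof.
move=> JJ /adaptedP h; apply/adaptedP => B mB; apply: (sigma_ofS JJ).
exact: h.
Qed.

Lemma adapted_cst J (c : R) : adapted J (fun=> c).
Proof. exact: measurable_cst. Qed.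

Lemma adaptedM J f g : adapted J f -> adapted J g -> adapted J (fun w => f w * g w).
Proof. exact: measurable_funM. Qed.

Lemma adapted_prod J (T : Type) (s : seq T) (f : T -> Om -> R) :
  (forall t, adapted J (f t)) -> adapted J (fun w => \prod_(t <- s) f t w).
Proof.
move=> h; elim: s => [|t s ih].
  by under eq_fun do rewrite big_nil; exact: adapted_cst.
by under eq_fun do rewrite big_cons; exact: adaptedM.
Qed.

Lemma adapted_bind J (E : countType) (Z : Om -> E) (G : E -> Om -> R) :
  (forall a, sigma_of J (Z @^-1` [set a])) -> (forall a, adapted J (G a)) ->
  adapted J (fun w => G (Z w) w).
Proof.
move=> hZ hG; apply/adaptedP => B mB.
have -> : (fun w => G (Z w) w) @^-1` B =
    \bigcup_(a in [set: E]) (Z @^-1` [set a] `&` G a @^-1` B).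
  apply/seteqP; split=> w /=; first by move=> h; exists (Z w).
  by move=> [a _ [<-]].
apply: (@countable_bigcupT_measurable _ (g_sigma_algebraType (cylinder J))).
  exact: countableP.
move=> a; apply: measurableI; first exact: hZ.
exact: (adaptedP _ _).1 (hG a) _ mB.
Qed.

(** The joint law agrees with the product of the laws on rectangles, hence everywhere; Tonelli's
    theorem then splits the integral. *)
Lemma integralM_indep J J' f g : J `&` J' = set0 -> adapted J f -> adapted J' g ->
  (forall w, 0 <= f w) -> (forall w, 0 <= g w) ->
  (\int[P]_w (f w * g w)%:E = \int[P]_w (f w)%:E * \int[P]_w (g w)%:E)%E.
Proof.
move=> JJ af ag f0 g0.
have mf := adapted_measurable af; have mg := adapted_measurable ag.
have mfg : measurable_fun setT (fun w => (f w, g w)) by exact: measurable_fun_pair.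
pose Mf := isMeasurableFun.Build _ _ Om R f mf.
pose Mg := isMeasurableFun.Build _ _ Om R g mg.
pose Mfg := isMeasurableFun.Build _ _ Om (R * R)%type _ mfg.
pose f' : {mfun Om >-> R} := HB.pack f Mf.
pose g' : {mfun Om >-> R} := HB.pack g Mg.
pose fg' : {mfun Om >-> (R * R)%type} := HB.pack (fun w => (f w, g w)) Mfg.
(* The positive part makes the integrand nonnegative on the whole plane without changing it at the
   values of [f] and [g]. *)
pose h1 (x : R) := Num.max 0 x.
have mh1 : measurable_fun setT h1.
  by apply: measurable_maxr; [exact: measurable_cst|exact: measurable_id].
have h10 x : 0 <= h1 x by rewrite /h1 le_max lexx.
have h1E x : 0 <= x -> h1 x = x by move=> x0; rewrite /h1 max_r.
pose h (z : R * R) := (h1 z.1 * h1 z.2)%:E.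
have mh : measurable_fun setT h.
  apply/measurable_EFinP; apply: measurable_funM.
    by apply: (measurableT_comp mh1); exact: measurable_fst.
  by apply: (measurableT_comp mh1); exact: measurable_snd.
have h0 z : (0 <= h z)%E by rewrite lee_fin mulr_ge0.
transitivity (\int[distribution P fg']_z h z)%E.
  rewrite ge0_integral_distribution//; apply: eq_integral => w _ /=.
  by rewrite /h /= !h1E.
transitivity (\int[(distribution P f' \x distribution P g')%E]_z h z)%E.
  apply: eq_measure_integral => A mA _; apply/esym.
  apply: product_measure_unique => // B C mB mC.
  have := sigma_of_indep JJ ((adaptedP _ _).1 af _ mB) ((adaptedP _ _).1 ag _ mC).
  by [].
rewrite fubini_tonelli1// /fubini_F /=.
under eq_integral => x _.
  rewrite /h /=.
  under eq_integral do rewrite EFinM.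
  rewrite ge0_integralZl_EFin//; last 2 first.
  - by move=> y _; rewrite lee_fin.
  - by apply/measurable_EFinP.
  rewrite muleC.
  over.
rewrite /= ge0_integralZl//; last 3 first.
- by apply/measurable_EFinP.
- by move=> x _; rewrite lee_fin.
- by apply: integral_ge0 => x _; rewrite lee_fin.
have mE : measurable_fun setT (EFin \o h1) by apply/measurable_EFinP.
have E0 x : (0 <= (EFin \o h1) x)%E by rewrite lee_fin.
have := ge0_integral_distribution f' mE E0.
have := ge0_integral_distribution g' mE E0.
rewrite /= => -> ->; rewrite muleC; congr (_ * _)%E.
- by apply: eq_integral => w _ /=; rewrite h1E.
- by apply: eq_integral => w _ /=; rewrite h1E.
Qed.

Lemma integral_prod_indep (T : eqType) (s : seq T) (J_ : T -> set I) (f : T -> Om -> R) :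
  uniq s -> {in s &, forall t t', t != t' -> J_ t `&` J_ t' = set0} ->
  (forall t, adapted (J_ t) (f t)) -> (forall t w, 0 <= f t w) ->
  (\int[P]_w (\prod_(t <- s) f t w)%:E = \prod_(t <- s) \int[P]_w (f t w)%:E)%E.
Proof.
move=> us dJ af f0.
elim: s us dJ => [|t s ih] /=.
  move=> _ _; rewrite big_nil.
  under eq_integral do rewrite big_nil.
  by rewrite integral_cst//= mul1e probability_setT.
move=> /andP[ts us] dJ; rewrite big_cons -ih//; last first.
  by move=> a b sa sb; apply: dJ; rewrite inE ?sa ?sb orbT.
under eq_integral do rewrite big_cons.
apply: (@integralM_indep (J_ t) (\bigcup_(t' in [set` s]) J_ t') (f t) (fun w => \prod_(j <- s) f j w)) => //.
- rewrite setI_bigcupr bigcup0// => t' /= st'; apply: dJ.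
  + by rewrite inE eqxx.
  + by rewrite inE st' orbT.
  + by apply: contraNneq ts => ->.
- have -> : (fun w : Om => \prod_(j <- s) f j w) =
      (fun w : Om => \prod_(j <- s) if j \in s then f j w else 1).
    by apply/funext => w; rewrite big_seq [RHS]big_seq; apply: eq_bigr => j ->.
  apply: (@adapted_prod _ _ _ (fun j w => if j \in s then f j w else 1)) => t'.
  case st' : (t' \in s); last exact: adapted_cst.
  by apply: adaptedS (af t') => i Ji; exists t'.
- by move=> w; apply: prodr_ge0.
Qed.

(** Conditioning on [Z]: on each fibre the integrand is an indicator determined by J times a
    function determined by J'. *)
Lemma integral_bind_indep J J' (E : countType) (Z : Om -> E) (G : E -> Om -> R)
    (p : E -> R) (g : E -> R) : J `&` J' = set0 ->
  (forall a, sigma_of J (Z @^-1` [set a])) ->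
  (forall a, P (Z @^-1` [set a]) = (p a)%:E) ->
  (forall a, adapted J' (G a)) -> (forall a w, 0 <= G a w) ->
  (forall a, \int[P]_w (G a w)%:E = (g a)%:E)%E ->
  (\int[P]_w (G (Z w) w)%:E = \esum_(a in [set: E]) (p a * g a)%:E)%E.
Proof.
move=> JJ sZ pZ aG G0 gG.
have mZ a : measurable (Z @^-1` [set a]) by exact: sigma_of_measurable (sZ a).
have aGZ : adapted (J `|` J') (fun w => G (Z w) w).
  apply: adapted_bind => a; first by apply: (sigma_ofS _ (sZ a)) => i; left.
  by apply: (adaptedS _ (aG a)) => i; right.
have mGZ := adapted_measurable aGZ.
(* Fibres are indexed by [pickle] so as to form a sequence; a number that is not a code gives an
   empty fibre. *)
pose D (k : nat) := [set w | choice.pickle (Z w) = k].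
have DE a : D (choice.pickle a) = Z @^-1` [set a].
  apply/seteqP; split=> w /=; [exact: (pcan_inj choice.pickleK)|by move=> <-].
have D0 k : ~ (choice.pickle @` [set: E]) k -> D k = set0.
  by move=> nk; apply/seteqP; split=> // w /= Dw; apply: nk; exists (Z w).
have mD k : measurable (D k).
  by have [[a _ <-]|/D0 ->//] := pselect ((choice.pickle @` [set: E]) k); rewrite DE.
have DT : \bigcup_k D k = setT.
  by apply/seteqP; split=> // w _; exists (choice.pickle (Z w)).
have trD : trivIset setT D.
  apply/trivIsetP => i j _ _ ij; apply/seteqP; split=> // w /= [hi hj].
  by move: ij; rewrite -hi -hj eqxx.
have iD a : (\int[P]_(w in Z @^-1` [set a]) (G (Z w) w)%:E = (p a * g a)%:E)%E.
  transitivity (\int[P]_w (\1_(Z @^-1` [set a]) w * G a w)%:E)%E.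
    rewrite integral_mkcond; apply: eq_integral => w _.
    rewrite patchE indicE; case: ifPn => [|_]; last by rewrite mul0r.
    by rewrite inE /= => ->; rewrite mul1r.
  rewrite (integralM_indep JJ _ (aG a))//; last first.
    apply/adaptedP => B mB.
    have mZ' : @measurable _ (g_sigma_algebraType (cylinder J)) (Z @^-1` [set a]) by exact: sZ.
    have := measurable_indic mZ' => /(_ R setT measurableT B mB).
    by rewrite setTI.
  rewrite gG integral_indic// setIT; exact: (congr1 (fun t => t * (g a)%:E)%E (pZ a)).
transitivity (\int[P]_(w in \bigcup_k D k) (G (Z w) w)%:E)%E; first by rewrite DT.
rewrite ge0_integral_bigcup//; last 2 first.
- by rewrite DT; apply/measurable_EFinP.
- by move=> w _; rewrite lee_fin.
have p0 a : 0 <= p a by rewrite -lee_fin -pZ.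
have g0 a : 0 <= g a.
  by rewrite -lee_fin -gG integral_ge0// => w _; rewrite lee_fin.
rewrite nneseries_esumT; last first.
  by move=> k; apply: integral_ge0 => w _; rewrite lee_fin.
rewrite (esumID (choice.pickle @` [set: E])); last first.
  by move=> k _; apply: integral_ge0 => w _; rewrite lee_fin.
rewrite !setTI [X in (_ + X)%E]esum1 ?adde0; last first.
  by move=> k nk; rewrite D0// integral_set0.
rewrite esum_image; last first.
  by move=> a b _ _ /(pcan_inj choice.pickleK).
by apply: eq_esum => a _; rewrite DE iD.
Qed.

Lemma integral_bind_indep_real J J' (E : countType) (Z : Om -> E) (G : E -> Om -> R)
    (p : E -> R) (g : E -> R) : J `&` J' = set0 ->
  (forall a, sigma_of J (Z @^-1` [set a])) ->
  (forall a, P (Z @^-1` [set a]) = (p a)%:E) ->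
  (forall a, adapted J' (G a)) -> (forall a w, 0 <= G a w <= 1) ->
  (forall a, \int[P]_w (G a w)%:E = (g a)%:E)%E ->
  (\int[P]_w (G (Z w) w)%:E = (pmf_mean p g)%:E)%E.
Proof.
move=> JJ sZ pZ aG G01 gG.
have G0 a w : 0 <= G a w by have /andP[] := G01 a w.
rewrite /pmf_mean -(integral_bind_indep JJ sZ pZ aG G0 gG) fineK//.
have aGZ : adapted (J `|` J') (fun w => G (Z w) w).
  apply: adapted_bind => a; first by apply: (sigma_ofS _ (sZ a)) => i; left.
  by apply: (adaptedS _ (aG a)) => i; right.
rewrite ge0_fin_numE; last by apply: integral_ge0 => w _; rewrite lee_fin.
apply: (@le_lt_trans _ _ (\int[P]_w 1)%E).
  apply: ge0_le_integral => //.
  - by move=> w _; rewrite lee_fin.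
  - by apply/measurable_EFinP; exact: adapted_measurable aGZ.
  - by move=> w _; rewrite lee_fin; have /andP[] := G01 (Z w) w.
by rewrite integral_cst//= mul1e probability_setT ltry.
Qed.

End Independence.

Lemma events_ofT (Om E : Type) (Z : Om -> E) : events_of Z setT.
Proof. by exists setT => //; rewrite preimage_setT. Qed.

Lemma events_ofI (Om E : Type) (Z : Om -> E) : setI_closed (events_of Z).
Proof.
by move=> _ _ [A _ <-] [B _ <-]; exists (A `&` B) => //; rewrite preimage_setI.
Qed.

Lemma events_of_measurable (R : realType) (dO : measure_display)
    (Om : measurableType dO) (P : probability Om R) (E : Type) (Z : Om -> E) p A :
  has_law P Z p -> events_of Z A -> measurable A.
Proof. by move=> [h _] [B _ <-]; exact: h. Qed.

Section Law.
Context (R : realType) (dO : measure_display) (Om : measurableType dO).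
Variables (P : probability Om R) (E : countType) (Z : Om -> E) (p : E -> R).
Hypothesis law_Z : has_law P Z p.

Lemma integral_law (f : E -> R) : (forall a, 0 <= f a) ->
  (\int[P]_w (f (Z w))%:E = \esum_(a in [set: E]) (p a * f a)%:E)%E.
Proof.
move=> f0; have [mZ pZ] := law_Z.
(* A single variable is trivially an independent family, so conditioning on it with constant [G]
   gives the formula. *)
pose F (_ : unit) := events_of Z.
have indepF : mutually_independent P F.
  move=> J A hA.
  have [->|[u uJ]] := fset_0Vmem J.
    by rewrite set_fset0 bigcap_set0 big_seq_fset0 probability_setT.
  have -> : J = [fset tt]%fset.
    by apply/fsetP => -[]; rewrite !inE; case: u uJ => ->.
  rewrite big_seq_fset1; congr (P _); apply/seteqP; split=> w /=.
    by move=> h; apply: (h tt); apply/fset1P.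
  by move=> Aw [].
have FT i : F i setT by exact: events_ofT.
have FI i : setI_closed (F i) by exact: events_ofI.
have Fm i A : F i A -> measurable A by exact: events_of_measurable law_Z.
apply: (@integral_bind_indep _ _ _ P _ F FT FI Fm indepF setT set0 E Z (fun a _ => f a)) => //.
- by rewrite setI0.
- by move=> a; apply: (@sigma_of_gen _ _ _ F setT tt) => //; exists [set a].
- by move=> a; exact: adapted_cst.
- by move=> a; rewrite integral_cst//= probability_setT mule1.
Qed.

Lemma is_pmf_law : is_pmf p.
Proof.
have [mZ pZ] := law_Z; split=> [a|]; first by rewrite -lee_fin -pZ.
have := @integral_law (fun=> 1) (fun=> ler01).
rewrite integral_cst//= mul1e probability_setT => ->.
by apply: eq_esum => a _; rewrite mulr1.
Qed.

End Law.

(** * Expectations of functionals of the trees *)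

Lemma pmf_mean_fsfun (R : realType) (T : choiceType) (p : {fsfun T -> R with 0})
    (f : T -> R) : (forall x, 0 <= p x) -> (forall x, 0 <= f x) ->
  pmf_mean p f = \sum_(x <- finsupp p) p x * f x.
Proof.
move=> p0 f0; rewrite /pmf_mean (esumID [set` finsupp p])//; last first.
  by move=> x _; rewrite lee_fin mulr_ge0.
rewrite !setTI [X in (_ + X)%E]esum1 ?adde0; last first.
  by move=> x /negP; rewrite mem_finsupp negbK => /eqP ->; rewrite mul0r.
rewrite esum_fset//; last by move=> x _; rewrite lee_fin mulr_ge0.
by rewrite fsbig_finite//= set_fsetK sumEFin.
Qed.

Lemma prod01 (R : realType) (T : Type) (s : seq T) (f : T -> R) :
  (forall t, 0 <= f t <= 1) -> 0 <= \prod_(t <- s) f t <= 1.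
Proof.
move=> h; elim: s => [|t s ih]; first by rewrite big_nil ler01 lexx.
by rewrite big_cons; apply: mul01.
Qed.

Section BushValue.
Variables (R : realType) (d : nat) (K : {fset site d}) (alpha : site d -> R).

(** Pathwise counterpart of [stopped_gf]. Labels stay absolute, [v] being the root of the explored
    subtree, so that one can read off which variables the value depends on. *)
Fixpoint bush_val (e : R) (c : vertex -> nat) (s : vertex -> site d) n y v : R :=
  if n is n'.+1 then
    if y \in K then alpha y else
    \prod_(i <- iota 0 (c v)) bush_val e c s n' (y + s (rcons v i)) (rcons v i)
  else e.

Lemma bush_val01 e c s n y v : (forall z, 0 <= alpha z <= 1) -> 0 <= e <= 1 ->
  0 <= bush_val e c s n y v <= 1.
Proof.
move=> a01 e01; elim: n y v => //= n ih y v; case: ifP => // _.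
by apply: prod01 => i; exact: ih.
Qed.

End BushValue.

Lemma prodEFin_cst (R : realType) (T : Type) (s : seq T) (x : R) :
  (\prod_(i <- s) x%:E)%E = (x ^+ size s)%:E.
Proof.
elim: s => [|a s ih]; first by rewrite big_nil.
by rewrite big_cons ih/= exprS EFinM.
Qed.

Lemma rcons_prefix_disjoint (v w : vertex) i j :
  prefix (rcons v i) w -> prefix (rcons v j) w -> i = j.
Proof.
move=> /prefixP[a ->] /prefixP[b]; rewrite !cat_rcons => /eqP.
by rewrite eqseq_cat// => /andP[_ /eqP[]].
Qed.

Lemma prefix_rconsN (v : vertex) j : prefix (rcons v j) v = false.
Proof.
by apply/negP => /prefixP[x /(congr1 size)]; rewrite size_cat size_rcons; lia.
Qed.

Section GaltonWatson.
Context (R : realType) (dO : measure_display) (Om : measurableType dO).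
Variables (P : probability Om R) (I : choiceType) (F : I -> set (set Om)).
Hypothesis FT : forall i, F i setT.
Hypothesis FI : forall i, setI_closed (F i).
Hypothesis Fm : forall i A, F i A -> measurable A.
Hypothesis indepF : mutually_independent P F.
Variables (d : nat) (m : nat -> R) (theta : {fsfun site d -> R with 0}).
Variables (c : vertex -> Om -> nat) (s : vertex -> Om -> site d).
Variables (ic is_ : vertex -> I).
Hypothesis Fc : forall v, F (ic v) = events_of (c v).
Hypothesis Fs : forall v, F (is_ v) = events_of (s v).
Hypothesis ic_inj : injective ic.
Hypothesis is_inj : injective is_.
Hypothesis ic_is : forall v w, ic v <> is_ w.
Hypothesis law_c : forall v, has_law P (c v) m.
Hypothesis law_s : forall v, has_law P (s v) theta.
Variables (K : {fset site d}) (alpha : site d -> R) (e : R).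
Hypothesis alpha01 : forall z, 0 <= alpha z <= 1.
Hypothesis e01 : 0 <= e <= 1.

(** [subtree_keys v] includes the step on the edge into [v] and [bush_keys v] does not: in the
    latter case the position of [v] is already given. *)
Definition subtree_keys (v : vertex) : set I :=
  [set i | exists2 w, prefix v w & i = ic w \/ i = is_ w].
Definition bush_keys (v : vertex) : set I :=
  [set i | exists2 w, prefix v w & i = ic w \/ (i = is_ w /\ w != v)].

Definition bush_var n y v (w : Om) : R :=
  bush_val K alpha e (c^~ w) (s^~ w) n y v.

Lemma bush_var01 n y v w : 0 <= bush_var n y v w <= 1.
Proof. exact: bush_val01. Qed.

Lemma sigma_of_c J v a : J (ic v) -> sigma_of F J (c v @^-1` [set a]).
Proof. by move=> Jv; apply: (@sigma_of_gen _ _ _ F J (ic v)) => //; rewrite Fc; exists [set a]. Qed.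

Lemma sigma_of_s J v a : J (is_ v) -> sigma_of F J (s v @^-1` [set a]).
Proof. by move=> Jv; apply: (@sigma_of_gen _ _ _ F J (is_ v)) => //; rewrite Fs; exists [set a]. Qed.

Lemma bush_keys_sub v : bush_keys v `<=` subtree_keys v.
Proof. by move=> i [w vw h]; exists w => //; case: h => [->|[-> _]]; [left|right]. Qed.

Lemma subtree_keys_sub v j : subtree_keys (rcons v j) `<=` bush_keys v.
Proof.
move=> i [w vw h]; exists w.
  by apply: prefix_trans vw; exact: prefix_rcons.
case: h => [->|->]; [by left|right; split=> //].
by apply: contraTneq vw => ->; rewrite prefix_rconsN.
Qed.

Lemma subtree_keys_disjoint v j j' : j != j' ->
  subtree_keys (rcons v j) `&` subtree_keys (rcons v j') = set0.
Proof.
move=> jj; apply/seteqP; split=> // i [[w vw h] [w' vw' h']].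
suff ww : w = w' by move: jj; rewrite -ww in vw'; rewrite (rcons_prefix_disjoint vw vw') eqxx.
case: h h' => -> [] h; try exact: ic_inj; try exact: is_inj.
- by case: (ic_is h).
- by case: (ic_is (esym h)).
Qed.

Lemma bush_var_rec n y v w : bush_var n.+1 y v w =
  if y \in K then alpha y else
  \prod_(i <- iota 0 (c v w)) bush_var n (y + s (rcons v i) w) (rcons v i) w.
Proof. by []. Qed.

Lemma adapted_bush_step n y v : (forall y, adapted F (bush_keys v) (bush_var n y v)) ->
  adapted F (subtree_keys v) (fun w => bush_var n (y + s v w) v w).
Proof.
move=> h; apply: (adapted_bind (Z := s v) (G := fun z => bush_var n (y + z) v)).
- by move=> a; apply: sigma_of_s; exists v; [exact: prefix_refl|right].
- by move=> a; apply: adaptedS (h _); exact: bush_keys_sub.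
Qed.

Lemma adapted_bush n y v : adapted F (bush_keys v) (bush_var n y v).
Proof.
elim: n y v => [|n ih] y v; first exact: adapted_cst.
have [yK|yK] := boolP (y \in K).
  have -> : bush_var n.+1 y v = fun=> alpha y.
    by apply/funext => w; rewrite bush_var_rec yK.
  exact: adapted_cst.
have -> : bush_var n.+1 y v = fun w =>
    \prod_(i <- iota 0 (c v w)) bush_var n (y + s (rcons v i) w) (rcons v i) w.
  by apply/funext => w; rewrite bush_var_rec (negbTE yK).
apply: (adapted_bind (Z := c v) (G := fun k w =>
   \prod_(i <- iota 0 k) bush_var n (y + s (rcons v i) w) (rcons v i) w)).
  by move=> a; apply: sigma_of_c; exists v; [exact: prefix_refl|left].
move=> k; apply: adapted_prod => i; apply: adaptedS (adapted_bush_step _ _).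
  exact: subtree_keys_sub.
by move=> z; exact: ih.
Qed.

Lemma theta_pmf (v : vertex) : is_pmf theta.
Proof. exact: is_pmf_law (law_s v). Qed.

Lemma integral_bush_step n y v g : (forall y, \int[P]_w (bush_var n y v w)%:E = (g y)%:E)%E ->
  (\int[P]_w (bush_var n (y + s v w) v w)%:E = (fwd theta g y)%:E)%E.
Proof.
move=> h; have [t0 t1] := theta_pmf v.
have g0 z : 0 <= g z.
  by rewrite -lee_fin -h integral_ge0// => w _; rewrite lee_fin; have /andP[] := bush_var01 n z v w.
rewrite /fwd -(pmf_mean_fsfun (f := fun z => g (y + z)))//.
apply: (integral_bind_indep_real FT FI Fm indepF (J := [set is_ v]) (J' := bush_keys v)
  (Z := s v) (G := fun z => bush_var n (y + z) v)).
- apply/seteqP; split=> // i /= [-> [w vw [/esym /ic_is//|[/is_inj ->]]]].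
  by rewrite eqxx.
- by move=> a; exact: sigma_of_s.
- by move=> a; have [_ ->] := law_s v.
- by move=> a; exact: adapted_bush.
- by move=> a w; exact: bush_var01.
- by move=> a; rewrite h.
Qed.

(** Once the number of children is fixed by conditioning, the child subtrees involve disjoint sets
    of variables. *)
Lemma integral_bush n y v :
  (\int[P]_w (bush_var n y v w)%:E = (stopped_gf theta m K alpha e n y)%:E)%E.
Proof.
elim: n y v => [|n ih] y v.
  rewrite /bush_var /=; under eq_integral do rewrite /=.
  by rewrite integral_cst//= probability_setT mule1.
have [yK|yK] := boolP (y \in K).
  rewrite /= yK; under eq_integral do rewrite bush_var_rec yK.
  by rewrite integral_cst//= probability_setT mule1.
rewrite /= (negbTE yK); under eq_integral do rewrite bush_var_rec (negbTE yK).
apply: (integral_bind_indep_real FT FI Fm indepF (J := [set ic v])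
  (J' := \bigcup_j subtree_keys (rcons v j)) (Z := c v)
  (G := fun k w => \prod_(i <- iota 0 k) bush_var n (y + s (rcons v i) w) (rcons v i) w)).
- apply/seteqP; split=> // i /= [-> [j _ [w vw [/ic_inj h|/ic_is//]]]].
  by move: vw; rewrite -h prefix_rconsN.
- by move=> a; exact: sigma_of_c.
- by move=> a; have [_ ->] := law_c v.
- move=> k; apply: adapted_prod => i; apply: adaptedS (adapted_bush_step _ _).
    by move=> j h; exists i.
  by move=> z; exact: adapted_bush.
- by move=> k w; apply: prod01 => i; exact: bush_var01.
move=> k.
rewrite (integral_prod_indep FT FI Fm indepF (J_ := fun i => subtree_keys (rcons v i))
  (f := fun i w => bush_var n (y + s (rcons v i) w) (rcons v i) w)).
- under eq_bigr => i _ do rewrite (integral_bush_step _ (fun z => ih z (rcons v i))).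
  by rewrite prodEFin_cst size_iota.
- exact: iota_uniq.
- by move=> i j _ _; exact: subtree_keys_disjoint.
- by move=> i; apply: adapted_bush_step => z; exact: adapted_bush.
- by move=> i w; have /andP[] := bush_var01 n (y + s (rcons v i) w) (rcons v i) w.
Qed.

End GaltonWatson.

(** * Expectations along the random spine *)

Section SpineValue.
Variables (R : realType) (d : nat) (K : {fset site d}) (alpha : site d -> R).
Variable n : nat.

Definition side_weight (i a : nat) : site d -> R :=
  if (i < a)%N then alpha else fun=> 0.

(* N levels of the spine, starting from the vertex v of level l at x: subtrees
   hanging off before the spine get the weight alpha at their first visits to
   K, the others (and the spine itself) must avoid K; bushes are explored up to
   depth n. *)
Fixpoint spine_val (T : vtree_walk d) N x v l : R :=
  if N is N'.+1 then
    if x \in K then 0 else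
    \prod_(i <- iota 0 ((vspine T l).1 + (vspine T l).2).+1)
      if i == (vspine T l).1 then
        spine_val T N' (x - vstep T (rcons v (vspine T l).1))
          (rcons v (vspine T l).1) l.+1
      else bush_val K (side_weight i (vspine T l).1) 1 (vnchild T) (vstep T) n
             (x + vstep T (rcons v i)) (rcons v i)
  else 1.

(** The bushes at the root carry no weight: the path to infinity from any of their vertices passes
    through the root, which is placed in K. *)
Definition root_val (T : vtree_walk d) N x : R :=
  spine_val T N (x - vstep T [:: (vspine T 0).1]) [:: (vspine T 0).1] 1.

Hypothesis alpha01 : forall z, 0 <= alpha z <= 1.

Lemma side_weight01 i a z : 0 <= side_weight i a z <= 1.
Proof. by rewrite /side_weight; case: ifP => // _; rewrite lexx ler01. Qed.

Lemma spine_val01 T N x v l : 0 <= spine_val T N x v l <= 1.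
Proof.
elim: N x v l => [|N ih] x v l /=; first by rewrite ler01 lexx.
case: ifP => _; first by rewrite lexx ler01.
apply: prod01 => i; case: ifP => _; first exact: ih.
by apply: bush_val01; [exact: side_weight01|rewrite ler01 lexx].
Qed.

End SpineValue.

Section SpineWalk.
Context (R : realType) (dO : measure_display) (Om : measurableType dO).
Variables (P : probability Om R) (d : nat) (mu : probability nat R).
Variables (theta : {fsfun site d -> R with 0}) (W : Om -> vtree_walk d).
Hypothesis htheta : step_distribution theta.
Hypothesis hW : is_vtree_walk mu theta P W.

Local Notation m := (mass mu).
Local Notation key := (vertex + nat + vertex)%type.

Definition walk_events (i : key) : set (set Om) :=
  match i with
  | inl (inl v) => events_of (fun w => vnchild (W w) v)
  | inl (inr n) => events_of (fun w => vspine (W w) n)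
  | inr v => events_of (fun w => vstep (W w) v)
  end.

Let F := walk_events.
Let c v w := vnchild (W w) v.
Let s v w := vstep (W w) v.
Let sp l w := vspine (W w) l.
Let ic (v : vertex) : key := inl (inl v).
Let isp (l : nat) : key := inl (inr l).
Let is_ (v : vertex) : key := inr v.

Lemma walk_eventsT i : F i setT.
Proof. by case: i => [[v|l]|v]; exact: events_ofT. Qed.

Lemma walk_eventsI i : setI_closed (F i).
Proof.
by case: i => [[v|l]|v]; exact: events_ofI.
Qed.

Lemma walk_events_measurable i A : F i A -> measurable A.
Proof.
have [hc hs ht _] := hW.
by case: i => [[v|l]|v]; [exact: events_of_measurable (hc v)
  |exact: events_of_measurable (hs l)|exact: events_of_measurable (ht v)].
Qed.

Lemma walk_events_indep : mutually_independent P F.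
Proof. by case: hW. Qed.

Let FT := walk_eventsT.
Let FI := walk_eventsI.
Let Fm := walk_events_measurable.
Let indepF := walk_events_indep.

Let ic_inj : injective ic. Proof. by move=> v w []. Qed.
Let is_inj : injective is_. Proof. by move=> v w []. Qed.
Let ic_is v w : ic v <> is_ w. Proof. by []. Qed.
Let law_c v : has_law P (c v) m. Proof. by case: hW => h _ _ _; exact: h. Qed.
Let law_s v : has_law P (s v) theta. Proof. by case: hW => _ _ h _; exact: h. Qed.
Let law_sp l : has_law P (sp l) (spine_pmf mu l).
Proof. by case: hW => _ h _ _; exact: h. Qed.

Lemma mass_is_pmf : is_pmf m.
Proof. exact: is_pmf_law (law_c [::]). Qed.

Lemma spine_pmfS l : spine_pmf mu l.+1 = bush_pmf m.
Proof.
apply/funext => -[a b]; rewrite /spine_pmf /size_biased /bush_pmf /=.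
by rewrite mulrAC mulfV ?mul1r// pnatr_eq0.
Qed.

Lemma bush_pmf_is_pmf : is_pmf (bush_pmf m).
Proof. by rewrite -(spine_pmfS 0); exact: is_pmf_law (law_sp 1). Qed.

Variables (K : {fset site d}) (alpha : site d -> R) (n : nat).
Hypothesis alpha01 : forall z, 0 <= alpha z <= 1.

Let V := spine_val K alpha n.
Let subkeys := subtree_keys ic is_.

Definition spine_keys (v : vertex) (l : nat) : set key :=
  bush_keys ic is_ v `|` [set i | exists2 k, (l <= k)%N & i = isp k].
Definition spine_subtree_keys (v : vertex) (l : nat) : set key :=
  subkeys v `|` [set i | exists2 k, (l <= k)%N & i = isp k].

(** The index [a] of the special child is a parameter: it is the value on which one conditions. *)
Definition child_factor a N x v l i (w : Om) : R :=
  if i == a then V (W w) N (x - s (rcons v a) w) (rcons v a) l.+1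
  else bush_var c s K (side_weight alpha i a) 1 n (x + s (rcons v i) w) (rcons v i) w.

Definition child_keys a v l i : set key :=
  if i == a then spine_subtree_keys (rcons v a) l.+1 else subkeys (rcons v i).

Lemma spine_val_rec N x v l w : x \notin K -> V (W w) N.+1 x v l =
  \prod_(i <- iota 0 ((sp l w).1 + (sp l w).2).+1) child_factor (sp l w).1 N x v l i w.
Proof. by move=> /negbTE xK; rewrite /V /= xK. Qed.

Lemma child_factor01 a N x v l i w : 0 <= child_factor a N x v l i w <= 1.
Proof.
rewrite /child_factor; case: ifP => _; first exact: spine_val01.
by apply: bush_var01; [exact: side_weight01|rewrite ler01 lexx].
Qed.

Let one01 : (0 <= 1 :> R) && (1 <= 1 :> R). Proof. by rewrite ler01 lexx. Qed.

Lemma adapted_child_factor a N x v l i :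
  (forall y, adapted F (spine_keys (rcons v a) l.+1) (fun w => V (W w) N y (rcons v a) l.+1)) ->
  adapted F (child_keys a v l i) (child_factor a N x v l i).
Proof.
move=> h; rewrite /child_keys /child_factor; case: eqP => [_|ia].
  apply: (adapted_bind (Z := s (rcons v a))
    (G := fun z w => V (W w) N (x - z) (rcons v a) l.+1)).
    move=> b; apply: (sigma_of_s (fun _ => erefl) _ (is_ := is_)).
    by left; exists (rcons v a); [exact: prefix_refl|right].
  move=> b; apply: adaptedS (h _) => k [/bush_keys_sub|] hk; [by left|by right].
apply: adapted_bush_step => // y; exact: adapted_bush.
Qed.

(** The spine variables of later levels are used by the special child alone, so siblings do not
    share them. *)
Lemma child_keys_disjoint a v l i j : i != j ->
  child_keys a v l i `&` child_keys a v l j = set0.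
Proof.
move=> ij.
have dsub : subkeys (rcons v i) `&` subkeys (rcons v j) = set0.
  exact: subtree_keys_disjoint.
have nsp k u : ~ subkeys u (isp k) by move=> [w _ []].
have H k : child_keys a v l i k -> child_keys a v l j k ->
   (subkeys (rcons v i) `&` subkeys (rcons v j)) k.
  rewrite /child_keys; case: eqP => ia; case: eqP => ja.
  - by move: ij; rewrite ia ja eqxx.
  - by rewrite -ia => -[h //|[k' _ ->] h]; case: (nsp _ _ h).
  - rewrite -ja => h [//|[k' _ e]]; move: h; rewrite e => h; case: (nsp _ _ h).
  - by [].
by apply/seteqP; split=> // k [h1 h2]; have := H k h1 h2; rewrite dsub.
Qed.

Lemma child_keys_sub a v l i : child_keys a v l i `<=` spine_keys v l.+1.
Proof.
rewrite /child_keys; case: ifP => _ k; last by move=> /subtree_keys_sub h; left.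
by move=> [/subtree_keys_sub|] h; [left|right].
Qed.

Lemma adapted_spine N x v l :
  adapted F (spine_keys v l) (fun w => V (W w) N x v l).
Proof.
elim: N x v l => [|N ih] x v l; first exact: adapted_cst.
have [xK|xK] := boolP (x \in K).
  have -> : (fun w => V (W w) N.+1 x v l) = fun=> 0.
    by apply/funext => w; rewrite /V /= xK.
  exact: adapted_cst.
have -> : (fun w => V (W w) N.+1 x v l) = (fun w =>
  \prod_(i <- iota 0 ((sp l w).1 + (sp l w).2).+1) child_factor (sp l w).1 N x v l i w).
  by apply/funext => w; rewrite spine_val_rec.
apply: (adapted_bind (Z := sp l) (G := fun ab w =>
  \prod_(i <- iota 0 (ab.1 + ab.2).+1) child_factor ab.1 N x v l i w)).
  move=> ab; apply: (@sigma_of_gen _ _ _ F _ (isp l)); last by exists [set ab].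
  by right; exists l.
move=> [a b]; apply: adapted_prod => i.
apply: adaptedS (adapted_child_factor _ _).
  by move=> k /child_keys_sub[h|[k' lk ->]]; [left|right; exists k' => //; exact: ltnW].
by move=> y; exact: ih.
Qed.

Definition upto_rate y : R := spine_rate theta m K
  (stopped_gf theta m K (fun=> 0) 1 n) (stopped_gf theta m K alpha 1 n) y.

Fixpoint spine_gf N x : R :=
  if N is N'.+1 then upto_rate x * bwd theta (spine_gf N') x else 1.

Let t0 z : 0 <= theta z. Proof. by case: htheta. Qed.
Let t1 : \sum_(z <- finsupp theta) theta z = 1. Proof. by case: htheta. Qed.

Let gf01 (a : site d -> R) x : (forall z, 0 <= a z <= 1) -> 0 <= stopped_gf theta m K a 1 n x <= 1.
Proof. by move=> a01; apply: (stopped_gf01 htheta mass_is_pmf); rewrite ?ler01 ?lexx. Qed.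

Let zero01 (z : site d) : (0 <= 0 :> R) && (0 <= 1 :> R). Proof. by rewrite ler01 lexx. Qed.

Lemma upto_rate01 y : 0 <= upto_rate y <= 1.
Proof.
apply: spine_rate01 => //; first exact: bush_pmf_is_pmf.
  by move=> z; exact: gf01.
by move=> z; exact: gf01.
Qed.

Lemma spine_gf01 N x : 0 <= spine_gf N x <= 1.
Proof.
elim: N x => [|N ih] x //=; apply: mul01; first exact: upto_rate01.
exact: bwd01.
Qed.

Lemma integral_spine_step N x v l g :
  (forall y, \int[P]_w (V (W w) N y v l)%:E = (g y)%:E)%E ->
  (\int[P]_w (V (W w) N (x - s v w) v l)%:E = (bwd theta g x)%:E)%E.
Proof.
move=> h.
have g0 z : 0 <= g z.
  by rewrite -lee_fin -h integral_ge0// => w _; rewrite lee_fin; have /andP[] := spine_val01 K n alpha01 (W w) N z v l.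
rewrite /bwd -(pmf_mean_fsfun (f := fun z => g (x - z)))//.
apply: (integral_bind_indep_real FT FI Fm indepF (J := [set is_ v]) (J' := spine_keys v l)
  (Z := s v) (G := fun z w => V (W w) N (x - z) v l)).
- apply/seteqP; split=> // i /= [->] [|[k _ //]].
  by move=> [w vw [//|[/is_inj ->]]]; rewrite eqxx.
- by move=> a; apply: (sigma_of_s (fun _ => erefl) _ (is_ := is_)).
- by move=> a; have [_ ->] := law_s v.
- by move=> a; exact: adapted_spine.
- by move=> a w; exact: spine_val01.
- by move=> a; rewrite h.
Qed.

Lemma prod_child_gf (a b : nat) (p q h : R) :
  (\prod_(i <- iota 0 (a + b).+1) (if i == a then h else if (i < a)%N then q else p)%:E
   = (q ^+ a * p ^+ b * h)%:E)%E.
Proof.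
rewrite -addnS iotaD big_cat/= big_cons eqxx add0n.
rewrite big_seq (eq_bigr (fun=> q%:E)); last first.
  by move=> i; rewrite mem_iota add0n => /andP[_ ia]; rewrite ia; case: ltngtP ia.
rewrite -big_seq prodEFin_cst size_iota.
rewrite [X in (_ * (_ * X))%E]big_seq (eq_bigr (fun=> p%:E)); last first.
  move=> i; rewrite mem_iota => /andP[ia _].
  by case: ltngtP ia.
by rewrite -big_seq prodEFin_cst size_iota -!EFinM; congr EFin; ring.
Qed.

(** Levels start at 1 because the root has its own law of children; at later levels the size bias
    and the uniform choice of the special child combine into [bush_pmf]. *)
Lemma integral_spine N x v l :
  (\int[P]_w (V (W w) N x v l.+1)%:E = (spine_gf N x)%:E)%E.
Proof.
elim: N x v l => [|N ih] x v l.
  rewrite /V /=; under eq_integral do rewrite /=.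
  by rewrite integral_cst//= probability_setT mule1.
have [xK|xK] := boolP (x \in K).
  under eq_integral do rewrite /V /= xK.
  by rewrite integral0 /= /upto_rate /spine_rate xK mul0r.
under eq_integral do rewrite spine_val_rec//.
pose p := fwd theta (stopped_gf theta m K (fun=> 0) 1 n) x.
pose q := fwd theta (stopped_gf theta m K alpha 1 n) x.
have p01 : 0 <= p <= 1 by apply: fwd01 => // z; exact: gf01.
have q01 : 0 <= q <= 1 by apply: fwd01 => // z; exact: gf01.
have h01 : 0 <= bwd theta (spine_gf N) x <= 1 by apply: bwd01 => // z; exact: spine_gf01.
have -> : spine_gf N.+1 x = pmf_mean (bush_pmf m)
   (fun ab => q ^+ ab.1 * p ^+ ab.2 * bwd theta (spine_gf N) x).
  rewrite /= /upto_rate /spine_rate (negbTE xK) mulrC -(pmf_meanZ bush_pmf_is_pmf).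
  - by apply: eq_pmf_mean => ab; rewrite mulrC.
  - by have /andP[] := h01.
  - by apply: bounded_ge0_01 => ab; apply: mul01; exact: expr01.
rewrite -(spine_pmfS l).
apply: (integral_bind_indep_real FT FI Fm indepF (J := [set isp l.+1])
  (J' := spine_keys v l.+2) (Z := sp l.+1) (G := fun ab w =>
  \prod_(i <- iota 0 (ab.1 + ab.2).+1) child_factor ab.1 N x v l.+1 i w)).
- apply/seteqP; split=> // i /= [->] [[w _ [//|[]//]]|[k lk [kl]]].
  by move: lk; rewrite -kl ltnn.
- by move=> ab; apply: (@sigma_of_gen _ _ _ F _ (isp l.+1)) => //; exists [set ab].
- by move=> a; have [_ ->] := law_sp l.+1.
- move=> [a b]; apply: adapted_prod => i.
  apply: adaptedS (adapted_child_factor _ _); first exact: child_keys_sub.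
  by move=> y; exact: adapted_spine.
- by move=> ab w; apply: prod01 => i; exact: child_factor01.
move=> [a b] /=.
rewrite (integral_prod_indep FT FI Fm indepF (J_ := child_keys a v l.+1)
  (f := child_factor a N x v l.+1)).
- rewrite -prod_child_gf; apply: eq_bigr => i _; rewrite /child_factor.
  case: ifP => [_|ia].
    by apply: integral_spine_step => y; exact: ih.
  rewrite (@integral_bush_step _ _ _ P _ F FT FI Fm indepF d theta c s ic is_
    (fun=> erefl) (fun=> erefl) is_inj ic_is law_s K (side_weight alpha i a) 1
    (fun z => side_weight01 alpha01 i a z) one01 n x (rcons v i)
    (stopped_gf theta m K (side_weight alpha i a) 1 n)).
  + by rewrite /side_weight; case: ifP.
  + move=> y; apply: (integral_bush FT FI Fm indepF (ic := ic) (is_ := is_)) => //.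
      by move=> z; exact: side_weight01.
- exact: (iota_uniq 0 (a + b).+1).
- by move=> i j _ _; exact: child_keys_disjoint.
- by move=> i; apply: adapted_child_factor => y; exact: adapted_spine.
- by move=> i w; have /andP[] := child_factor01 a N x v l.+1 i w.
Qed.

Lemma adapted_root N x : adapted F setT (fun w => root_val K alpha n (W w) N x).
Proof.
apply: (adapted_bind (Z := sp 0) (G := fun ab w =>
  V (W w) N (x - s [:: ab.1] w) [:: ab.1] 1)).
  by move=> ab; apply: (@sigma_of_gen _ _ _ F _ (isp 0)) => //; exists [set ab].
move=> ab; apply: (adapted_bind (Z := s [:: ab.1]) (G := fun z w =>
  V (W w) N (x - z) [:: ab.1] 1)).
  by move=> z; apply: (sigma_of_s (fun _ => erefl) _ (is_ := is_)).
by move=> z; apply: (adaptedS _ (@adapted_spine N (x - z) [:: ab.1] 1)).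
Qed.

Lemma integral_root_val N x :
  (\int[P]_w (root_val K alpha n (W w) N x)%:E = (escape_upto theta upto_rate N x)%:E)%E.
Proof.
(* [spine_gf] applies the rate at its starting point and [escape_upto] does not, so they differ by
   one reversed step. *)
have -> : escape_upto theta upto_rate N x = bwd theta (spine_gf N) x.
  elim: N x => [|N ih] x; first by rewrite /= bwd_cst.
  by rewrite /escape_upto /= /bwd_killed; congr bwd; apply/funext => y; rewrite -ih.
have h01 : 0 <= bwd theta (spine_gf N) x <= 1 by apply: bwd01 => // z; exact: spine_gf01.
have sp0 := is_pmf_law (law_sp 0).
have /andP[h0 _] := h01.
(* The integral given the children of the root does not depend on their number, so it is averaged as
   a constant. *)
rewrite -(pmf_mean_cst sp0 h0).
apply: (integral_bind_indep_real FT FI Fm indepF (J := [set isp 0])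
  (J' := [set i | i <> isp 0]) (Z := sp 0) (G := fun ab w =>
  V (W w) N (x - s [:: ab.1] w) [:: ab.1] 1)).
- by apply/seteqP; split=> // i /= [->].
- by move=> ab; apply: (@sigma_of_gen _ _ _ F _ (isp 0)) => //; exists [set ab].
- by move=> a; have [_ ->] := law_sp 0.
- move=> ab; apply: (adapted_bind (Z := s [:: ab.1]) (G := fun z w =>
    V (W w) N (x - z) [:: ab.1] 1)).
    by move=> z; apply: (sigma_of_s (fun _ => erefl) _ (is_ := is_)).
  move=> z; apply: (adaptedS _ (@adapted_spine N (x - z) [:: ab.1] 1)) => i.
  by move=> [[w _ [->//|[->]//]]|[k lk ->] /= [k0]]; move: lk; rewrite k0.
- by move=> ab w; exact: spine_val01.
- by move=> ab; apply: integral_spine_step => y; exact: integral_spine.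
Qed.

End SpineWalk.

(** * Deterministic trees: first visits, levels of the spine and products of weights *)

Section Trees.
Variable d : nat.
Implicit Types (c : vertex -> nat) (s : vertex -> site d) (y : site d) (u v w : vertex).

Lemma position_cons y s i u : position y s (i :: u) =
  position (y + s [:: i]) (fun u => s (i :: u)) u.
Proof.
by rewrite /position /= big_nat_recl//= take0 addrA.
Qed.

Lemma position_nil y s : position y s [::] = y.
Proof. by rewrite /position big_geq// addr0. Qed.

Lemma position_rcons y s v i : position y s (rcons v i) = position y s v + s (rcons v i).
Proof.
rewrite /position size_rcons big_nat_recr//= addrA.
congr (_ + _ + _); last by rewrite take_oversize// size_rcons.
apply: eq_big_nat => k /andP[_ ks]; rewrite ltnS in ks.
by rewrite -cats1 takel_cat.
Qed.

Lemma position_cat y s v u : position y s (v ++ u) =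
  position (position y s v) (fun u => s (v ++ u)) u.
Proof.
elim/last_ind: u => [|u i ih]; first by rewrite cats0 position_nil.
by rewrite -rcons_cat !position_rcons ih rcons_cat.
Qed.

Lemma in_tree_cons c i u :
  in_tree c (i :: u) <-> (i < c [::])%N /\ in_tree (fun u => c (i :: u)) u.
Proof.
split=> [h|[ic h] [|k] ks //=]; last exact: h.
by split=> [|k ks]; [exact: (h 0%N)|exact: (h k.+1)].
Qed.

Lemma in_tree_rcons c v i : in_tree c (rcons v i) <-> in_tree c v /\ (i < c v)%N.
Proof.
split=> [h|[h ic] k].
  split=> [k ks|]; last first.
    have := h (size v); rewrite size_rcons nth_rcons ltnn eqxx -cats1 take_size_cat//.
    exact.
  have := h k; rewrite size_rcons nth_rcons ks -cats1 takel_cat ?(ltnW ks)//.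
  by apply; exact: ltnW.
rewrite size_rcons ltnS leq_eqVlt => /orP[/eqP ->|ks].
  by rewrite nth_rcons ltnn eqxx -cats1 take_size_cat.
by rewrite nth_rcons ks -cats1 takel_cat ?(ltnW ks)//; exact: h.
Qed.

Lemma in_tree_cat c v u :
  in_tree c (v ++ u) <-> in_tree c v /\ in_tree (fun u => c (v ++ u)) u.
Proof.
elim/last_ind: u => [|u i ih]; first by rewrite cats0; split=> // -[].
by rewrite -rcons_cat !in_tree_rcons ih; split=> [[[]]|[? []]].
Qed.

Lemma in_tree_take c v k : in_tree c v -> in_tree c (take k v).
Proof. by rewrite -{1}(cat_take_drop k v) => /in_tree_cat[]. Qed.

Section FirstHits.
Variable K : {fset site d}.

Definition first_hit c s y u : Prop :=
  [/\ in_tree c u, position y s u \in K &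
      forall k, (k < size u)%N -> position y s (take k u) \notin K].

Fixpoint first_hits c s n y : seq vertex :=
  if n is n'.+1 then
    if y \in K then [:: [::]] else
    [seq i :: u | i <- iota 0 (c [::]),
       u <- first_hits (fun u => c (i :: u)) (fun u => s (i :: u)) n' (y + s [:: i])]
  else [::].

Lemma first_hitsP c s n y u :
  u \in first_hits c s n y <-> (size u < n)%N /\ first_hit c s y u.
Proof.
elim: n c s y u => [|n ih] c s y u /=; first by split=> // -[].
have [yK|yK] := boolP (y \in K).
  rewrite inE; split=> [/eqP ->|[_ [_ _]]].
    by split=> //; split=> //; rewrite position_nil.
  case: u => // a u /(_ 0%N isT).
  by rewrite take0 position_nil yK.
split.
  move=> /allpairsPdep[i [u' [ii uu ->]]] /=.
  move: ii uu; rewrite mem_iota => /= ii /ih[su [h1 h2 h3]].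
  split=> //; split; [by apply/in_tree_cons|by rewrite position_cons|].
  move=> [|k] ks; first by rewrite take0 position_nil.
  by rewrite /= position_cons; exact: h3.
case: u => [[_ [_]]|i u [/= su [/in_tree_cons[ii h1]]]].
  by rewrite position_nil (negbTE yK).
rewrite position_cons => h2 h3; apply/allpairsPdep; exists i, u; split=> //.
  by rewrite mem_iota.
apply/ih; split=> //; split=> // k ks.
by have := h3 k.+1 ks; rewrite /= position_cons.
Qed.

Lemma first_hits_uniq c s n y : uniq (first_hits c s n y).
Proof.
elim: n c s y => //= n ih c s y; case: ifP => // _.
apply: allpairs_uniq_dep => //; first exact: iota_uniq.
by move=> [i u] [j v] _ _ /= [-> ->].
Qed.

Lemma first_hit_exists c s y u : in_tree c u -> position y s u \in K ->
  exists k, first_hit c s y (take k u) /\ (size (take k u) <= size u)%N.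
Proof.
move=> tu uK.
have ex : exists k, position y s (take k u) \in K by exists (size u); rewrite take_size.
exists (ex_minn ex); case: ex_minnP => k kK kmin; split; last first.
  by rewrite size_take_min geq_minr.
split=> //; first exact: in_tree_take.
move=> j; rewrite size_take_min ltn_min => /andP[jk ju].
rewrite take_takel ?(ltnW jk)//; apply/negP => /kmin; rewrite leqNgt jk //.
Qed.

Variables (R : realType) (alpha : site d -> R).

(** Leaves and branches explored to depth n without a visit contribute 1, so only the first visits
    remain. *)
Lemma bush_valE c s n y v :
  bush_val K alpha 1 c s n y v =
  \prod_(u <- first_hits (fun u => c (v ++ u)) (fun u => s (v ++ u)) n y)
     alpha (position y (fun u => s (v ++ u)) u).
Proof.
elim: n c s y v => [|n ih] c s y v /=; first by rewrite big_nil.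
case: ifP => _; first by rewrite big_seq1 position_nil.
rewrite cats0 big_allpairs_dep; apply: eq_bigr => i _.
rewrite ih cats1.
have e (T : Type) (f : vertex -> T) : (fun u => f (rcons v i ++ u)) = (fun u => f (v ++ i :: u)).
  by apply/funext => u; rewrite cat_rcons.
by rewrite !e; apply: eq_bigr => u _; rewrite position_cons cats1.
Qed.

End FirstHits.

End Trees.

Section Spine.
Variables (d : nat) (T : vtree_walk d) (x : site d).
Implicit Types (u v w : vertex) (l n N : nat).

Local Notation sv := (spine_vertex T).
Local Notation vpos := (vposition T x).
Local Notation before l := (vspine T l).1.
Local Notation after l := (vspine T l).2.

Lemma size_spine_vertex l : size (sv l) = l.
Proof. by rewrite size_map size_iota. Qed.

Lemma spine_vertexS l : sv l.+1 = rcons (sv l) (before l).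
Proof. by rewrite /spine_vertex -[l.+1]addn1 iotaD map_cat -cats1. Qed.

Lemma take_spine_vertex k l : (k <= l)%N -> take k (sv l) = sv k.
Proof. by move=> kl; rewrite /spine_vertex -map_take take_iota (minn_idPl kl). Qed.

Lemma on_spine_spine l : on_spine T (sv l).
Proof. by rewrite /on_spine size_spine_vertex. Qed.

Lemma on_spineP v : reflect (exists l, v = sv l) (on_spine T v).
Proof.
by apply: (iffP eqP) => [->|[l ->]]; [exists (size v)|rewrite size_spine_vertex].
Qed.

Lemma off_spine l j u : j != before l -> on_spine T (rcons (sv l) j ++ u) = false.
Proof.
move=> jl; apply/negP => /on_spineP[k e].
have lk : (l.+1 <= k)%N.
  by rewrite -(size_spine_vertex k) -e size_cat size_rcons size_spine_vertex leq_addr.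
move: e => /(congr1 (take l.+1)); rewrite take_spine_vertex// spine_vertexS.
rewrite take_size_cat ?size_rcons ?size_spine_vertex// => /rcons_inj[] /eqP.
by rewrite (negbTE jl).
Qed.

Lemma vposition_spineS l : vpos (sv l.+1) = vpos (sv l) - vstep T (sv l.+1).
Proof.
rewrite /vposition {1}spine_vertexS position_rcons -spine_vertexS.
by rewrite on_spine_spine.
Qed.

Lemma vposition_child l j : j != before l ->
  vpos (rcons (sv l) j) = vpos (sv l) + vstep T (rcons (sv l) j).
Proof.
move=> jl; rewrite /vposition position_rcons.
by have := off_spine [::] jl; rewrite cats0 => ->.
Qed.

Lemma vposition_bush l j u : j != before l ->
  vpos (rcons (sv l) j ++ u) =
  position (vpos (sv l) + vstep T (rcons (sv l) j))
    (fun u => vstep T (rcons (sv l) j ++ u)) u.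
Proof.
move=> jl; rewrite -vposition_child// /vposition position_cat.
by congr position; apply/funext => u'; rewrite off_spine.
Qed.

Lemma vtree_rcons v i : vtree T (rcons v i) <-> vtree T v /\
  (i < if on_spine T v then (before (size v) + after (size v)).+1 else vnchild T v)%N.
Proof. exact: in_tree_rcons. Qed.

Lemma vtree_spine l : vtree T (sv l).
Proof.
elim: l => [|l ih] //; rewrite spine_vertexS; apply/vtree_rcons; split=> //.
by rewrite on_spine_spine size_spine_vertex ltnS leq_addr.
Qed.

Lemma vtree_bush l j u : j != before l ->
  vtree T (rcons (sv l) j ++ u) <-> (j < (before l + after l).+1)%N /\
    in_tree (fun u => vnchild T (rcons (sv l) j ++ u)) u.
Proof.
move=> jl; rewrite /vtree in_tree_cat.
have -> : (fun u : seq nat => if on_spine T (rcons (sv l) j ++ u)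
   then ((vspine T (size (rcons (sv l) j ++ u))).1 +
         (vspine T (size (rcons (sv l) j ++ u))).2).+1
   else vnchild T (rcons (sv l) j ++ u)) = fun u => vnchild T (rcons (sv l) j ++ u).
  by apply/funext => u'; rewrite off_spine.
rewrite -/(vtree T _) vtree_rcons on_spine_spine size_spine_vertex.
by split=> [[[]]|[? ?]] //; split=> //; split=> //; exact: vtree_spine.
Qed.

Section Levels.
Variables (R : realType) (K : {fset site d}) (alpha : site d -> R).
Hypothesis alpha01 : forall z, 0 <= alpha z <= 1.

Definition side_val (a : site d -> R) n l i : R :=
  bush_val K a 1 (vnchild T) (vstep T) n
    (vpos (sv l) + vstep T (rcons (sv l) i)) (rcons (sv l) i).

Definition level_val n l : R :=
  if vpos (sv l) \in K then 0 else
  (\prod_(i <- iota 0 (before l)) side_val alpha n l i) *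
  \prod_(i <- iota (before l).+1 (after l)) side_val (fun=> 0) n l i.

Lemma spine_valE n N l : spine_val K alpha n T N (vpos (sv l)) (sv l) l =
  \prod_(k <- iota l N) level_val n k.
Proof.
elim: N l => [|N ih] l; first by rewrite big_nil.
rewrite big_cons -ih /level_val.
rewrite -[LHS]/(if _ then _ else \prod_(i <- iota 0 (before l + after l).+1) _).
case: ifP => _; first by rewrite mul0r.
rewrite -addnS iotaD big_cat/= big_cons eqxx add0n.
rewrite -spine_vertexS -vposition_spineS mulrA mulrAC; congr (_ * _ * _).
- rewrite big_seq [RHS]big_seq; apply: eq_bigr => i; rewrite mem_iota => /andP[_ ia].
  by rewrite /side_weight ia (ltn_eqF ia).
- rewrite big_seq [RHS]big_seq; apply: eq_bigr => i; rewrite mem_iota => /andP[ia _].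
  by rewrite /side_weight ltnNge (ltnW ia) (gtn_eqF ia).
Qed.

Lemma root_valE n N : root_val K alpha n T N x = \prod_(l <- iota 1 N) level_val n l.
Proof.
rewrite -spine_valE vposition_spineS /root_val spine_vertexS /=.
by rewrite /vposition position_nil.
Qed.

Let zero01 (z : site d) : (0 <= 0 :> R) && (0 <= 1 :> R). Proof. by rewrite ler01 lexx. Qed.
Let one01 : (0 <= 1 :> R) && (1 <= 1 :> R). Proof. by rewrite ler01 lexx. Qed.

Lemma side_val01 a n l i : (forall z, 0 <= a z <= 1) -> 0 <= side_val a n l i <= 1.
Proof. by move=> a01; apply: bush_val01. Qed.

Lemma level_val01 n l : 0 <= level_val n l <= 1.
Proof.
rewrite /level_val; case: ifP => _; first exact: zero01.
by apply: mul01; apply: prod01 => i; exact: side_val01.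
Qed.

Lemma bush_val_decr (a : site d -> R) c s n y v : (forall z, 0 <= a z <= 1) ->
  bush_val K a 1 c s n.+1 y v <= bush_val K a 1 c s n y v.
Proof.
move=> a01; elim: n y v => [|n ih] y v.
  by have /andP[] := @bush_val01 _ _ K a 1 c s 1 y v a01 one01.
rewrite [leLHS]/= [leRHS]/=; case: ifP => // _.
apply: ler_prod => i _; rewrite ih andbT.
by have /andP[] := @bush_val01 _ _ K a 1 c s n.+1 (y + s (rcons v i)) (rcons v i) a01 one01.
Qed.

Lemma level_val_decr n l : level_val n.+1 l <= level_val n l.
Proof.
rewrite /level_val; case: ifP => // _; apply: ler_pM.
- by apply: prodr_ge0 => i _; have /andP[] := side_val01 n.+1 l i alpha01.
- by apply: prodr_ge0 => i _; have /andP[] := side_val01 n.+1 l i zero01.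
- apply: ler_prod => i _; rewrite bush_val_decr// andbT.
  by have /andP[] := side_val01 n.+1 l i alpha01.
- apply: ler_prod => i _; rewrite bush_val_decr// andbT.
  by have /andP[] := side_val01 n.+1 l i zero01.
Qed.

Lemma root_val_01 n N : 0 <= root_val K alpha n T N x <= 1.
Proof. by rewrite root_valE; apply: prod01 => l; exact: level_val01. Qed.

Lemma root_val_decr n : root_val K alpha n.+1 T n.+1 x <= root_val K alpha n T n x.
Proof.
rewrite !root_valE -[X in iota 1 X]addn1 iotaD big_cat big_seq1/= -[leRHS]mulr1.
apply: ler_pM.
- by apply: prodr_ge0 => l _; have /andP[] := level_val01 n.+1 l.
- by have /andP[] := level_val01 n.+1 (1 + n).
- apply: ler_prod => l _; rewrite level_val_decr andbT.
  by have /andP[] := level_val01 n.+1 l.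
- by have /andP[] := level_val01 n.+1 (1 + n).
Qed.

(** A product of zeros is 1 when empty and 0 otherwise; [has] with a constant predicate tests
    nonemptiness. *)
Lemma side_val0P n l i : i != before l ->
  side_val (fun=> 0) n l i =
  if has (fun u => true) (first_hits K (fun u => vnchild T (rcons (sv l) i ++ u))
       (fun u => vstep T (rcons (sv l) i ++ u)) n (vpos (sv l) + vstep T (rcons (sv l) i)))
  then 0 else 1.
Proof.
move=> il; rewrite /side_val bush_valE.
by case: first_hits => [|u r] /=; rewrite ?big_nil// big_cons mul0r.
Qed.

Lemma pastP v : past T v <-> exists2 l, (0 < l)%N & v = sv l \/
  exists j u, [/\ j \in iota (before l).+1 (after l), v = rcons (sv l) j ++ u &
     in_tree (fun u => vnchild T (rcons (sv l) j ++ u)) u].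
Proof.
split=> [[Tv [l l0 h]]|[l l0 h]].
  exists l => //; case: h => [->|[j lj /prefixP[u vE]]]; [by left|right].
  exists j, u.
  have jl : j != before l by rewrite gtn_eqF.
  move: Tv; rewrite vE => /(vtree_bush u jl)[jab tu]; split=> //.
  by rewrite mem_iota lj addSn.
case: h => [->|[j [u [jI -> tu]]]].
  by split; [exact: vtree_spine|exists l => //; left].
move: jI; rewrite mem_iota => /andP[lj jab].
split; first by apply/vtree_bush; rewrite ?gtn_eqF// -addSn.
by exists l => //; right; exists j => //; exact: prefix_prefix.
Qed.

Definition avoids_past : Prop := forall v, past T v -> vpos v \notin K.

(** A vertex of the past in K lies on the spine or yields a first visit in a bush after the spine;
    either way a factor 0 appears once its level and depth are explored. *)
Lemma root_val_past0 : ~ avoids_past ->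
  exists N0, forall N, (N0 <= N)%N -> root_val K alpha N T N x = 0.
Proof.
move=> /existsNP[v /not_implyP[/pastP[l l0 h] /negP]]; rewrite negbK => vK.
have H n N : (l <= N)%N -> level_val n l = 0 -> root_val K alpha n T N x = 0.
  move=> lN l0'; rewrite root_valE; apply/eqP; rewrite prodf_seq_eq0.
  apply/hasP; exists l; last by rewrite l0' eqxx.
  by rewrite mem_iota l0 add1n ltnS.
case: h => [vE|[j [u [jI vE tu]]]].
  by exists l => N lN; apply: H => //; rewrite /level_val -vE vK.
have jl : j != before l by move: jI; rewrite mem_iota => /andP[h _]; rewrite gtn_eqF.
exists (maxn l (size u).+1) => N; rewrite geq_max => /andP[lN uN].
apply: H => //; rewrite /level_val; case: ifP => // _.
apply/eqP; rewrite mulf_eq0; apply/orP; right; rewrite prodf_seq_eq0.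
apply/hasP; exists j => //=; rewrite side_val0P//.
move: vK; rewrite vE vposition_bush// => uK.
have [k [hk ks]] := first_hit_exists tu uK.
case: ifPn => [//|/hasPn /(_ (take k u))].
have -> // : take k u \in first_hits K (fun u0 : seq nat => vnchild T (rcons (sv l) j ++ u0))
          (fun u0 : seq nat => vstep T (rcons (sv l) j ++ u0)) N
          (vpos (sv l) + vstep T (rcons (sv l) j)).
  by apply/first_hitsP; split=> //; exact: leq_ltn_trans uN.
by move=> /(_ isT).
Qed.

Lemma level_val_avoids n l : avoids_past -> (0 < l)%N ->
  level_val n l = \prod_(i <- iota 0 (before l)) side_val alpha n l i.
Proof.
move=> hp l0; rewrite /level_val.
have /negbTE -> : vpos (sv l) \notin K.
  by apply: hp; apply/pastP; exists l => //; left.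
rewrite [X in _ * X]big1_seq ?mulr1// => j /andP[_ jI].
have jl : j != before l by move: jI; rewrite mem_iota => /andP[h _]; rewrite gtn_eqF.
rewrite side_val0P//; case: ifP => // /hasP[u /first_hitsP[_ [tu uK _]] _].
have : vpos (rcons (sv l) j ++ u) \notin K.
  by apply: hp; apply/pastP; exists l => //; right; exists j, u.
by rewrite vposition_bush// uK.
Qed.

End Levels.

Lemma root_val_avoids1 (R : realType) K n N :
  avoids_past K -> root_val K (fun=> 1 : R) n T N x = 1.
Proof.
move=> hp; rewrite root_valE big_seq big1// => l; rewrite mem_iota => /andP[l0 _].
rewrite level_val_avoids// big1// => i _.
have H c s k y v : bush_val K (fun=> 1 : R) 1 c s k y v = 1.
  by elim: k y v => //= k ih y v; case: ifP => // _; rewrite big1.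
exact: H.
Qed.

End Spine.

(** * Infinite simple paths and entering vertices *)

Section Rays.
Local Open Scope nat_scope.
Implicit Types (rho : nat -> nat) (v w : vertex) (n i k : nat).

(* Length of the longest common prefix of v and the ray rho: path_to rho v climbs
   from v to that prefix and then follows rho. *)
Fixpoint meet_size rho v : nat :=
  if v is a :: v' then
    if a == rho 0%N then (meet_size (rho \o S) v').+1 else 0%N
  else 0%N.

Lemma meet_size_le rho v : (meet_size rho v <= size v)%N.
Proof. by elim: v rho => //= a v ih rho; case: ifP => // _; exact: ih. Qed.

Lemma take_meet_size rho v : take (meet_size rho v) v = mkseq rho (meet_size rho v).
Proof.
elim: v rho => //= a v ih rho; case: eqP => // ->.
by rewrite /= ih /mkseq /= -[in RHS](addn0 1%N) iotaDl -map_comp.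
Qed.

Lemma meet_size_ge rho v k : (k <= size v)%N -> take k v = mkseq rho k ->
  (k <= meet_size rho v)%N.
Proof.
elim: k v rho => [|k ih] [|a v] rho //= kv.
rewrite /mkseq /= => -[-> h]; rewrite eqxx ltnS ih//.
by rewrite h -[in LHS](addn0 1%N) iotaDl -map_comp.
Qed.

Lemma size_mkseq_inj rho rho' n n' : mkseq rho n = mkseq rho' n' -> n = n'.
Proof. by move=> /(congr1 size); rewrite !size_mkseq. Qed.

Lemma mkseqS_rcons rho n : mkseq rho n.+1 = rcons (mkseq rho n) (rho n).
Proof. by rewrite /mkseq -addn1 iotaD map_cat -cats1. Qed.

Definition path_to rho v i : vertex :=
  if (i <= size v - meet_size rho v)%N then take (size v - i) v
  else mkseq rho (meet_size rho v + (i - (size v - meet_size rho v))).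

Lemma path_to_late rho v i : (size v - meet_size rho v <= i)%N ->
  path_to rho v i = mkseq rho (meet_size rho v + (i - (size v - meet_size rho v))).
Proof.
rewrite /path_to leq_eqVlt => /orP[/eqP <-|]; last by rewrite ltnNge => /negbTE ->.
rewrite leqnn subnn addn0 subKn ?take_meet_size//; exact: meet_size_le.
Qed.

Lemma path_to_early rho v i : (i <= size v - meet_size rho v)%N ->
  path_to rho v i = take (size v - i) v.
Proof. by rewrite /path_to => ->. Qed.

Variable T : set vertex.
Hypothesis T_parent : forall v i, T (rcons v i) -> T v.

Definition is_ray rho := forall n, T (mkseq rho n).

Lemma T_take v k : T v -> T (take k v).
Proof.
elim/last_ind: v => [|v i ih] //= Tv.
have [kv|kv] := leqP k (size v).
  by rewrite -cats1 takel_cat//; apply/ih/(T_parent Tv).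
by rewrite take_oversize// size_rcons.
Qed.

Lemma take_rcons_nth v k : (k < size v)%N -> take k.+1 v = rcons (take k v) (nth 0%N v k).
Proof. by move=> kv; rewrite -take_nth. Qed.

Lemma path_to_path rho v : is_ray rho -> T v -> infinite_simple_path T v (path_to rho v).
Proof.
move=> hr Tv; have lv := meet_size_le rho v.
split.
- by rewrite path_to_early// subn0 take_size.
- by move=> i; rewrite /path_to; case: ifP => _; [exact: T_take|exact: hr].
- move=> i; have [hi|hi] := ltnP i (size v - meet_size rho v).
    rewrite !path_to_early//; last exact: ltnW.
    have e : (size v - i = (size v - i.+1).+1)%N by lia.
    exists (nth 0%N v (size v - i.+1)); right.
    by rewrite e take_rcons_nth//; lia.
  rewrite !path_to_late//; last exact: leqW.
  exists (rho (meet_size rho v + (i - (size v - meet_size rho v)))); left.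
  by rewrite -mkseqS_rcons; congr mkseq; lia.
- have H i j : (i < j)%N -> path_to rho v i <> path_to rho v j.
    move=> ij.
    have [hj|hj] := leqP j (size v - meet_size rho v).
      rewrite !path_to_early//; last by lia.
      by move=> /(congr1 size); rewrite !size_take_min; lia.
    have [hi|hi] := leqP i (size v - meet_size rho v); last first.
      rewrite !path_to_late//; try lia.
      by move=> /size_mkseq_inj; lia.
    rewrite path_to_early// path_to_late//; last by lia.
    move=> e; have := congr1 size e; rewrite size_take_min size_mkseq => es.
    have es' : (size v - i = meet_size rho v + (j - (size v - meet_size rho v)))%N by lia.
    have := @meet_size_ge rho v (size v - i); rewrite e es' => h.
    have : (meet_size rho v + (j - (size v - meet_size rho v)) <= meet_size rho v)%N.
      by apply: h => //; lia.
    by lia.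
  by move=> i j e; case: (ltngtP i j) => // /H; [|move=> /nesym].
Qed.

Lemma path_to_inj rho rho' v : path_to rho v = path_to rho' v -> rho = rho'.
Proof.
move=> e; apply/funext => k.
have lv := meet_size_le rho v; have lv' := meet_size_le rho' v.
pose i := (size v + k.+1)%N.
have h1 := @path_to_late rho v i ltac:(rewrite /i; lia).
have h2 := @path_to_late rho' v i ltac:(rewrite /i; lia).
rewrite e h2 in h1; have hs := size_mkseq_inj h1; rewrite hs in h1.
have := congr1 (fun s => nth 0%N s k) h1; rewrite !nth_mkseq//; rewrite /i; lia.
Qed.

Section Paths.
Variables (v : vertex) (p : nat -> vertex).
Hypothesis hp : infinite_simple_path T v p.

Let child i := exists j, p i.+1 = rcons (p i) j.

Let down_down i : child i -> child i.+1.
Proof.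
have [_ _ ap ip] := hp; move=> [j pj]; have [j' [e|e]] := ap i.+1; first by exists j'.
move: e; rewrite pj => /rcons_inj[/ip]; lia.
Qed.

Let up_or_down i : child i \/ exists j, p i = rcons (p i.+1) j.
Proof. by have [_ _ ap _] := hp; have [j [e|e]] := ap i; [left|right]; exists j. Qed.

(** A simple path that has moved to a child cannot return to the parent it came from, and it cannot
    climb forever since climbing shortens labels. *)
Lemma path_turns : exists k, [/\ forall i, (i < k)%N -> exists j, p i = rcons (p i.+1) j
  & forall i, (k <= i)%N -> child i].
Proof.
have ex : exists k, `[< child k >].
  apply: contrapT => h.
  have up i : exists j, p i = rcons (p i.+1) j.
    have [c|//] := up_or_down i.
    by exfalso; apply: h; exists i; apply/asboolP.
  have sz i : (size (p i) + i = size (p 0%N))%N.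
    elim: i => [|i ih]; first by rewrite addn0.
    by have [j e] := up i; rewrite -ih e size_rcons; lia.
  have := sz (size (p 0%N)).+1; lia.
exists (ex_minn ex); case: ex_minnP => k /asboolP ck kmin; split.
  move=> i ik; have [c|//] := up_or_down i.
  have : (k <= i)%N by apply: kmin; apply/asboolP.
  by rewrite leqNgt ik.
move=> i; elim: i => [|i ih]; first by rewrite leqn0 => /eqP <-.
by rewrite leq_eqVlt => /orP[/eqP <-//|]; rewrite ltnS => /ih /down_down.
Qed.

(** From the turning time [k] on, the vertices are growing prefixes of one infinite word, which is
    the ray. *)
Lemma path_is_path_to : exists2 rho, is_ray rho & p = path_to rho v.
Proof.
have [p0 Tp _ pinj] := hp.
have [k [hup hdown]] := path_turns.
have sup i : (i <= k)%N -> (i <= size v)%N /\ p i = take (size v - i) v.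
  elim: i => [|i ih] ik; first by rewrite subn0 take_size.
  have [iv pi] := ih (ltnW ik); have [j e] := hup i ik.
  have si : size (p i) = (size v - i)%N by rewrite pi size_take_min; lia.
  have sS : size (p i) = (size (p i.+1)).+1 by rewrite e size_rcons.
  have iv' : (i.+1 <= size v)%N by lia.
  split=> //.
  have := congr1 (take (size v - i.+1)) e; rewrite pi take_takel; last by lia.
  by move=> ->; rewrite -cats1 take_size_cat//; lia.
have [kv pk] := sup k (leqnn k).
have sdown i : size (p (k + i)%N) = (size v - k + i)%N.
  elim: i => [|i ih]; first by rewrite !addn0 pk size_take_min; lia.
  have [|j e] := hdown (k + i)%N; first exact: leq_addr.
  by rewrite !addnS e size_rcons ih.
have pref i j : (i <= j)%N -> take (size v - k + i) (p (k + j)%N) = p (k + i)%N.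
  move=> ij; rewrite -(subnKC ij); elim: (j - i)%N => [|l ih].
    by rewrite addn0 -sdown take_size.
  have [|a e] := hdown (k + (i + l))%N; first exact: leq_addr.
  rewrite !addnS e -cats1 takel_cat//.
  by rewrite sdown; lia.
pose rho n := nth 0%N (p (k + n.+1)%N) n.
have mk n : mkseq rho n = take n (p (k + n)%N).
  apply: (@eq_from_nth _ 0%N); first by rewrite size_mkseq size_take_min sdown; lia.
  move=> a; rewrite size_mkseq => an; rewrite nth_mkseq// nth_take// /rho.
  by rewrite -(pref _ _ an) nth_take//; lia.
have mk2 i : mkseq rho (size v - k + i) = p (k + i)%N.
  rewrite mk -(@pref i (size v - k + i)%N); last by lia.
  by [].
exists rho; first by move=> n; rewrite mk; apply: T_take.
have ms : meet_size rho v = (size v - k)%N.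
  apply/eqP; rewrite eqn_leq; apply/andP; split; last first.
    apply: meet_size_ge; first by lia.
    by have := mk2 0%N; rewrite !addn0 => ->; rewrite pk.
  (* If [rho] followed [v] beyond the turning point, the path would descend to the vertex it had
     just left. *)
  rewrite leqNgt; apply/negP => lt.
  have k0 : (0 < k)%N by have := meet_size_le rho v; lia.
  have e1 : take (size v - k).+1 v = mkseq rho (size v - k).+1.
    have := congr1 (take (size v - k).+1) (take_meet_size rho v).
    rewrite take_takel// => ->.
    by rewrite /mkseq -map_take take_iota (minn_idPl _).
  have e2 : mkseq rho (size v - k).+1 = p k.+1.
    by have := mk2 1%N; rewrite !addn1.
  have [_ e3] := sup k.-1 (leq_pred k).
  have e4 : (size v - k.-1 = (size v - k).+1)%N by lia.
  by have := pinj k.+1 k.-1; rewrite -e2 e3 e4 e1 => /(_ erefl); lia.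
apply/funext => i; rewrite /path_to ms.
have -> : (size v - (size v - k) = k)%N by lia.
case: leqP => ik; first by have [_ ->] := sup i ik.
by rewrite mk2; congr p; lia.
Qed.

End Paths.

Lemma unique_path (rho : nat -> nat) v : is_ray rho -> T v ->
  (exists p, unique (infinite_simple_path T v) p) <->
  (forall rho', is_ray rho' -> rho' = rho).
Proof.
move=> hr Tv; split.
  move=> [p [hp up]] rho' hr'.
  apply: (@path_to_inj _ _ v).
  by rewrite -(up _ (path_to_path hr Tv)) -(up _ (path_to_path hr' Tv)).
move=> h; exists (path_to rho v); split; first exact: path_to_path.
by move=> q /path_is_path_to[rho' /h -> ->].
Qed.

Lemma unique_path_to rho v p : is_ray rho -> T v ->
  unique (infinite_simple_path T v) p -> p = path_to rho v.
Proof. by move=> hr Tv [_]; apply; exact: path_to_path. Qed.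

Hypothesis T_finite : forall v, exists b, forall i, T (rcons v i) -> (i < b)%N.

Definition deep v := forall n, exists2 u, size u = n & T (v ++ u).

(** Koenig's lemma: if no child were deep, the finitely many children would have subtrees of bounded
    height. *)
Lemma deep_child v : deep v -> exists i, deep (rcons v i).
Proof.
move=> dv; apply: contrapT => /forallNP h.
have {h} /choice[f hf] : forall i, exists n, forall u, size u = n -> ~ T (rcons v i ++ u).
  move=> i; have /existsNP[n hn] := h i; exists n => u su Tu.
  by apply: hn; exists u.
have [b hb] := T_finite v.
pose N := \max_(i < b) f i.
have [[|i u]] := dv N.+1; first by [].
move=> [su] Tu.
have Tk w : T (rcons v i ++ w) -> forall k, T (rcons v i ++ take k w).
  move=> Tw k; have := T_take (size (rcons v i) + k) Tw.
  by rewrite take_cat ltnNge leq_addr /= addKn.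
rewrite -cat_rcons in Tu.
have ib : (i < b)%N by apply: hb; have := Tk _ Tu 0%N; rewrite take0 cats0.
apply: (hf i (take (f i) u)); last exact: Tk.
rewrite size_take_min su; apply/minn_idPl.
exact: (@leq_bigmax _ (fun i : 'I_b => f i) (Ordinal ib)).
Qed.

Lemma deep_ray v : deep v -> exists2 rho, is_ray rho & mkseq rho (size v) = v.
Proof.
move=> dv.
have ext (w : {w | deep w}) : {i | deep (rcons (sval w) i)}.
  by apply: cid; apply: deep_child; exact: (svalP w).
pose step (w : {w | deep w}) : {w | deep w} := exist _ (rcons (sval w) (sval (ext w))) (svalP (ext w)).
pose W k := sval (iter k step (exist _ v dv)).
have WS k : exists i, W k.+1 = rcons (W k) i by eexists.
have sW k : size (W k) = (size v + k)%N.
  elim: k => [|k ih]; first by rewrite addn0.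
  by have [i ->] := WS k; rewrite size_rcons ih addnS.
have pW k l : take (size v + k) (W (k + l)%N) = W k.
  elim: l => [|l ih]; first by rewrite addn0 -sW take_size.
  have [i e] := WS (k + l)%N; rewrite addnS e -cats1 takel_cat//.
  by rewrite sW; lia.
pose rho n := nth 0%N (W n.+1) n.
have mk n k : (n <= size v + k)%N -> mkseq rho n = take n (W k).
  move=> nk; apply: (@eq_from_nth _ 0%N).
    by rewrite size_mkseq size_take_min sW; lia.
  move=> a; rewrite size_mkseq => an; rewrite nth_mkseq// nth_take// /rho.
  have [ak|ka] := leqP a.+1 k.
    rewrite -(pW a.+1 (k - a.+1)%N) subnKC// nth_take//; lia.
  rewrite -(pW k (a.+1 - k)%N) subnKC ?(ltnW ka)// nth_take//; lia.
exists rho.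
  move=> n; rewrite (@mk n n); last by lia.
  apply: T_take; have [u] := svalP (iter n step (exist _ v dv)) 0%N.
  by move=> /size0nil ->; rewrite cats0.
rewrite (@mk (size v) 0%N); last by lia.
by rewrite /W /= take_size.
Qed.

(** A deep vertex off the ray starts a second ray, and a second ray passes through deep vertices off
    the first. *)
Lemma unique_ray rho : is_ray rho -> (forall rho', is_ray rho' -> rho' = rho) <->
  (forall v, v <> mkseq rho (size v) -> ~ deep v).
Proof.
move=> hr; split.
  move=> h v vn /deep_ray[rho' /h -> e]; exact: vn.
move=> h rho' hr'; apply/funext => k; apply: contrapT => nk.
apply: (h (mkseq rho' k.+1)).
  rewrite size_mkseq => /(congr1 (fun s => nth 0%N s k)).
  by rewrite !nth_mkseq.
move=> n; exists (mkseq (fun i => rho' (k.+1 + i)%N) n); first by rewrite size_mkseq.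
have := hr' (k.+1 + n)%N; rewrite /mkseq iotaD map_cat add0n.
by rewrite -[X in iota X n]addn0 iotaDl -map_comp.
Qed.

End Rays.

(** Replaces a cardinality by a quantifier over finite sequences: for vertices these form a
    countable type, which gives measurability, and products can be taken along them. *)
Lemma card_eq_seqP (T : choiceType) (A : set T) n :
  (A #= `I_n)%card <-> exists s : seq T, [/\ uniq s, size s = n & forall v, v \in s <-> A v].
Proof.
split=> [An|[s [us sn sA]]].
  have fA : finite_set A by exists n.
  exists (fset_set A); split; first exact: fset_uniq.
    by rewrite -(card_fset_set An).
  by move=> v; rewrite in_fset_set// inE.
have -> : A = [set` [fset x in s]%fset].
  by apply/seteqP; split=> v /=; rewrite inE /= sA.
by apply/card_eq_fsetP; rewrite card_fseq undup_id.
Qed.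

Section Entering.
Variables (d : nat) (T : vtree_walk d) (x : site d) (K : {fset site d}).
Implicit Types (u v w : vertex) (l n N : nat).

Local Notation sv := (spine_vertex T).
Local Notation vpos := (vposition T x).
Local Notation before l := (vspine T l).1.
Local Notation after l := (vspine T l).2.

Definition spine_ray n : nat := before n.

Definition one_ended : Prop := forall v, ~~ on_spine T v -> ~ deep (vtree T) v.

(** The path that joins and follows the spine is always available, so this version is defined
    without the uniqueness required by [enters]. *)
Definition enters_along_spine v : Prop :=
  [/\ vtree T v, vpos v \in K & forall i, vpos (path_to spine_ray v i.+1) \notin K].

Let vtree_parent v i : vtree T (rcons v i) -> vtree T v.
Proof. by move/vtree_rcons => []. Qed.

Let vtree_finite v : exists b, forall i, vtree T (rcons v i) -> (i < b)%N.
Proof.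
by exists (if on_spine T v then (before (size v) + after (size v)).+1 else vnchild T v) => i /vtree_rcons[].
Qed.

Let spine_is_ray : is_ray (vtree T) spine_ray.
Proof. by move=> n; exact: vtree_spine. Qed.

Lemma entersP v : enters T x K v <-> one_ended /\ enters_along_spine v.
Proof.
have ones : one_ended <-> (forall rho', is_ray (vtree T) rho' -> rho' = spine_ray).
  rewrite (unique_ray vtree_parent vtree_finite spine_is_ray).
  by split=> h w wn; apply: h; exact/eqP.
split.
  move=> [Tv vK [p up hp]]; split.
    by apply/ones/(unique_path vtree_parent spine_is_ray Tv); exists p.
  split=> // i; have := hp i.
  by rewrite (unique_path_to vtree_parent spine_is_ray Tv up).
move=> [/ones h1 [Tv vK hp]]; split=> //.
have [p up] := (unique_path vtree_parent spine_is_ray Tv).2 h1.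
by exists p => // i; rewrite (unique_path_to vtree_parent spine_is_ray Tv up).
Qed.

Lemma meet_size_bush l j u : j != before l -> meet_size spine_ray (rcons (sv l) j ++ u) = l.
Proof.
move=> jl; set v := _ ++ u.
have tl : take l v = mkseq spine_ray l.
  by rewrite /v cat_rcons take_size_cat// size_spine_vertex.
have sl : (l < size v)%N by rewrite size_cat size_rcons size_spine_vertex addSn ltnS leq_addr.
apply/eqP; rewrite eqn_leq; apply/andP; split; last exact: meet_size_ge (ltnW sl) tl.
rewrite leqNgt; apply/negP => lm.
have := congr1 (fun s => nth 0%N s l) (take_meet_size spine_ray v).
rewrite nth_take// nth_mkseq// /v nth_cat size_rcons size_spine_vertex ltnSn.
by rewrite nth_rcons size_spine_vertex ltnn eqxx => /eqP; rewrite (negbTE jl).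
Qed.

Lemma vertex_decomp v : (exists l, v = sv l) \/
  exists l j u, j != before l /\ v = rcons (sv l) j ++ u.
Proof.
pose l := meet_size spine_ray v.
have tl : take l v = sv l by exact: take_meet_size.
have := meet_size_le spine_ray v; rewrite leq_eqVlt => /orP[/eqP lv|lv].
  by left; exists l; rewrite -tl /l lv take_size.
right; exists l, (nth 0%N v l), (drop l.+1 v); split; last first.
  by rewrite -tl -take_rcons_nth// cat_take_drop.
apply/negP => /eqP e.
have : (l.+1 <= l)%N; last by rewrite ltnn.
by apply: meet_size_ge => //; rewrite take_rcons_nth// tl e -spine_vertexS.
Qed.

Local Notation bush_nchild l i := (fun u => vnchild T (rcons (sv l) i ++ u)).
Local Notation bush_step l i := (fun u => vstep T (rcons (sv l) i ++ u)).
Local Notation bush_root l i := (vpos (sv l) + vstep T (rcons (sv l) i)).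

Definition bush_hits n l i : seq vertex :=
  [seq rcons (sv l) i ++ u | u <- first_hits K (bush_nchild l i) (bush_step l i) n (bush_root l i)].

Definition tree_hits n N : seq vertex :=
  [seq v | l <- iota 1 N, v <- [seq w | i <- iota 0 (before l), w <- bush_hits n l i]].

Hypothesis hpast : avoids_past T x K.
Hypothesis xK : x \in K.

Let spine_notin l : (0 < l)%N -> vpos (sv l) \notin K.
Proof. by move=> l0; apply: hpast; apply/pastP; exists l => //; left. Qed.

(** The later spine vertices and the bushes after the spine belong to the past, hence avoid K, and
    the bushes at the root are cut off by the root itself. Only ancestors within a bush before the
    spine can still prevent a vertex from entering. *)
Lemma enters_along_spineP v : enters_along_spine v <->
  v = [::] \/ exists l i u, [/\ (0 < l)%N, (i < before l)%N, v = rcons (sv l) i ++ u &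
   first_hit K (bush_nchild l i) (bush_step l i) (bush_root l i) u].
Proof.
split.
  move=> [Tv vK hp]; have [[l vE]|[l [j [u [jl vE]]]]] := vertex_decomp v.
    left; rewrite vE; case: l vE => // l vE.
    by move: vK; rewrite vE (negbTE (spine_notin _)).
  have ml := meet_size_bush u jl; rewrite -vE in ml.
  have sv' : size v = (l.+1 + size u)%N by rewrite vE size_cat size_rcons size_spine_vertex.
  (* From a bush at the root the path visits the root, at x in K. *)
  have l0 : (0 < l)%N.
    rewrite lt0n; apply/negP => /eqP l0.
    have := hp (size v).-1; rewrite path_to_early; last by rewrite ml l0 sv'; lia.
    rewrite (_ : (size v - (size v).-1.+1 = 0)%N); last by lia.
    by rewrite take0 /vposition position_nil xK.
  right; exists l, j, u; split=> //.
  - move: Tv; rewrite vE => /(vtree_bush u jl)[jab tu].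
    case: (ltngtP j (before l)) jl => // lj _.
    suff : vpos v \notin K by rewrite vK.
    apply: hpast; apply/pastP; exists l => //; right; exists j, u; split=> //.
    by rewrite mem_iota lj addSn.
  - split.
    + by move: Tv; rewrite vE => /(vtree_bush u jl)[].
    + by rewrite -vposition_bush// -vE.
    + move=> k ku; rewrite -vposition_bush//.
      have e : take (l.+1 + k) v = rcons (sv l) j ++ take k u.
        by rewrite vE take_cat size_rcons size_spine_vertex ltnNge leq_addr /= addKn.
      have := hp (size u - k).-1; rewrite path_to_early; last by rewrite ml sv'; lia.
      by rewrite (_ : (size v - (size u - k).-1.+1 = l.+1 + k)%N) ?e//; rewrite sv'; lia.
case=> [->|[l [i [u [l0 il vE [tu uK hu]]]]]].
  split=> //; first by rewrite /vposition position_nil.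
  move=> k; rewrite (_ : path_to spine_ray [::] k.+1 = sv k.+1); first exact: spine_notin.
  by rewrite path_to_late//= subn0 add0n.
have ilN : i != before l by rewrite ltn_eqF.
have ml := meet_size_bush u ilN; rewrite -vE in ml.
have sv' : size v = (l.+1 + size u)%N by rewrite vE size_cat size_rcons size_spine_vertex.
split.
- by rewrite vE; apply/vtree_bush => //; split=> //; lia.
- by rewrite vE vposition_bush.
- move=> k; have [kl|kl] := leqP k.+1 (size v - l).
    rewrite path_to_early ?ml//.
    have [e|ku] := eqVneq (size v - k.+1)%N l.
      by rewrite e vE cat_rcons take_size_cat ?size_spine_vertex//; exact: spine_notin.
    rewrite (_ : (size v - k.+1 = l.+1 + (size v - k.+1 - l.+1))%N); last by lia.
    have qu : (size v - k.+1 - l.+1 < size u)%N by lia.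
    move: (size v - k.+1 - l.+1)%N qu => q qu.
    have -> : take (l.+1 + q) v = rcons (sv l) i ++ take q u.
      by rewrite vE take_cat size_rcons size_spine_vertex ltnNge leq_addr /= addKn.
    by rewrite vposition_bush//; exact: hu.
  by rewrite path_to_late ?ml; [apply: spine_notin; lia|lia].
Qed.

Lemma mem_tree_hits n N v : v \in tree_hits n N <->
  exists l i u, [/\ (0 < l <= N)%N, (i < before l)%N, (size u < n)%N, v = rcons (sv l) i ++ u &
   first_hit K (bush_nchild l i) (bush_step l i) (bush_root l i) u].
Proof.
split.
  move=> /allpairsPdep[l [v' [lN /allpairsPdep[i [v'' [ii /mapP[u uh ->]]]] -> ->]]].
  move: uh => /first_hitsP[su hu].
  by exists l, i, u; split=> //; [move: lN|move: ii]; rewrite mem_iota//= add1n ltnS.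
move=> [l [i [u [lN il su -> hu]]]]; apply/allpairsPdep.
exists l, (rcons (sv l) i ++ u); split=> //; first by rewrite mem_iota add1n ltnS.
apply/allpairsPdep; exists i, (rcons (sv l) i ++ u); split=> //; first by rewrite mem_iota.
by apply: map_f; apply/first_hitsP.
Qed.

Lemma tree_hits_uniq n N : uniq (tree_hits n N).
Proof.
have key l i u l' i' u' : (i < before l)%N -> (i' < before l')%N ->
    rcons (sv l) i ++ u = rcons (sv l') i' ++ u' -> l = l' /\ i = i'.
  move=> il il' e.
  have ll : l = l'.
    by rewrite -(@meet_size_bush l i u) ?ltn_eqF// e meet_size_bush// ltn_eqF.
  split=> //; move: e; rewrite -ll !cat_rcons => /eqP.
  by rewrite eqseq_cat// => /andP[_ /eqP[]].
rewrite /tree_hits; apply: allpairs_uniq_dep.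
- exact: iota_uniq.
- move=> l _; apply: allpairs_uniq_dep.
  + exact: iota_uniq.
  + move=> i _; rewrite map_inj_uniq; first exact: first_hits_uniq.
    by move=> a b /eqP; rewrite eqseq_cat// => /andP[_ /eqP].
  + move=> [i v] [i' v'] /allpairsPdep[a [b [ai bh [ia vb]]]] /allpairsPdep[a' [b' [ai' bh' [ia' vb']]]] /= vv.
    move: bh bh'; subst => /mapP[u _ e] /mapP[u' _ e'].
    move: ai ai'; rewrite !mem_iota /= add0n => ai ai'.
    by have [_ ->] := key _ _ _ _ _ _ ai ai' (etrans (esym e) e').
- move=> [l v] [l' v'] /allpairsPdep[a [b [al bh [la vb]]]] /allpairsPdep[a' [b' [al' bh' [la' vb']]]] /= vv.
  move: bh bh'; subst => /allpairsPdep[i [c [ai /mapP[u _ e] e1]]] /allpairsPdep[i' [c' [ai' /mapP[u' _ e'] e1']]].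
  move: ai ai'; rewrite !mem_iota /= !add0n => ai ai'.
  have ee : rcons (sv a) i ++ u = rcons (sv a') i' ++ u' by rewrite -e -e1 e1' e'.
  by have [-> _] := key _ _ _ _ _ _ ai ai' ee.
Qed.

Variables (R : realType) (alpha : site d -> R).
Hypothesis alpha01 : forall z, 0 <= alpha z <= 1.

Lemma root_val_hits n N :
  root_val K alpha n T N x = \prod_(v <- tree_hits n N) alpha (vpos v).
Proof.
rewrite root_valE /tree_hits big_allpairs_dep/= big_seq [RHS]big_seq.
apply: eq_bigr => l; rewrite mem_iota => /andP[l0 _].
rewrite level_val_avoids// big_allpairs_dep/= big_seq [RHS]big_seq.
apply: eq_bigr => i; rewrite mem_iota => /andP[_ il].
rewrite /side_val bush_valE /bush_hits big_map; apply: eq_bigr => u _.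
by rewrite vposition_bush// ltn_eqF.
Qed.

(** The factor [alpha x] accounts for the root, an entering vertex that [root_val] leaves out. A
    depth that bounds the sizes of all entering vertices captures the others. *)
Lemma root_val_entering (s : seq vertex) : uniq s ->
  (forall v, v \in s <-> enters_along_spine v) ->
  exists N0, forall N, (N0 <= N)%N ->
    alpha x * root_val K alpha N T N x = \prod_(v <- s) alpha (vpos v).
Proof.
move=> us hs; exists (\max_(v <- s) size v)%N => N sN.
have -> : alpha x = alpha (vpos [::]) by rewrite /vposition position_nil.
rewrite root_val_hits.
transitivity (\prod_(v <- [::] :: tree_hits N N) alpha (vpos v)).
  by rewrite big_cons.
apply: perm_big; apply: uniq_perm => //.
  rewrite /= tree_hits_uniq andbT; apply/negP => /mem_tree_hits[l [i [u [_ _ _]]]].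
  by move=> /(congr1 size); rewrite size_cat size_rcons.
move=> v; apply/idP/idP.
  rewrite inE => vh; apply/hs/enters_along_spineP; case/orP: vh => [/eqP ->|]; first by left.
  by move=> /mem_tree_hits[l [i [u [/andP[l0 _] il _ vE hu]]]]; right; exists l, i, u.
move=> vs; have := vs; move=> /hs/enters_along_spineP[->|]; first by rewrite inE eqxx.
move=> [l [i [u [l0 il vE hu]]]]; rewrite inE; apply/orP; right.
have : (size v <= N)%N by apply: leq_trans sN; exact: leq_bigmax_seq.
rewrite vE size_cat size_rcons size_spine_vertex => sN'.
apply/mem_tree_hits; exists l, i, u; split=> //; first by rewrite l0; lia.
by apply: leq_trans sN'; rewrite addSn ltnS leq_addl.
Qed.

Lemma root_val_entering_measure (m : point_measure K) : one_ended ->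
  (forall y : K, ([set v | enters T x K v /\ vpos v = val y] #= `I_(m y))%card) ->
  exists N0, forall N, (N0 <= N)%N ->
    alpha x * root_val K alpha N T N x = \prod_(y : K) alpha (val y) ^+ m y.
Proof.
move=> oe hm.
have /choice[f hf] : forall y : K, exists s : seq vertex, [/\ uniq s, size s = m y &
    forall v, v \in s <-> enters T x K v /\ vpos v = val y].
  by move=> y; apply/card_eq_seqP; exact: hm.
pose s := [seq v | y <- index_enum K, v <- f y].
have us : uniq s.
  apply: allpairs_uniq_dep => //; first exact: index_enum_uniq.
    by move=> y _; have [] := hf y.
  move=> [y v] [y' v'] /allpairsPdep[a [b [_ bf [ya vb]]]] /allpairsPdep[a' [b' [_ bf' [ya' vb']]]] /= vv.
  have [_ _ /(_ b)[/(_ bf)[_ h] _]] := hf a.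
  have [_ _ /(_ b')[/(_ bf')[_ h'] _]] := hf a'.
  have bb : b = b' by rewrite -vb -vb'.
  have aa : a = a' by apply: val_inj; rewrite /= -h -h' bb.
  by rewrite ya ya' vb vb' aa bb.
have hs v : v \in s <-> enters_along_spine v.
  split.
    move=> /allpairsPdep[y [w [_ wf ->]]].
    by have [_ _ /(_ w)[/(_ wf)[/entersP[]]]] := hf y.
  move=> hv; have vK : vpos v \in K by case: hv.
  apply/allpairsPdep; exists [` vK]%fset, v; split=> //; first exact: mem_index_enum.
  by have [_ _ /(_ v)[_ ->//]] := hf [` vK]%fset; split=> //; exact/entersP.
have [N0 hN] := root_val_entering us hs.
exists N0 => N /hN ->.
rewrite /s big_allpairs_dep/=; apply: eq_bigr => y _.
have [_ sf hfy] := hf y.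
rewrite big_seq (eq_bigr (fun=> alpha (val y))); last by move=> v /hfy[_ ->].
by rewrite -big_seq big_const_seq count_predT sf iter_mulr_1.
Qed.

End Entering.

(** * Escape probabilities and the harmonic measure *)

Section DiscreteMeasurability.
Context (dO : measure_display) (Om : measurableType dO).

Definition dmeas (E : Type) (Z : Om -> E) : Prop :=
  forall B : set E, measurable (Z @^-1` B).

(** Events are handled as predicates closed under connectives and countable quantifiers, so that
    measurability follows the logical form of the definitions. *)
Definition pmeas (A : Om -> Prop) : Prop := measurable [set w | A w].

Lemma dmeas_cst (E : Type) (a : E) : dmeas (fun=> a).
Proof. by move=> B; rewrite preimage_cst; case: ifP. Qed.

Lemma dmeas_comp (E E' : Type) (f : E -> E') (Z : Om -> E) :
  dmeas Z -> dmeas (fun w => f (Z w)).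
Proof. by move=> h B; exact: (h (f @^-1` B)). Qed.

Lemma pmeas_bind (E : countType) (Y : Om -> E) (A : E -> Om -> Prop) :
  dmeas Y -> (forall a, pmeas (A a)) -> pmeas (fun w => A (Y w) w).
Proof.
move=> hY hA; rewrite /pmeas.
have -> : [set w | A (Y w) w] = \bigcup_(a in [set: E]) (Y @^-1` [set a] `&` [set w | A a w]).
  apply/seteqP; split=> w /=; first by move=> h; exists (Y w).
  by move=> [a _ [<-]].
apply: countable_bigcupT_measurable; first exact: countableP.
by move=> a; apply: measurableI; [exact: hY|exact: hA].
Qed.

Lemma dmeas_bind (E : countType) (E' : Type) (Y : Om -> E) (Z : E -> Om -> E') :
  dmeas Y -> (forall a, dmeas (Z a)) -> dmeas (fun w => Z (Y w) w).
Proof.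
by move=> hY hZ B; apply: (pmeas_bind (A := fun a w => B (Z a w)) hY) => a; exact: hZ.
Qed.

Lemma pmeas_dmeas (E : Type) (Z : Om -> E) (B : E -> Prop) :
  dmeas Z -> pmeas (fun w => B (Z w)).
Proof. by move=> h; exact: (h B). Qed.

Lemma pmeas_cst (A : Prop) : pmeas (fun=> A).
Proof. exact: (pmeas_dmeas id (dmeas_cst A)). Qed.

Lemma pmeas_not (A : Om -> Prop) : pmeas A -> pmeas (fun w => ~ A w).
Proof. by move=> h; exact: measurableC. Qed.

Lemma pmeas_and (A B : Om -> Prop) : pmeas A -> pmeas B -> pmeas (fun w => A w /\ B w).
Proof. by move=> h h'; exact: measurableI. Qed.

Lemma pmeas_or (A B : Om -> Prop) : pmeas A -> pmeas B -> pmeas (fun w => A w \/ B w).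
Proof. by move=> h h'; exact: measurableU. Qed.

Lemma pmeas_ext (A B : Om -> Prop) : (forall w, A w <-> B w) -> pmeas A -> pmeas B.
Proof.
rewrite /pmeas => AB; suff -> : [set w | A w] = [set w | B w] by [].
by apply/seteqP; split=> w /AB.
Qed.

Lemma pmeas_exists (E : countType) (A : E -> Om -> Prop) :
  (forall a, pmeas (A a)) -> pmeas (fun w => exists a, A a w).
Proof.
move=> h; rewrite /pmeas.
have -> : [set w | exists a, A a w] = \bigcup_(a in [set: E]) [set w | A a w].
  by apply/seteqP; split=> w /= => [[a ha]|[a _ ha]]; exists a.
by apply: countable_bigcupT_measurable; first exact: countableP.
Qed.

Lemma pmeas_forall (E : countType) (A : E -> Om -> Prop) :
  (forall a, pmeas (A a)) -> pmeas (fun w => forall a, A a w).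
Proof.
move=> h; apply: (@pmeas_ext (fun w => ~ exists a, ~ A a w)).
  by move=> w; split=> [/forallNP hw a|hw [a]]; [exact: contrapT|apply].
by apply: pmeas_not; apply: pmeas_exists => a; exact: pmeas_not.
Qed.

Lemma pmeas_imply (A B : Om -> Prop) : pmeas A -> pmeas B -> pmeas (fun w => A w -> B w).
Proof.
move=> hA hB; apply: (@pmeas_ext (fun w => ~ A w \/ B w)).
  move=> w; split=> [[]//|h]; have [a|] := pselect (A w); [by right; exact: h|by left].
by apply: pmeas_or => //; exact: pmeas_not.
Qed.

End DiscreteMeasurability.

Section WalkMeasurability.
Context (dO : measure_display) (Om : measurableType dO) (d : nat).
Variables (W : Om -> vtree_walk d).
Hypothesis mc : forall v, dmeas (fun w => vnchild (W w) v).
Hypothesis ms : forall l, dmeas (fun w => vspine (W w) l).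
Hypothesis mt : forall v, dmeas (fun w => vstep (W w) v).
Variables (K : {fset site d}) (x : site d).

Lemma dmeas_spine_vertex l : dmeas (fun w => spine_vertex (W w) l).
Proof.
elim: l => [|l ih]; first exact: dmeas_cst.
under eq_fun do rewrite spine_vertexS.
apply: (dmeas_bind (Z := fun v w => rcons v (vspine (W w) l).1) ih) => v.
exact: (dmeas_comp (fun ab => rcons v ab.1)).
Qed.

Lemma dmeas_on_spine v : dmeas (fun w => on_spine (W w) v).
Proof. exact: (dmeas_comp (fun s => v == s) (dmeas_spine_vertex _)). Qed.

Lemma dmeas_vposition v : dmeas (fun w => vposition (W w) x v).
Proof.
elim/last_ind: v => [|v i ih].
  by rewrite /vposition; under eq_fun do rewrite position_nil; exact: dmeas_cst.
rewrite /vposition; under eq_fun do rewrite position_rcons.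
apply: (dmeas_bind (Z := fun z w => z + if on_spine (W w) (rcons v i)
   then - vstep (W w) (rcons v i) else vstep (W w) (rcons v i)) ih) => z.
apply: (dmeas_bind (Z := fun b w => z + if b
   then - vstep (W w) (rcons v i) else vstep (W w) (rcons v i)) (dmeas_on_spine _)) => b.
exact: (dmeas_comp (fun t => z + if b then - t else t)).
Qed.

Lemma pmeas_vtree v : pmeas (fun w => vtree (W w) v).
Proof.
elim/last_ind: v => [|v i ih]; first exact: (pmeas_ext (A := fun=> True)) (pmeas_cst _ _).
apply: (pmeas_ext (fun w => iff_sym (vtree_rcons (W w) v i))).
apply: pmeas_and => //.
apply: (pmeas_bind (A := fun b w => (i < if b then ((vspine (W w) (size v)).1 +
  (vspine (W w) (size v)).2).+1 else vnchild (W w) v)%N) (dmeas_on_spine v)) => b.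
case: b.
  exact: (pmeas_dmeas (fun ab : nat * nat => (i < (ab.1 + ab.2).+1)%N) (ms (size v))).
exact: (pmeas_dmeas (fun k => (i < k)%N) (mc v)).
Qed.

Lemma pmeas_past v : pmeas (fun w => past (W w) v).
Proof.
apply: (pmeas_ext (A := fun w => vtree (W w) v /\ exists n, (0 < n)%N /\
    (v = spine_vertex (W w) n \/ exists j, ((vspine (W w) n).1 < j)%N /\
      prefix (rcons (spine_vertex (W w) n) j) v))).
  move=> w; split=> [[tv [n [n0 h]]]|[tv [n n0 h]]]; split=> //; exists n => //.
    by case: h => [->|[j [nj hj]]]; [left|right; exists j].
  by split=> //; case: h => [->|[j nj hj]]; [left|right; exists j].
apply: pmeas_and; first exact: pmeas_vtree.
apply: pmeas_exists => n; apply: pmeas_and; first exact: pmeas_cst.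
apply: pmeas_or; first exact: (pmeas_dmeas (fun s => v = s) (dmeas_spine_vertex n)).
apply: pmeas_exists => j; apply: pmeas_and.
  exact: (pmeas_dmeas (fun ab : nat * nat => (ab.1 < j)%N) (ms n)).
exact: (pmeas_dmeas (fun s => prefix (rcons s j) v) (dmeas_spine_vertex n)).
Qed.

Lemma pmeas_avoids_past : pmeas (fun w => avoids_past (W w) x K).
Proof.
apply: pmeas_forall => v; apply: pmeas_imply; first exact: pmeas_past.
exact: (pmeas_dmeas (fun z => z \notin K) (dmeas_vposition v)).
Qed.

Lemma dmeas_meet_size (rho : nat -> Om -> nat) v : (forall n, dmeas (rho n)) ->
  dmeas (fun w => meet_size (rho^~ w) v).
Proof.
elim: v rho => [|a v ih] rho h /=; first exact: dmeas_cst.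
apply: (dmeas_bind (Z := fun b w => if a == b then (meet_size (rho^~ w \o S) v).+1 else 0%N) (h 0%N)) => b.
case: eqP => _; last exact: dmeas_cst.
apply: (dmeas_comp S); apply: (ih (fun n => rho n.+1)) => n; exact: h.
Qed.

Lemma dmeas_path_to v i : dmeas (fun w => path_to (spine_ray (W w)) v i).
Proof.
apply: (dmeas_bind (Z := fun k w => if (i <= size v - k)%N then take (size v - i) v
   else spine_vertex (W w) (k + (i - (size v - k)))%N)
   (Y := fun w => meet_size (spine_ray (W w)) v)).
  apply: (dmeas_meet_size (rho := fun n w => spine_ray (W w) n)) => n.
  exact: (dmeas_comp fst (ms n)).
by move=> k; case: (i <= size v - k)%N; [exact: dmeas_cst|exact: dmeas_spine_vertex].
Qed.

Lemma pmeas_one_ended : pmeas (fun w => one_ended (W w)).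
Proof.
apply: pmeas_forall => v; apply: pmeas_imply.
  exact: (pmeas_dmeas (fun b => ~~ b) (dmeas_on_spine v)).
apply: pmeas_not; apply: pmeas_forall => n.
apply: (pmeas_ext (A := fun w => exists u, size u = n /\ vtree (W w) (v ++ u))).
  by move=> w; split=> [[u [h h']]|[u h h']]; exists u.
apply: pmeas_exists => u; apply: pmeas_and; first exact: pmeas_cst.
exact: pmeas_vtree.
Qed.

Lemma pmeas_enters_along_spine v : pmeas (fun w => enters_along_spine (W w) x K v).
Proof.
apply: (pmeas_ext (A := fun w => vtree (W w) v /\ (vposition (W w) x v \in K /\
  forall i, vposition (W w) x (path_to (spine_ray (W w)) v i.+1) \notin K))).
  by move=> w; split=> [[h1 [h2 h3]]|[h1 h2 h3]].
apply: pmeas_and; first exact: pmeas_vtree.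
apply: pmeas_and; first exact: (pmeas_dmeas (fun z => is_true (z \in K)) (dmeas_vposition v)).
apply: pmeas_forall => i.
apply: (pmeas_bind (A := fun u w => vposition (W w) x u \notin K) (dmeas_path_to v i.+1)) => u.
exact: (pmeas_dmeas (fun z => z \notin K) (dmeas_vposition u)).
Qed.

Lemma pmeas_enters v : pmeas (fun w => enters (W w) x K v).
Proof.
apply: (pmeas_ext (fun w => iff_sym (entersP (W w) x K v))).
by apply: pmeas_and; [exact: pmeas_one_ended|exact: pmeas_enters_along_spine].
Qed.

Lemma pmeas_entering_measure (m : point_measure K) :
  pmeas (fun w => entering_measure_is W x m w).
Proof.
apply: pmeas_forall => y.
apply: (pmeas_ext (fun w => iff_sym (card_eq_seqP _ _))).
apply: (pmeas_ext (A := fun w => exists s : seq vertex, (uniq s /\ size s = m y) /\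
    forall v, v \in s <-> enters (W w) x K v /\ vposition (W w) x v = val y)).
  by move=> w; split=> [[s [[h1 h2] h3]]|[s [h1 h2 h3]]]; exists s.
apply: pmeas_exists => s; apply: pmeas_and; first exact: pmeas_cst.
apply: pmeas_forall => v.
have h : pmeas (fun w => enters (W w) x K v /\ vposition (W w) x v = val y).
  apply: pmeas_and; first exact: pmeas_enters.
  exact: (pmeas_dmeas (fun z => z = val y) (dmeas_vposition v)).
by apply: pmeas_and; apply: pmeas_imply => //; exact: pmeas_cst.
Qed.

End WalkMeasurability.

(** * Limits in the depth of bushes and the length of the spine *)

(** Monotonicity in n gives b n <= a n n, monotonicity in N gives a m m <= a m N for m >= N, so the
    two limits bound each other. *)
Lemma diagonal_cvg (R : realType) (a : nat -> nat -> R) (b : nat -> R) (l : R) :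
  (forall n N, 0 <= a n N) -> (forall n N, a n.+1 N <= a n N) ->
  (forall n N, a n N.+1 <= a n N) ->
  (forall N, a^~ N @ \oo --> b N) -> b @ \oo --> l -> (fun n => a n n) @ \oo --> l.
Proof.
move=> a0 an aN ab bl.
have anm n m N : a (n + m)%N N <= a n N.
  by elim: m => [|m ih]; rewrite ?addn0// addnS (le_trans (an _ _)).
have aNm n N m : a n (N + m)%N <= a n N.
  by elim: m => [|m ih]; rewrite ?addn0// addnS (le_trans (aN _ _)).
have [cv _ _] := @nonincreasing_lim _ (fun n => a n n)
  (fun n => le_trans (an n n.+1) (aN n n)) (fun n => a0 n n).
set L := lim _ in cv.
suff -> : l = L by [].
apply/eqP; rewrite eq_le; apply/andP; split.
  apply: (le_cvg bl cv) => n; apply: (cvg_le_cst (u := fun m => a (m + n)%N n)).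
    rewrite (cvg_shiftn n (fun m => a m n)); exact: ab.
  by move=> m; rewrite addnC; exact: anm.
apply: (@le_cvg _ (fun=> L) b L l (cvg_cst _) bl) => N.
apply: (@le_cvg _ (fun m => a (m + N)%N (m + N)%N) (fun m => a (m + N)%N N)).
- by rewrite (cvg_shiftn N (fun n => a n n)).
- by rewrite (cvg_shiftn N (fun m => a m N)); exact: ab.
- by move=> m; rewrite [X in a _ X <= _]addnC; exact: aNm.
Qed.

(** Dominated convergence for sums. The inequality that does not follow from monotonicity is checked
    on the complements 1 - f n, over finite sets, where the limit passes through the sum. *)
Lemma pmf_mean_cvg (R : realType) (E : choiceType) (p : E -> R)
    (f : nat -> E -> R) (g : E -> R) : is_pmf p -> (forall n e, 0 <= f n e <= 1) ->
  (forall n e, f n.+1 e <= f n e) -> (forall e, f^~ e @ \oo --> g e) ->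
  pmf_mean p (f n) @[n --> \oo] --> pmf_mean p g.
Proof.
move=> hp f01 fd fg.
have bf n : bounded_ge0 (f n) by apply: bounded_ge0_01.
have [cv leL L0] := @nonincreasing_lim _ (fun n => pmf_mean p (f n))
  (fun n => le_pmf_mean hp (bf _) (bf _) (fd n))
  (fun n => pmf_mean_ge0 hp (fun e => (andP (f01 n e)).1)).
set L := lim _ in cv leL L0.
have gf n e : g e <= f n e.
  apply: (@le_cvg _ (fun m => f (m + n)%N e) (fun=> f n e)).
  - by rewrite (cvg_shiftn n (fun m => f m e)).
  - exact: cvg_cst.
  - by elim=> // k ih; rewrite addSn (le_trans (fd _ _)).
have g01 e : 0 <= g e <= 1.
  apply/andP; split; last by have /andP[_ h] := f01 0%N e; exact: le_trans (gf 0%N e) h.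
  by apply: (@le_cvg _ (fun=> 0) (f^~ e)) => //; [exact: cvg_cst|move=> n; have /andP[] := f01 n e].
have bg : bounded_ge0 g by exact: bounded_ge0_01.
have compl h : (forall e, 0 <= h e <= 1) -> pmf_mean p (fun e => 1 - h e) = 1 - pmf_mean p h.
  move=> h01; apply/eqP; rewrite eq_sym subr_eq -pmf_meanD//.
  - apply/eqP; rewrite -[LHS](@pmf_mean_cst _ _ _ hp 1)//.
    by apply: eq_pmf_mean => e; ring.
  - by apply: bounded_ge0_01 => e; have := h01 e; lra.
  - exact: bounded_ge0_01.
suff -> : pmf_mean p g = L by [].
apply/eqP; rewrite eq_le; apply/andP; split.
  by apply: (@le_cvg _ (fun=> pmf_mean p g) _ _ _ (cvg_cst _) cv) => n; apply: le_pmf_mean.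
suff : pmf_mean p (fun e => 1 - g e) <= 1 - L by rewrite compl//; lra.
rewrite -lee_fin -pmf_meanE//; last first.
  by apply: bounded_ge0_01 => e; have := g01 e; lra.
apply: ge_ereal_sup => _ [X [finX XI] <-].
rewrite fsbig_finite//= sumEFin lee_fin.
apply: (@le_cvg _ (fun n => \sum_(e <- fset_set X) p e * (1 - f n e))
  (fun n => 1 - pmf_mean p (f n))).
- apply: (@cvg_bigsum _ _ _ (fun n e => p e * (1 - f n e))) => e.
  apply: cvgM; first exact: cvg_cst.
  by apply: cvgB; [exact: cvg_cst|exact: fg].
- by apply: cvgB; [exact: cvg_cst|exact: cv].
- move=> n; rewrite -compl// -lee_fin -pmf_meanE//; last first.
    by apply: bounded_ge0_01 => e; have := f01 n e; lra.
  by rewrite -sumEFin -fsbig_finite//; apply: ereal_sup_ubound; exists X.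
Qed.

Lemma cvg_bush_gf (R : realType) (m : nat -> R) (p q : nat -> R) (p0 q0 : R) :
  is_pmf (bush_pmf m) ->
  (forall n, 0 <= p n <= 1) -> (forall n, 0 <= q n <= 1) ->
  p @ \oo --> p0 -> q @ \oo --> q0 ->
  (forall n, p n.+1 <= p n) -> (forall n, q n.+1 <= q n) ->
  bush_gf m (p n) (q n) @[n --> \oo] --> bush_gf m p0 q0.
Proof.
move=> hnu p01 q01 cp cq dp dq.
have cX (u : nat -> R) (l : R) k : u @ \oo --> l -> u n ^+ k @[n --> \oo] --> l ^+ k.
  move=> ul; elim: k => [|k ih]; first exact: cvg_cst.
  by under eq_fun do rewrite exprS; rewrite exprS; exact: cvgM.
apply: (@pmf_mean_cvg _ _ _ (fun n ab => q n ^+ ab.1 * p n ^+ ab.2)) => //.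
- by move=> n ab; apply: mul01; exact: expr01.
- move=> n [a b] /=; have /andP[? ?] := p01 n; have /andP[? ?] := q01 n.
  have /andP[? ?] := p01 n.+1; have /andP[? ?] := q01 n.+1.
  by apply: ler_pM; rewrite ?exprn_ge0//; apply: lerXn2r.
- by move=> [a b] /=; apply: cvgM; exact: cX.
Qed.

Lemma integral_decreasing_lim (R : realType) (dO : measure_display)
    (Om : measurableType dO) (P : probability Om R) (f : nat -> Om -> R)
    (a : nat -> R) (l : R) :
  (forall n, measurable_fun setT (f n)) -> (forall n w, 0 <= f n w <= 1) ->
  (forall n w, f n.+1 w <= f n w) ->
  (forall n, \int[P]_w (f n w)%:E = (a n)%:E)%E -> a @ \oo --> l ->
  measurable_fun setT (fun w => lim (f n w @[n --> \oo])) /\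
  (\int[P]_w (lim (f n w @[n --> \oo]))%:E = l%:E)%E.
Proof.
move=> mf f01 fd fa al.
have cf w : f n w @[n --> \oo] --> lim (f n w @[n --> \oo]).
  have [] // := @nonincreasing_lim _ (f^~ w) (fun n => fd n w).
  by move=> n; have /andP[] := f01 n w.
have ml : measurable_fun setT (fun w => lim (f n w @[n --> \oo])).
  by apply: (measurable_fun_cvg mf) => w _; exact: cf.
split=> //.
have [] := @dominated_convergence _ _ _ P setT measurableT (fun n w => (f n w)%:E)
  (fun w => (lim (f n w @[n --> \oo]))%:E) (fun=> 1%E).
- by move=> n; exact/measurable_EFinP.
- exact/measurable_EFinP.
- by apply: aeW => w _; apply: cvg_EFin; [exact: nearW|exact: cf].
- by apply: finite_measure_integrable_cst.
- apply: aeW => w n _; rewrite /= lee_fin ger0_norm; by have /andP[] := f01 n w.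
move=> _ _ cv.
have cv2 : (\int[P]_w (f n w)%:E)%E @[n --> \oo] --> l%:E.
  by under eq_fun do rewrite fa; apply: cvg_EFin; [exact: nearW|].
by rewrite -(cvg_lim _ cv)//; exact: cvg_lim.
Qed.

Section WalkLaws.
Context (R : realType) (dO : measure_display) (Om : measurableType dO).
Variables (P : probability Om R) (d : nat) (mu : probability nat R).
Variables (theta : {fsfun site d -> R with 0}) (W : Om -> vtree_walk d).
Hypothesis htheta : step_distribution theta.
Hypothesis hW : is_vtree_walk mu theta P W.
Variable k0 : nat.
Hypothesis hk0 : 0 < mass mu k0.+2.

Local Notation m := (mass mu).

Let hm : is_pmf m. Proof. exact: mass_is_pmf hW. Qed.
Let hnu : is_pmf (bush_pmf m). Proof. exact: bush_pmf_is_pmf hW. Qed.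

Lemma walk_dmeas :
  [/\ forall v, dmeas (fun w => vnchild (W w) v),
      forall l, dmeas (fun w => vspine (W w) l)
    & forall v, dmeas (fun w => vstep (W w) v)].
Proof. by case: hW => h1 h2 h3 _; split=> [v|l|v]; [case: (h1 v)|case: (h2 l)|case: (h3 v)]. Qed.

(** A vertex at depth n contributes the terminal weight 0, and nothing stops the exploration when K
    is empty. *)
Lemma bush_val_deep K (alpha : site d -> R) c s n y v u : K = fset0 -> size u = n ->
  in_tree (fun u => c (v ++ u)) u -> bush_val K alpha 0 c s n y v = 0.
Proof.
move=> K0; elim: n y v u => [//|n ih] y v [|i u] //= [su].
move=> /in_tree_cons[]; rewrite cats0 => ic tu.
have -> : y \in K = false by rewrite K0 inE.
apply/eqP; rewrite prodf_seq_eq0; apply/hasP; exists i; first by rewrite mem_iota.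
apply/eqP; apply: (ih _ _ u) => //.
by move=> k ku; have := tu k ku; rewrite cat_rcons.
Qed.

Let shallow v n w : Prop := forall u, size u = n ->
  ~ in_tree (fun u => vnchild (W w) (v ++ u)) u.

Let pmeas_shallow v n : pmeas (shallow v n).
Proof.
have [mc _ _] := walk_dmeas.
apply: pmeas_forall => u; apply: pmeas_imply; first exact: pmeas_cst.
apply: pmeas_not; apply: pmeas_forall => k; apply: pmeas_imply; first exact: pmeas_cst.
exact: (pmeas_dmeas (fun c => (nth 0%N u k < c)%N) (mc _)).
Qed.

(** The product with terminal weight 0 and no stopping is at most the indicator of having no vertex
    at depth n, and its mean is 1 - [survival m n]. *)
Let shallow_ge v n : ((1 - survival m n)%:E <= P [set w | shallow v n w])%E.
Proof.
pose f := bush_var (fun v w => vnchild (W w) v) (fun v w => vstep (W w) v) fset0 (fun=> 0 : R) 0 n 0 v.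
have zero01 (z : site d) : (0 <= 0 :> R) && (0 <= 1 :> R) by rewrite ler01 lexx.
have f01 w : 0 <= f w <= 1 by apply: bush_var01 => //; rewrite lexx ler01.
have fE : (\int[P]_w (f w)%:E = (1 - survival m n)%:E)%E.
  rewrite -(stopped_gf_survival m htheta n 0).
  have [h1 _ h3 _] := hW.
  apply: (integral_bush (walk_eventsT W) (walk_eventsI (W := W))
    (walk_events_measurable hW) (walk_events_indep hW)
    (ic := fun v => inl (inl v)) (is_ := fun v => inr v)) => //.
  - by move=> a b [].
  - by move=> a b [].
  - by rewrite lexx ler01.
have mf : measurable_fun setT f.
  apply: (@adapted_measurable _ _ _ _ _ (@walk_events_measurable _ _ _ _ _ _ _ _ hW)
    (bush_keys (fun v => inl (inl v)) (fun v => inr v) v)).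
  exact (@adapted_bush R dO Om _ (walk_events W) d (fun v w => vnchild (W w) v)
    (fun v w => vstep (W w) v) (fun v => inl (inl v)) (fun v => inr v)
    (fun=> erefl) (fun=> erefl) fset0 (fun=> 0) 0 n 0 v).
rewrite -fE -[X in (_ <= P X)%E]setIT -integral_indic//; last exact: pmeas_shallow.
have mI : measurable_fun setT (\1_[set w | shallow v n w] : Om -> R).
  by apply: measurable_indic; exact: pmeas_shallow.
apply: ge0_le_integral => //.
- by move=> w _; rewrite lee_fin; have /andP[] := f01 w.
- by apply/measurable_EFinP.
- by apply/measurable_EFinP.
- move=> w _; rewrite lee_fin indicE.
  case: (boolP (w \in _)) => [_|]; first by have /andP[] := f01 w.
  rewrite notin_setE => /existsNP[u /not_implyP[su /contrapT tu]].
  by rewrite /f /bush_var (bush_val_deep _ _ _ erefl su tu).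
Qed.

Let shallow_ae v : P.-negligible [set w | forall n, ~ shallow v n w].
Proof.
have mS : measurable [set w | forall n, ~ shallow v n w].
  by apply: pmeas_forall => n; apply: pmeas_not; exact: pmeas_shallow.
have [r rE] : exists r : R, P [set w | forall n, ~ shallow v n w] = r%:E.
  by exists (fine (P [set w | forall n, ~ shallow v n w])); rewrite fineK// fin_num_measure.
have r0 : 0 <= r by rewrite -lee_fin -rE.
have rs n : r <= survival m n.
  have h : (P [set w | forall n, ~ shallow v n w] <= P (~` [set w | shallow v n w]))%E.
    apply: le_measure; rewrite ?inE//; first by apply: measurableC; exact: pmeas_shallow.
    by move=> w /(_ n).
  rewrite probability_setC in h; last exact: pmeas_shallow.
  have := shallow_ge v n.
  have [q qE] : exists q : R, P [set w | shallow v n w] = q%:E.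
    by exists (fine (P [set w | shallow v n w])); rewrite fineK// fin_num_measure//; exact: pmeas_shallow.
  move: h; rewrite rE qE -EFinB !lee_fin; lra.
apply/negligibleP => //; apply: (etrans rE); congr EFin.
apply/eqP; rewrite eq_le r0 andbT.
apply: (le_cvg (u := fun=> r) (v := survival m)) => //; first exact: cvg_cst.
exact: survival_cvg hk0.
Qed.

(** Below a normal vertex there is a critical tree, almost surely of finite height. The exceptional
    sets are taken for all labels rather than for the vertices of the random tree, so that a
    countable union suffices. *)
Lemma one_ended_ae : P.-negligible [set w | ~ one_ended (W w)].
Proof.
pose N k := if choice.unpickle k is Some v then
  [set w | forall n, ~ shallow v n w] else set0.
have hN k : P.-negligible (N k).
  by rewrite /N; case: (choice.unpickle k) => [v|]; [exact: shallow_ae|exact: negligible_set0].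
apply: negligibleS (negligible_bigcup hN) => w /= /existsNP[v /not_implyP[voff /contrapT dv]].
exists (choice.pickle v) => //; rewrite /N choice.pickleK => n sn.
have [u su tu] := dv n; apply: (sn u su).
have off u' : on_spine (W w) (v ++ u') = false.
  apply/negP => /on_spineP[l e]; move/negP: voff; apply; apply/on_spineP.
  exists (size v); have := congr1 (take (size v)) e; rewrite take_size_cat// => ve.
  have vl : (size v <= l)%N by rewrite -(size_spine_vertex (W w) l) -e size_cat leq_addr.
  by rewrite {1}ve take_spine_vertex.
move: tu => /in_tree_cat[_ h] k ku; have := h k ku.
by rewrite off.
Qed.

Section Limit.
Variables (K B : {fset site d}) (x : site d).
Hypothesis BK : (B `<=` K)%fset.

Let gB := avoid_prob theta m B.
Let gB01 z : 0 <= gB z <= 1. Proof. exact: avoid01. Qed.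

(** If the past avoids K and finitely many vertices enter, this is the product of gB over the
    entering vertices other than the root; it is 0 if the past meets K. *)
Definition past_weight w : R := lim (root_val K gB n (W w) n x @[n --> \oo]).

Lemma past_weight_cvg w : root_val K gB n (W w) n x @[n --> \oo] --> past_weight w.
Proof.
have [] // := @nonincreasing_lim _ (fun n => root_val K gB n (W w) n x).
- by move=> n; exact: root_val_decr.
- by move=> n; have /andP[] := root_val_01 (W w) x K gB01 n n.
Qed.

Let rate := spine_rate theta m K (avoid_prob theta m K) gB.
Let t0 z : 0 <= theta z. Proof. by case: htheta. Qed.
Let t1 : \sum_(z <- finsupp theta) theta z = 1. Proof. by case: htheta. Qed.

Let zero01 (z : site d) : (0 <= 0 :> R) && (0 <= 1 :> R). Proof. by rewrite ler01 lexx. Qed.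

Let ur01 n y : 0 <= upto_rate mu theta K gB n y <= 1.
Proof. exact: (upto_rate01 htheta hW K n gB01). Qed.

Let rate01 y : 0 <= rate y <= 1.
Proof. by apply: (spine_rate01 htheta hnu) => z; exact: avoid01. Qed.

Let upto_rate_decr n y : upto_rate mu theta K gB n.+1 y <= upto_rate mu theta K gB n y.
Proof.
have one01 : (0 <= 1 :> R) && (1 <= 1 :> R) by rewrite ler01 lexx.
rewrite /upto_rate /spine_rate; case: ifP => // _.
have /andP[a0 a1] := fwd01 t0 t1 y (fun z => stopped_gf01 htheta hm K n z zero01 one01).
have /andP[b0 b1] := fwd01 t0 t1 y (fun z => stopped_gf01 htheta hm K n.+1 z zero01 one01).
have /andP[c0 c1] := fwd01 t0 t1 y (fun z => stopped_gf01 htheta hm K n z gB01 one01).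
have /andP[d0 d1] := fwd01 t0 t1 y (fun z => stopped_gf01 htheta hm K n.+1 z gB01 one01).
apply: (le_bush_gf hnu) => //; apply: le_fwd => // z; exact: (stopped_gf_decr htheta hm hnu).
Qed.

Let upto_rate_cvg y : upto_rate mu theta K gB n y @[n --> \oo] --> rate y.
Proof.
have one01 : (0 <= 1 :> R) && (1 <= 1 :> R) by rewrite ler01 lexx.
rewrite /upto_rate /rate /spine_rate; case: ifP => _; first exact: cvg_cst.

have c1 : fwd theta (stopped_gf theta m K (fun=> 0) 1 n) y @[n --> \oo] --> fwd theta (avoid_prob theta m K) y.
  by apply: cvg_fwd => z; exact: avoid_cvg.
have c2 : fwd theta (stopped_gf theta m K gB 1 n) y @[n --> \oo] --> fwd theta gB y.
  by apply: cvg_fwd => z; exact: (stopped_gf_cvg htheta hm hnu hk0 BK).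
apply: (cvg_bush_gf hnu) => //.
- by move=> n; apply: fwd01 => // z; exact: (stopped_gf01 htheta hm).
- by move=> n; apply: fwd01 => // z; exact: (stopped_gf01 htheta hm).
- by move=> n; apply: le_fwd => // z; exact: (stopped_gf_decr htheta hm hnu).
- by move=> n; apply: le_fwd => // z; exact: (stopped_gf_decr htheta hm hnu).
Qed.

Lemma integral_past_weight : measurable_fun setT past_weight /\
  (\int[P]_w (past_weight w)%:E = (escape theta rate x)%:E)%E.
Proof.
apply: (@integral_decreasing_lim _ _ _ P (fun n w => root_val K gB n (W w) n x)
  (fun n => escape_upto theta (upto_rate mu theta K gB n) n x)).
- move=> n; apply: (adapted_measurable (walk_events_measurable hW) (J := setT)).
  exact: adapted_root.
- by move=> n w; exact: root_val_01.
- by move=> n w; exact: root_val_decr.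
- by move=> n; exact: (integral_root_val htheta hW K n gB01).
(* Depth of the bushes and number of spine levels grow together; for a fixed number of levels the
   rates converge with the depth. *)
apply: (@diagonal_cvg _ (fun n N => escape_upto theta (upto_rate mu theta K gB n) N x)
  (fun N => escape_upto theta rate N x)).
- by move=> n N; have /andP[] := escape_upto01 t0 t1 (ur01 n) N x.
- move=> n N.
  suff /andP[] : 0 <= escape_upto theta (upto_rate mu theta K gB n.+1) N x <=
    escape_upto theta (upto_rate mu theta K gB n) N x by [].
  apply: le_iter_bwd_killed => // y; last by rewrite ler01 lexx.
  by rewrite upto_rate_decr andbT; have /andP[] := ur01 n.+1 y.
- by move=> n N; exact: escape_upto_decr.
- move=> N; rewrite /escape_upto.
  elim: N x => [|N ih] y /=; first exact: cvg_cst.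
  apply: (@cvg_bwd _ _ theta (fun n z => upto_rate mu theta K gB n z * iter N (bwd_killed theta (upto_rate mu theta K gB n)) (fun=> 1) z)
    (fun z => rate z * iter N (bwd_killed theta rate) (fun=> 1) z)) => z.
  by apply: cvgM; [exact: upto_rate_cvg|exact: ih].
- exact: escape_cvg.
Qed.

End Limit.

End WalkLaws.

Section EscapeProbability.
Context (R : realType) (dO : measure_display) (Om : measurableType dO).
Variables (P : probability Om R) (d : nat) (mu : probability nat R).
Variables (theta : {fsfun site d -> R with 0}) (W : Om -> vtree_walk d).
Hypothesis htheta : step_distribution theta.
Hypothesis hW : is_vtree_walk mu theta P W.
Variable k0 : nat.
Hypothesis hk0 : 0 < mass mu k0.+2.

Local Notation m := (mass mu).
Local Notation gB B := (avoid_prob theta m B).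

Let hm : is_pmf m. Proof. exact: mass_is_pmf hW. Qed.
Let hnu : is_pmf (bush_pmf m). Proof. exact: bush_pmf_is_pmf hW. Qed.

Lemma past_avoids_measurable K x : measurable (past_avoids W K x).
Proof. by have [mc ms mt] := walk_dmeas hW; exact: (pmeas_avoids_past mc ms mt). Qed.

Lemma past_weight0 K B x w : ~ avoids_past (W w) x K -> past_weight mu theta W K B x w = 0.
Proof.
move=> /(root_val_past0 (gB B)) [N0 hN]; apply: cvg_lim => //.
apply: cvg_near_cst; exists N0 => // n /= N0n; exact: hN.
Qed.

Lemma past_weight1 K x w : avoids_past (W w) x K -> past_weight mu theta W K fset0 x w = 1.
Proof.
move=> hp; apply: cvg_lim => //; apply: cvg_near_cst; apply: nearW => n.
have -> : avoid_prob theta m fset0 = fun=> 1.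
  by apply/funext => z; exact: (avoid_fset0 htheta hm hnu).
exact: root_val_avoids1.
Qed.

(** For B empty all weights are 1, so [past_weight] is the indicator that the past avoids K. *)
Lemma Es_escape K x : Es P W K x =
  escape theta (spine_rate theta m K (gB K) (gB fset0)) x.
Proof.
have [_ h] := integral_past_weight htheta hW hk0 x (fsub0set K).
apply: EFin_inj; rewrite -h /Es fineK; last first.
  by rewrite fin_num_measure//; exact: past_avoids_measurable.
rewrite -[X in P X = _]setIT -integral_indic//; last exact: past_avoids_measurable.
apply: eq_integral => w _; congr EFin; rewrite indicE.
case: (boolP (w \in _)) => [|]; first by rewrite inE => /past_weight1 ->.
by rewrite notin_setE => /past_weight0 ->.
Qed.

Section EnteringLaw.
Variables (K B : {fset site d}) (x : site d).
Hypothesis BK : (B `<=` K)%fset.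
Hypothesis xK : x \in K.

Local Notation entering k := (entering_measure_is W x (k : point_measure K)).

Lemma entering_measurable k : measurable (entering k).
Proof. by have [mc ms mt] := walk_dmeas hW; exact: (pmeas_entering_measure mc ms mt). Qed.

Lemma entering_unique k k' w : entering k w -> entering k' w -> k = k'.
Proof.
move=> h h'; apply/ffunP => y; apply/card_eq_II.
have := h y; have := h' y; set A := [set v | _] => h2 h1.
by rewrite -(card_eql h1).
Qed.

(** The entering measure as a random element of a countable type, with [None] when it is infinite or
    when the past meets K. *)
Let Z w : option (point_measure K) :=
  if pselect (exists k, entering k w /\ past_avoids W K x w) is left e
  then Some (projT1 (cid e)) else None.

Let ZP w k : Z w = Some k <-> entering k w /\ past_avoids W K x w.
Proof.
rewrite /Z; case: pselect => [e|ne]; last by split=> // h; case: ne; exists k.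
case: (cid e) => k' /= [h hp]; split=> [[<-]//|[h' _]].
by rewrite (entering_unique h h').
Qed.

Let dmeasZ : dmeas Z.
Proof.
have mS k : measurable (Z @^-1` [set Some k]).
  have -> : Z @^-1` [set Some k] = entering k `&` past_avoids W K x.
    by apply/seteqP; split=> w /ZP.
  by apply: measurableI; [exact: entering_measurable|exact: past_avoids_measurable].
have mz z : measurable (Z @^-1` [set z]).
  case: z => [k|]; first exact: mS.
  have -> : Z @^-1` [set None] = ~` \bigcup_(k in [set: point_measure K]) (Z @^-1` [set Some k]).
    apply/seteqP; split=> w /=; first by move=> e [k _ /=]; rewrite e.
    by case e: (Z w) => [k|//] h; exfalso; apply: h; exists k.
  apply: measurableC; apply: countable_bigcupT_measurable => //; exact: countableP.
move=> C; have -> : Z @^-1` C = \bigcup_(z in [set: option (point_measure K)]) (Z @^-1` [set z] `&` [set w | C z]).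
  by apply/seteqP; split=> w /=; [move=> h; exists (Z w)|move=> [z _ [<-]]].
apply: countable_bigcupT_measurable; first exact: countableP.
move=> z; apply: measurableI => //; exact: pmeas_cst.
Qed.

Let lawZ : has_law P Z (fun z => fine (P (Z @^-1` [set z]))).
Proof.
by split=> [|z]; [exact: dmeasZ|rewrite fineK// fin_num_measure//; exact: dmeasZ].
Qed.

Let entering_expectation (f : point_measure K -> R) : (forall k, 0 <= f k) ->
  (\esum_(k in [set: point_measure K]) (fine (P (entering k `&` past_avoids W K x)) * f k)%:E =
   \int[P]_w (if Z w is Some k then f k else 0)%:E)%E.
Proof.
move=> f0; pose G (z : option (point_measure K)) : R := if z is Some k then f k else 0.
have G0 z : 0 <= G z by case: z => //= k.
rewrite -[RHS]/(\int[P]_w (G (Z w))%:E)%E.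
rewrite (integral_law lawZ G0) (esumID (Some @` [set: point_measure K])); last first.
  by move=> z _; rewrite lee_fin mulr_ge0// fine_ge0.
rewrite !setTI [X in (_ + X)%E]esum1 ?adde0; last first.
  by move=> [k|] /=; [case; exists k|rewrite mulr0].
rewrite esum_image; last by move=> a b _ _ [].
apply: eq_esum => k _; rewrite /=; congr ((fine (P _)) * _)%:E.
by apply/seteqP; split=> w /ZP.
Qed.

(** The possible finite entering measures split the avoidance event up to a deficit, the case of
    infinitely many entering vertices, which is shown to be null later. *)
Lemma entering_total :
  (P (past_avoids W K x) = P (past_avoids W K x `&` [set w | forall k, ~ entering k w]) +
   \esum_(k in [set: point_measure K]) (fine (P (entering k `&` past_avoids W K x)))%:E)%E.
Proof.
have mA := past_avoids_measurable K x.
have mB : measurable [set w | exists k, entering k w].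
  by apply: pmeas_exists => k; exact: entering_measurable.
rewrite [LHS](measureDI _ mA mB); congr (P _ + _)%E.
  by apply/seteqP; split=> w /= [hp /forallNP].
have := entering_expectation (fun=> ler01).
under eq_esum do rewrite mulr1.
move=> ->; have mAB := measurableI _ _ mA mB.
apply: (etrans (congr1 P (esym (setIT _)))); rewrite -integral_indic//.
apply: eq_integral => w _; rewrite indicE; congr _%:E.
case e: (Z w) => [k|]; first by rewrite mem_set//; split; [|exists k]; have [] := (ZP w k).1 e.
by rewrite memNset// => -[hp [k hk]]; have := (ZP w k).2 (conj hk hp); rewrite e.
Qed.

Let gm (k : point_measure K) : R := \prod_(y : K) gB B (val y) ^+ k y.

Let gB01 z : 0 <= gB B z <= 1. Proof. exact: (avoid01 htheta hm hnu). Qed.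

Let gm0 k : 0 <= gm k.
Proof. by apply: prodr_ge0 => y _; rewrite exprn_ge0//; have /andP[] := gB01 (val y). Qed.

Lemma past_weight_entering k w : one_ended (W w) -> entering k w ->
  avoids_past (W w) x K -> gB B x * past_weight mu theta W K B x w = gm k.
Proof.
move=> oe hk hp.
have [N0 hN] := root_val_entering_measure hp xK (gB B) oe hk.
have c1 : gB B x * root_val K (gB B) n (W w) n x @[n --> \oo] --> gB B x * past_weight mu theta W K B x w.
  by apply: cvgM; [exact: cvg_cst|exact: (past_weight_cvg htheta hW)].
have c2 : gB B x * root_val K (gB B) n (W w) n x @[n --> \oo] --> gm k.
  by apply: cvg_near_cst; exists N0 => // n /= N0n; exact: hN.
exact: cvg_unique_real c1 c2.
Qed.

Hypothesis entering_finite :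
  P.-negligible (past_avoids W K x `&` [set w | forall k, ~ entering k w]).

(** Off the null set where the tree has a second end or the entering measure is infinite, both sides
    integrate the same function; gB x is the weight of the root. *)
Lemma entering_generating :
  (\esum_(k in [set: point_measure K])
     (fine (P (entering k `&` past_avoids W K x)) * \prod_(y : K) gB B (val y) ^+ k y)%:E
   = (gB B x * escape theta (spine_rate theta m K (gB K) (gB B)) x)%:E)%E.
Proof.
have [mpw ipw] := integral_past_weight htheta hW hk0 x BK.
have /andP[g0 _] := gB01 x.
rewrite EFinM -ipw -ge0_integralZl_EFin//; last 2 first.
- move=> w _; rewrite lee_fin; apply: limr_ge.
    by apply: cvgP; exact: (past_weight_cvg htheta hW).
  by apply: nearW => n; have /andP[] := root_val_01 (W w) x K gB01 n n.
- by apply/measurable_EFinP.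
pose G (z : option (point_measure K)) : R := if z is Some k then gm k else 0.
have G0 z : 0 <= G z by case: z => //= k.
rewrite (entering_expectation gm0) -[LHS]/(\int[P]_w (G (Z w))%:E)%E.
have mG : measurable_fun setT (fun w => G (Z w)).
  by move=> _ C mC; rewrite setTI; exact: (dmeasZ (G @^-1` C)).
apply: ge0_ae_eq_integral => //.
- by apply/measurable_EFinP.
- apply/measurable_EFinP; apply: measurable_funM => //; exact: measurable_cst.
- by move=> w _; rewrite lee_fin.
- move=> w _; rewrite -EFinM lee_fin mulr_ge0//; apply: limr_ge.
    by apply: cvgP; exact: (past_weight_cvg htheta hW).
  by apply: nearW => n; have /andP[] := root_val_01 (W w) x K gB01 n n.
have neg := negligibleU (one_ended_ae htheta hW hk0) entering_finite.
apply: negligibleS neg => w /= /not_implyP[_] hne.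
have [oe|] := pselect (one_ended (W w)); last by left.
right; have hp : past_avoids W K x w.
  apply: contrapT => np; apply: hne; rewrite past_weight0// mule0.
  case e: (Z w) => [k|//]; by move/ZP: e => [_].
split=> // k hk; apply: hne.
have -> : Z w = Some k by apply/ZP.
by rewrite -EFinM (past_weight_entering oe hk hp).
Qed.

End EnteringLaw.

End EscapeProbability.

(** If no family had two children, the mean would equal the mass at 1, and criticality would force
    the Dirac mass at 1. *)
Lemma offspring_two_children (R : realType) (mu : probability nat R) :
  critical_offspring mu -> is_pmf (mass mu) -> is_pmf (bush_pmf (mass mu)) ->
  exists k, 0 < mass mu k.+2.
Proof.
move=> [_ _ mu1] hm hnu; apply: contrapT => /forallNP h.
have m0 k : mass mu k.+2 = 0.
  by apply/eqP; rewrite eq_le (hm.1 k.+2) andbT leNgt; apply/negP; exact: h.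
have m1 : mass mu 1%N = 1.
  have := hnu.2; rewrite (esumID [set (0, 0)%N])//; last by move=> e _; rewrite lee_fin; exact: hnu.1.
  rewrite !setTI esum_set1; last by rewrite lee_fin; exact: hnu.1.
  rewrite [X in (_ + X)%E]esum1 ?adde0; first by move=> [].
  by move=> [[|a] [|b]] //= ne; rewrite /bush_pmf/= ?addSn ?addnS m0.
apply: mu1; apply/funext => A.
have mu1E : mu [set 1%N] = 1%E.
  by rewrite -[LHS]fineK ?fin_num_measure// -[fine _]/(mass mu 1%N) m1.
rewrite diracE; case: (boolP (_ \in _)) => [|]; [rewrite inE => A1|rewrite notin_setE => A1].
  apply/eqP; rewrite eq_le probability_le1//= -mu1E.
  by apply: le_measure; rewrite ?inE// => _ ->.
apply/eqP; rewrite -measure_le0 -(subee (x := mu [set 1%N])) ?mu1E//.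
rewrite lee_suber_addr// -mu1E -measureU//; last by apply/seteqP; split=> // x [] /[swap] ->.
by rewrite mu1E; exact: probability_le1.
Qed.

(** * Total mass and generating function of the harmonic measure *)

Section HarmonicMeasure.
Context (R : realType) (dO : measure_display) (Om : measurableType dO).
Variables (P : probability Om R) (d : nat) (mu : probability nat R).
Variables (theta : {fsfun site d -> R with 0}) (W : Om -> vtree_walk d).
Hypothesis htheta : step_distribution theta.
Hypothesis hW : is_vtree_walk mu theta P W.
Variable k0 : nat.
Hypothesis hk0 : 0 < mass mu k0.+2.
Variable K : {fset site d}.
Hypothesis hmK : is_pmf (harmonic_measure P W (K := K)).

Local Notation m := (mass mu).
Local Notation gB B := (avoid_prob theta m B).
Local Notation hit x k := (fine (P (entering_measure_is W x (k : point_measure K) `&` past_avoids W K x))).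

Let hm : is_pmf m. Proof. exact: mass_is_pmf hW. Qed.
Let hnu : is_pmf (bush_pmf m). Proof. exact: bush_pmf_is_pmf hW. Qed.

Let Es0 x : 0 <= Es P W K x. Proof. by rewrite fine_ge0. Qed.

Let hit0 x k : 0 <= hit x k. Proof. by rewrite fine_ge0. Qed.

Let hit_Es x k : hit x k <= Es P W K x.
Proof.
have mp := past_avoids_measurable hW K x.
have mi : measurable (entering_measure_is W x (k : point_measure K) `&` past_avoids W K x).
  by apply: measurableI => //; exact: entering_measurable hW _ _ _.
by apply: fine_le; rewrite ?fin_num_measure//; apply: le_measure; rewrite ?inE//; exact: subIsetr.
Qed.

Lemma BCap_gt0 : 0 < BCap P W K.
Proof.
rewrite lt_def sumr_ge0 ?andbT//; apply/eqP => C0.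
have := hmK.2; rewrite esum1; first by move=> /eqP; rewrite eq_sym onee_eq0.
move=> k _; congr EFin; rewrite /harmonic_measure big1// => x _.
(* The inverse of 0 is 0 by convention, so a zero capacity would make all the masses vanish. *)
by rewrite C0 invr0 mulr0 mul0r.
Qed.

Lemma BCap_harmonic k :
  BCap P W K * harmonic_measure P W k = \sum_(x <- K) hit x k.
Proof.
rewrite /harmonic_measure mulr_sumr; apply: eq_bigr => x _.
rewrite /cond_prob -[fine (P (past_avoids W K x))]/(Es P W K x).
have C0 := BCap_gt0.
(* If the conditioning event is null the term vanishes, and so does the joint probability, which is
   smaller. *)
have [e0|e0] := eqVneq (Es P W K x) 0.
  rewrite e0 !mul0r mulr0; apply/eqP; rewrite eq_le -[X in _ && X]/(hit x k <= 0).
  by rewrite hit0/= -e0 hit_Es.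
by field; rewrite e0 gt_eqF.
Qed.

Let sum_hit (f : point_measure K -> R) : (forall k, 0 <= f k) ->
  (\esum_(k in [set: point_measure K]) (BCap P W K * harmonic_measure P W k * f k)%:E =
   \sum_(x <- K) \esum_(k in [set: point_measure K]) (hit x k * f k)%:E)%E.
Proof.
move=> f0; rewrite -esum_sum; last by move=> k x _ _; rewrite lee_fin mulr_ge0.
by apply: eq_esum => k _; rewrite sumEFin BCap_harmonic mulr_suml.
Qed.

(** Bookkeeping of mass: since the harmonic measure has total mass one, the deficits of
    [entering_total] sum to 0 over K, and being nonnegative each of them is 0. *)
Lemma entering_finite x : x \in K ->
  P.-negligible (past_avoids W K x `&` [set w | forall k : point_measure K, ~ entering_measure_is W x k w]).
Proof.
move=> xK; set D := fun x => past_avoids W K x `&` [set w | forall k : point_measure K, ~ entering_measure_is W x k w].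
have mD z : measurable (D z).
  apply: measurableI; first exact: past_avoids_measurable hW _ _.
  by apply: pmeas_forall => k; apply: pmeas_not; exact: entering_measurable hW _ _ _.
have PD z : P (D z) = (fine (P (D z)))%:E by rewrite fineK// fin_num_measure.
have tot z : ((Es P W K z)%:E = (fine (P (D z)))%:E + \esum_(k in [set: point_measure K]) (hit z k)%:E)%E.
  rewrite -PD -(entering_total hW); rewrite /Es fineK// fin_num_measure//.
  exact: past_avoids_measurable hW _ _.
have e1 : ((BCap P W K)%:E = \sum_(z <- K) \esum_(k in [set: point_measure K]) (hit z k)%:E)%E.
  have := sum_hit (fun=> ler01).
  under eq_esum do rewrite mulr1 mulrC.
  rewrite esum_pmfZ//; last exact: ltW BCap_gt0.
  by move=> ->; apply: eq_bigr => z _; under eq_esum do rewrite mulr1.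
have e2 : ((BCap P W K)%:E = \sum_(z <- K) (fine (P (D z)))%:E + (BCap P W K)%:E)%E.
  rewrite {2}e1 -big_split/= /BCap -sumEFin; apply: eq_bigr => z _; exact: tot.
have {}e2 : \sum_(z <- K) fine (P (D z)) = 0.
  by move: e2; rewrite sumEFin -EFinD => -[]; lra.
apply/negligibleP; first exact: (mD x).
apply: (etrans (PD x)); congr EFin.
move/eqP: e2; rewrite psumr_eq0; last by move=> z _; rewrite fine_ge0.
by move=> /allP/(_ _ xK)/eqP.
Qed.

Lemma generating_harmonic B : (B `<=` K)%fset ->
  BCap P W K * pmf_mean (harmonic_measure P W (K := K))
    (fun k => \prod_(y : K) gB B (val y) ^+ k y) =
  \sum_(x <- K) gB B x * escape theta (spine_rate theta m K (gB K) (gB B)) x.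
Proof.
move=> BK; set f := fun k : point_measure K => _.
have f01 k : 0 <= f k <= 1.
  by apply: prod01 => y; apply: expr01; exact: (avoid01 htheta hm hnu).
have f0 k : 0 <= f k by have /andP[] := f01 k.
have C0 := ltW BCap_gt0.
have [D fD] : bounded_ge0 f by exact: bounded_ge0_01.
rewrite -(pmf_meanZ hmK C0 (ex_intro _ D fD)).
apply: EFin_inj; rewrite -pmf_meanE//; last first.
  by exists (BCap P W K) => k; have /andP[h0 h1] := f01 k; rewrite mulr_ge0//= ler_piMr.
transitivity (\esum_(k in [set: point_measure K]) (BCap P W K * harmonic_measure P W k * f k)%:E)%E.
  by apply: eq_esum => k _; congr EFin; ring.
rewrite (sum_hit f0) -sumEFin !big_seq; apply: eq_bigr => x xK.
exact: (entering_generating htheta hW hk0 BK xK (entering_finite xK)).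
Qed.

Lemma BCap_generating B : (B `<=` K)%fset ->
  BCap P W K * (1 - pmf_mean (harmonic_measure P W (K := K))
    (fun k => \prod_(y : K) gB B (val y) ^+ k y)) = BCap P W B.
Proof.
move=> BK; rewrite mulrBr mulr1 generating_harmonic//.
(* The escape identity assumes B nonempty; for B empty all weights are 1 and both sides are 0. *)
have [->|B0] := eqVneq B fset0.
  rewrite {2}/BCap big_seq_fset0; apply/eqP; rewrite subr_eq0; apply/eqP.
  apply: eq_bigr => x _; rewrite (Es_escape htheta hW hk0).
  by rewrite (avoid_fset0 htheta hm hnu) mul1r.
rewrite /BCap -sumrB.
under eq_bigr do rewrite (Es_escape htheta hW hk0).
under [RHS]eq_bigr do rewrite (Es_escape htheta hW hk0).
exact: (escape_identity htheta hm hnu hk0).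
Qed.

End HarmonicMeasure.

(** * The Poissonian cloud of branching random walks *)

Lemma prod_asbool (R : realType) (T : eqType) (s : seq T) (A : T -> Prop) :
  \prod_(t <- s) (`[< A t >]%:R : R) = `[< forall t, t \in s -> A t >]%:R.
Proof.
elim: s => [|t s ih].
  by rewrite big_nil asboolT// => t; rewrite in_nil.
rewrite big_cons ih -natrM mulnb; congr (_%:R); congr (nat_of_bool _).
apply/idP/idP.
  by move=> /andP[/asboolP h /asboolP h']; apply/asboolP => t'; rewrite inE => /predU1P[->//|/h'].
move=> /asboolP h; apply/andP; split; apply/asboolP; first by apply: h; rewrite inE eqxx.
by move=> t' ts; apply: h; rewrite inE ts orbT.
Qed.

Lemma lim_bush_val (R : realType) (d : nat) (W : gw_walk d) (B : {fset site d}) y :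
  lim (bush_val B (fun=> 0) 1 (gw_nchild W) (gw_step W) n y [::] @[n --> \oo]) =
  `[< gw_range W y `&` [set` B] = set0 >]%:R :> R.
Proof.
apply: cvg_lim => //.
have [h|/eqP/set0P[z [[u tu <-] /= uB]]] := pselect (gw_range W y `&` [set` B] = set0).
  rewrite asboolT//; apply: cvg_near_cst; apply: nearW => n.
  rewrite bush_valE big1_seq//= => u /first_hitsP[_ [tu uB _]].
  exfalso; suff : (gw_range W y `&` [set` B]) (position y (gw_step W) u) by rewrite h.
  by split=> //; exists u.
rewrite asboolF; last first.
  move=> e; suff : (gw_range W y `&` [set` B]) (position y (gw_step W) u) by rewrite e.
  by split=> //; exists u.
have [k [hk sk]] := first_hit_exists tu uB.
apply: cvg_near_cst; exists (size u).+1 => // n /= un.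
rewrite bush_valE; apply/eqP; rewrite prodf_seq_eq0; apply/hasP; exists (take k u).
  by apply/first_hitsP; split=> //; exact: leq_ltn_trans sk un.
by rewrite eqxx.
Qed.

Lemma integral_asbool (R : realType) (dO : measure_display) (Om : measurableType dO)
    (P : probability Om R) (A : set Om) :
  measurable_fun setT (fun w => `[< A w >]%:R : R) ->
  measurable A /\ (P A = \int[P]_w (`[< A w >]%:R)%:E)%E.
Proof.
move=> mf; have mA : measurable A.
  have -> : A = (fun w => `[< A w >]%:R : R) @^-1` [set 1].
    apply/seteqP; split=> w /=; first by move=> h; rewrite asboolT.
    have [//|n] := pselect (A w); rewrite asboolF// => /eqP.
    by rewrite eq_sym oner_eq0.
  by rewrite -[_ @^-1` _]setTI; exact: mf.
split=> //; rewrite -[X in P X]setIT -integral_indic//.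
Qed.

Lemma poisson_generating (R : realType) (rate q : R) : 0 < rate -> 0 <= q ->
  (\esum_(n in [set: nat]) (poisson_pmf rate n * q ^+ n)%:E = (expR (- (rate * (1 - q))))%:E)%E.
Proof.
move=> r0 q0; rewrite -nneseries_esumT; last first.
  by move=> n; rewrite lee_fin mulr_ge0 ?poisson_pmf_ge0 ?exprn_ge0.
under eq_eseriesr => n _.
  rewrite /poisson_pmf r0 (_ : _ * _ = expR (- rate) * ((rate * q) ^+ n * n`!%:R^-1)); last first.
    by rewrite exprMn; ring.
  rewrite EFinM; over.
rewrite nneseriesZl; last first.
  by move=> n _; rewrite lee_fin divr_ge0// exprn_ge0// mulr_ge0// ltW.
rewrite (_ : - (rate * (1 - q)) = - rate + rate * q); last by ring.
rewrite expRD EFinM; congr (_ * _)%E; rewrite expRE -EFin_lim; last first.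
  rewrite /pseries/=; under eq_fun do rewrite mulrC.
  exact: is_cvg_series_exp_coeff.
apply/congr_lim/funext => n/=; rewrite /pseries/= /series/= -sumEFin//.
by under eq_bigr do rewrite mulrC.
Qed.

Section PoissonianWalks.
Context (R : realType) (dO : measure_display) (Om : measurableType dO).
Variables (P : probability Om R) (d : nat) (mu : probability nat R).
Variables (theta : {fsfun site d -> R with 0}) (K : {fset site d}).
Variables (mK : point_measure K -> R) (rate : R).
Variables (N : Om -> nat) (X : nat -> Om -> brw K).
Hypothesis htheta : step_distribution theta.
Hypothesis hX : indep_poisson_iid_brw mu theta mK rate P N X.
Hypothesis hm : is_pmf (mass mu).
Hypothesis hnu : is_pmf (bush_pmf (mass mu)).
Variable B : {fset site d}.

Local Notation m := (mass mu).
Local Notation gB := (avoid_prob theta m B).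
Local Notation key := (unit + nat + nat * K * nat * vertex + nat * K * nat * vertex)%type.

Let F (s : key) : set (set Om) :=
  match s with
  | inl (inl (inl _)) => events_of N
  | inl (inl (inr j)) => events_of (fun w => initial (X j w))
  | inl (inr (j, y, i, v)) =>
      events_of (fun w => gw_nchild (walk_at (X j w) y i) v)
  | inr (j, y, i, v) =>
      events_of (fun w => gw_step (walk_at (X j w) y i) v)
  end.

Let FT s : F s setT.
Proof.
by case: s => [[[?|j]|[[[j y] i] v]]|[[[j y] i] v]]; exact: events_ofT.
Qed.

Let FI s : setI_closed (F s).
Proof.
by case: s => [[[?|j]|[[[j y] i] v]]|[[[j y] i] v]]; exact: events_ofI.
Qed.

Let Fm s A : F s A -> measurable A.
Proof.
have [h1 h2 h3 h4 _] := hX.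
by case: s => [[[?|j]|[[[j y] i] v]]|[[[j y] i] v]]; [exact: events_of_measurable h1
  |exact: events_of_measurable (h2 j)|exact: events_of_measurable (h3 j y i v)
  |exact: events_of_measurable (h4 j y i v)].
Qed.

Let indepF : mutually_independent P F. Proof. by case: hX. Qed.

Let ic j y i v : key := inl (inr (j, y, i, v)).
Let is_ j y i v : key := inr (j, y, i, v).

Let walk_keys j y i : set key := [set s | exists v, s = ic j y i v \/ s = is_ j y i v].

Let walk_keys_disjoint j y i j' y' i' : (j, y, i) != (j', y', i') ->
  walk_keys j y i `&` walk_keys j' y' i' = set0.
Proof.
move=> /eqP ne; apply/seteqP; split=> // s [[v h] [v' h']]; apply: ne.
by case: h h' => -> [] // [-> -> ->].
Qed.

Let miss j y i w : R :=
  `[< gw_range (walk_at (X j w) y i) (val y) `&` [set` B] = set0 >]%:R.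

Let zero01 (z : site d) : (0 <= 0 :> R) && (0 <= 1 :> R). Proof. by rewrite ler01 lexx. Qed.
Let one01 : (0 <= 1 :> R) && (1 <= 1 :> R). Proof. by rewrite ler01 lexx. Qed.

Let bush j y i n w : R := bush_var (fun v w => gw_nchild (walk_at (X j w) y i) v)
  (fun v w => gw_step (walk_at (X j w) y i) v) B (fun=> 0) 1 n (val y) [::] w.

Let adapted_walk j y i n : adapted F (walk_keys j y i) (bush j y i n).
Proof.
apply: (@adaptedS _ _ _ _ F (bush_keys (ic j y i) (is_ j y i) [::])).
  by move=> s [v _ [->|[-> _]]]; exists v; [left|right].
exact (@adapted_bush R dO Om _ F d (fun v w => gw_nchild (walk_at (X j w) y i) v)
  (fun v w => gw_step (walk_at (X j w) y i) v) (ic j y i) (is_ j y i)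
  (fun=> erefl) (fun=> erefl) B (fun=> 0) 1 n (val y) [::]).
Qed.

Let integral_walk j y i n :
  (\int[P]_w (bush j y i n w)%:E = (stopped_gf theta m B (fun=> 0) 1 n (val y))%:E)%E.
Proof.
have [h1 h2 h3 h4 _] := hX.
apply: (integral_bush FT FI Fm indepF (ic := ic j y i) (is_ := is_ j y i)) => //.
- by move=> v v' [].
- by move=> v v' [].
Qed.

Let bush01 j y i n w : 0 <= bush j y i n w <= 1.
Proof. by apply: bush_var01. Qed.

Let bush_decr j y i n w : bush j y i n.+1 w <= bush j y i n w.
Proof. by apply: bush_val_decr. Qed.

Let bush_cvg j y i w : bush j y i n w @[n --> \oo] --> miss j y i w.
Proof.
rewrite /miss -lim_bush_val.
have [] // := @nonincreasing_lim _ (fun n => bush j y i n w).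
by move=> n; have /andP[] := bush01 j y i n w.
Qed.

(** Avoiding B altogether is a pointwise limit of the functionals of depth n, so it depends only on
    the variables of this one walk. *)
Let adapted_miss j y i : adapted F (walk_keys j y i) (miss j y i).
Proof.
apply: (@measurable_fun_cvg _ (g_sigma_algebraType (cylinder F (walk_keys j y i))) R
  setT (bush j y i) (miss j y i)) => [n|w _]; [exact: adapted_walk|exact: bush_cvg].
Qed.

Let integral_miss j y i : (\int[P]_w (miss j y i w)%:E = (gB (val y))%:E)%E.
Proof.
have [|||||_ <-] := @integral_decreasing_lim _ _ _ P (bush j y i)
    (fun n => stopped_gf theta m B (fun=> 0) 1 n (val y)) (gB (val y)).
- by move=> n; exact: (@adapted_measurable _ _ _ _ F Fm _ _ (@adapted_walk j y i n)).
- by move=> n w; exact: bush01.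
- by move=> n w; exact: bush_decr.
- by move=> n; exact: integral_walk.
- exact: avoid_cvg.
by apply: eq_integral => w _; congr EFin; apply/esym/cvg_lim.
Qed.

Let miss01 j y i w : 0 <= miss j y i w <= 1.
Proof. by rewrite /miss; case: asbool; rewrite ?ler01 ?lexx. Qed.

Let config_miss j (k : point_measure K) w : R :=
  \prod_(y : K) \prod_(i <- iota 0 (k y)) miss j y i w.

Let config_keys j : set key := \bigcup_y \bigcup_i walk_keys j y i.

Let adapted_config j k : adapted F (config_keys j) (config_miss j k).
Proof.
apply: adapted_prod => y; apply: adapted_prod => i.
by apply: adaptedS (@adapted_miss j y i) => s hs; exists y => //; exists i.
Qed.

Let config_miss01 j k w : 0 <= config_miss j k w <= 1.
Proof. by apply: prod01 => y; apply: prod01 => i. Qed.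

Let integral_config j k :
  (\int[P]_w (config_miss j k w)%:E = (\prod_(y : K) gB (val y) ^+ k y)%:E)%E.
Proof.
rewrite (integral_prod_indep FT FI Fm indepF (J_ := fun y => \bigcup_i walk_keys j y i)
  (f := fun y w => \prod_(i <- iota 0 (k y)) miss j y i w)).
- rewrite -prodEFin; apply: eq_bigr => y _.
  rewrite (integral_prod_indep FT FI Fm indepF (J_ := walk_keys j y) (f := miss j y)).
  + under eq_bigr do rewrite integral_miss.
    by rewrite prodEFin_cst size_iota.
  + exact: iota_uniq.
  + move=> i i' _ _ ii; apply: walk_keys_disjoint.
    by apply: contraNneq ii => -[->].
  + exact: adapted_miss.
  + by move=> i w; have /andP[] := miss01 j y i w.
- exact: index_enum_uniq.
- move=> y y' _ _ yy; apply/seteqP; split=> // s [[i _ hi] [i' _ hi']].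
  suff : (walk_keys j y i `&` walk_keys j y' i') s.
    by rewrite walk_keys_disjoint//; apply: contraNneq yy => -[->].
  by [].
- move=> y; apply: adapted_prod => i.
  by apply: adaptedS (@adapted_miss j y i) => s hs; exists i.
- by move=> y w; have /andP[] := prod01 (iota 0 (k y)) (fun i => miss01 j y i w).
Qed.

Let avoids j w : R := `[< brw_range (X j w) `&` [set` B] = set0 >]%:R.

Let avoidsE j w : avoids j w = config_miss j (initial (X j w)) w.
Proof.
rewrite /config_miss; under eq_bigr => y _ do rewrite prod_asbool.
rewrite prod_asbool; congr (_%:R); congr (nat_of_bool _); apply/idP/idP => /asboolP h; apply/asboolP.
  move=> y _ i; rewrite mem_iota/= add0n => ik; apply/seteqP; split=> // z [hz zB].
  by rewrite -h; split=> //; exists y, i.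
apply/seteqP; split=> // z [[y [i [ik hz]]] zB].
by rewrite -(h y (mem_index_enum _) i) ?mem_iota.
Qed.

Let brw_keys j : set key := [set s | s = inl (inl (inr j)) \/ config_keys j s].

Let sigma_initial (J : set key) j a : J (inl (inl (inr j))) ->
  sigma_of F J ((fun w => initial (X j w)) @^-1` [set a]).
Proof. by move=> Jj; apply: (@sigma_of_gen _ _ _ F J (inl (inl (inr j)))) => //; exists [set a]. Qed.

Let adapted_avoids j : adapted F (brw_keys j) (avoids j).
Proof.
have -> : avoids j = fun w => config_miss j (initial (X j w)) w.
  by apply/funext => w; exact: avoidsE.
apply: (adapted_bind (G := config_miss j) (Z := fun w => initial (X j w))).
  by move=> k; apply: sigma_initial; left.
by move=> k; apply: adaptedS (@adapted_config j k) => s hs; right.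
Qed.

Let q := pmf_mean mK (fun k => \prod_(y : K) gB (val y) ^+ k y).

Let integral_avoids j : (\int[P]_w (avoids j w)%:E = q%:E)%E.
Proof.
under eq_integral do rewrite avoidsE.
apply: (integral_bind_indep_real FT FI Fm indepF (J := [set inl (inl (inr j))])
  (J' := config_keys j) (G := config_miss j) (Z := fun w => initial (X j w))).
- by apply/seteqP; split=> // s /= [-> [y _ [i _ [v []]]]].
- by move=> k; exact: sigma_initial.
- by move=> k; have [_ h _ _ _] := hX; have [_ ->] := h j.
- exact: adapted_config.
- exact: config_miss01.
- exact: integral_config.
Qed.

Let brw_keys_disjoint j j' : j != j' -> brw_keys j `&` brw_keys j' = set0.
Proof.
move=> /eqP jj; apply/seteqP; split=> // s [h h']; apply: jj.
by case: h h' => [->|[y _ [i _ [v [->|->]]]]] [|[y' _ [i' _ [v' []]]]] // [].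
Qed.

Lemma poissonian_avoids : 0 < rate ->
  measurable [set w | (\bigcup_(j < N w) brw_range (X j w)) `&` [set` B] = set0] /\
  P [set w | (\bigcup_(j < N w) brw_range (X j w)) `&` [set` B] = set0] =
    (expR (- (rate * (1 - q))))%:E.
Proof.
move=> rate0; set A := [set w | _].
have AE w : `[< A w >]%:R = \prod_(j <- iota 0 (N w)) avoids j w :> R.
  rewrite prod_asbool; congr (_%:R); congr (nat_of_bool _); apply/idP/idP => /asboolP h; apply/asboolP.
    move=> j; rewrite mem_iota/= add0n => jN; apply/seteqP; split=> // z [hz zB].
    by rewrite -h; split=> //; exists j.
  apply/seteqP; split=> // z [[j jN hz] zB].
  by rewrite -(h j) ?mem_iota.
have ad n : adapted F (\bigcup_j brw_keys j) (fun w => \prod_(j <- iota 0 n) avoids j w).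
  by apply: adapted_prod => j; apply: adaptedS (@adapted_avoids j) => s hs; exists j.
have sN (J : set key) n : J (inl (inl (inl tt))) -> sigma_of F J (N @^-1` [set n]).
  by move=> Jt; apply: (@sigma_of_gen _ _ _ F J (inl (inl (inl tt)))) => //; exists [set n].
have avoids01 j w : 0 <= avoids j w <= 1.
  by rewrite /avoids; case: asbool; rewrite ?ler01 ?lexx.
have q0 : 0 <= q.
  rewrite -lee_fin -(integral_avoids 0) integral_ge0// => w _.
  by rewrite lee_fin; have /andP[] := avoids01 0%N w.
have [|mA ->] := @integral_asbool R _ _ P A.
  under eq_fun do rewrite AE.
  apply: (@adapted_measurable _ _ _ _ F Fm setT).
  apply: (adapted_bind (Z := N) (G := fun n w => \prod_(j <- iota 0 n) avoids j w)).
    by move=> n; exact: sN.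
  by move=> n; apply: adaptedS (ad n).
split=> //; under eq_integral do rewrite AE.
rewrite (integral_bind_indep_real FT FI Fm indepF (J := [set inl (inl (inl tt))])
  (J' := \bigcup_j brw_keys j) (Z := N)
  (G := fun n w => \prod_(j <- iota 0 n) avoids j w) (p := poisson_pmf rate) (g := fun n => q ^+ n)).
- by rewrite /pmf_mean poisson_generating.
- by apply/seteqP; split=> // s /= [-> [j _ [|[y _ [i _ [v []]]]]]].
- by move=> n; exact: sN.
- by move=> n; have [[_ ->] _ _ _ _] := hX.
- by [].
- by move=> n w; apply: prod01.
move=> n; rewrite (integral_prod_indep FT FI Fm indepF (J_ := brw_keys) (f := avoids)).
- under eq_bigr do rewrite integral_avoids.
  by rewrite prodEFin_cst size_iota.
- exact: iota_uniq.
- by move=> j j' _ _; exact: brw_keys_disjoint.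
- exact: adapted_avoids.
- by move=> j w; have /andP[] := avoids01 j w.
Qed.

End PoissonianWalks.

(** * Void probabilities *)

(** Events with prescribed visits and prescribed misses: dropping one visit expresses such an event
    as a difference of two events with fewer visits, which leads down to void events. *)
Definition covers_misses (T : choiceType) (Om : Type) (Z : Om -> set T) (s : seq T)
    (C : {fset T}) : set Om :=
  [set w | (forall x, x \in s -> Z w x) /\ Z w `&` [set` C] = set0].

Lemma covers_misses_cons (T : choiceType) (Om : Type) (Z : Om -> set T) x s C :
  covers_misses Z (x :: s) C =
  covers_misses Z s C `\` covers_misses Z s (x |` C)%fset.
Proof.
apply/seteqP; split=> w [].
  move=> hs hC; split; first by split=> // z zs; apply: hs; rewrite inE zs orbT.
  move=> [_ h]; suff : (Z w `&` [set` (x |` C)%fset]) x by rewrite h.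
  by split; [apply: hs; rewrite inE eqxx|rewrite /= !inE eqxx].
move=> [hs hC] n; split=> // z; rewrite inE => /predU1P[->|]; last exact: hs.
apply: contrapT => nx; apply: n; split=> //; apply/seteqP; split=> // t [Zt].
rewrite /= !inE => /predU1P[tx|tC]; first by rewrite tx in Zt.
by suff : set0 t by []; rewrite -hC.
Qed.

Section VoidProbabilities.
Context (R : realType) (T : choiceType).
Context (d1 : measure_display) (Om1 : measurableType d1) (P1 : probability Om1 R).
Context (d2 : measure_display) (Om2 : measurableType d2) (P2 : probability Om2 R).
Variables (Z1 : Om1 -> set T) (Z2 : Om2 -> set T) (K : {fset T}).
Hypothesis mZ1 : forall B, (B `<=` K)%fset -> measurable [set w | Z1 w `&` [set` B] = set0].
Hypothesis mZ2 : forall B, (B `<=` K)%fset -> measurable [set w | Z2 w `&` [set` B] = set0].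
Hypothesis void : forall B, (B `<=` K)%fset ->
  P1 [set w | Z1 w `&` [set` B] = set0] = P2 [set w | Z2 w `&` [set` B] = set0].

Lemma void_covers_misses s C : {subset s <= K} -> (C `<=` K)%fset ->
  [/\ measurable (covers_misses Z1 s C), measurable (covers_misses Z2 s C)
    & P1 (covers_misses Z1 s C) = P2 (covers_misses Z2 s C)].
Proof.
elim: s C => [|x s ih] C sK CK.
  have e Om (Z : Om -> set T) : covers_misses Z [::] C = [set w | Z w `&` [set` C] = set0].
    by apply/seteqP; split=> w => [[]|].
  by rewrite !e; split; [exact: mZ1|exact: mZ2|exact: void].
have sK' : {subset s <= K} by move=> z zs; apply: sK; rewrite inE zs orbT.
have xK : (x |` C `<=` K)%fset by rewrite fsubUset CK fsub1set sK// inE eqxx.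
have [m1 m2 e] := ih C sK' CK; have [m1' m2' e'] := ih _ sK' xK.
rewrite !covers_misses_cons; split; [exact: measurableD|exact: measurableD|].
have sub Om (Z : Om -> set T) : covers_misses Z s C `&` covers_misses Z s (x |` C)%fset =
    covers_misses Z s (x |` C)%fset.
  apply/setIidr => w [hs hC]; split=> //; apply/seteqP; split=> // t [Zt tC].
  suff : set0 t by []; rewrite -hC; split=> //.
  by move: tC; rewrite /= !inE => ->; rewrite orbT.
have PD dO (Om : measurableType dO) (P : probability Om R) A B :
    measurable A -> measurable B -> (P (A `\` B) = P A - P (A `&` B))%E.
  by move=> mA mB; rewrite measureD// ltey_eq fin_num_measure.
by rewrite !PD// !sub e e'.
Qed.

Lemma void_probabilities (A : set T) :
  P1 [set w | Z1 w `&` [set` K] = A] = P2 [set w | Z2 w `&` [set` K] = A].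
Proof.
(* A trace on K cannot leave K, so for any other set A both events are empty. *)
have [AK|nAK] := pselect (A `<=` [set` K]); last first.
  have e Om (Z : Om -> set T) : [set w | Z w `&` [set` K] = A] = set0.
    by apply/seteqP; split=> // w /= h; apply: nAK; rewrite -h => t [].
  by rewrite !e !measure0.
have e Om (Z : Om -> set T) : [set w | Z w `&` [set` K] = A] =
    covers_misses Z [seq x <- K | `[< A x >]] [fset x in K | ~~ `[< A x >]]%fset.
  apply/seteqP; split=> w /=.
    move=> h; split=> [x|]; first by rewrite mem_filter -h => /andP[/asboolP[]].
    apply/seteqP; split=> // x [Zx]; rewrite /= !inE -h => /andP[xK /asboolP].
    by apply.
  move=> [h1 h2]; apply/seteqP; split=> x; last first.
    move=> Ax; have xK := AK x Ax; split=> //; apply: h1.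
    by rewrite mem_filter; apply/andP; split=> //; apply/asboolP.
  move=> [Zx xK]; apply: contrapT => nA.
  suff : set0 x by []; rewrite -h2; split=> //; rewrite /= !inE.
  by apply/andP; split=> //; apply/asboolP.
rewrite !e; have [||_ _ ->//] := @void_covers_misses [seq x <- K | `[< A x >]] [fset x in K | ~~ `[< A x >]]%fset.
- by move=> x; rewrite mem_filter => /andP[].
- by apply/fsubsetP => x; rewrite !inE => /andP[].
Qed.

End VoidProbabilities.

Theorem proposition2 (R : realType) (d : nat) (hd : (5 <= d)%N)
  (mu : probability nat R) (hmu : critical_offspring mu)
  (theta : {fsfun site d -> R with 0}) (htheta : step_distribution theta)
  (* a realization of the walk indexed by T^v *)
  (d1 : measure_display) (Om1 : measurableType d1) (P1 : probability Om1 R)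
  (W : Om1 -> vtree_walk d) (hW : is_vtree_walk mu theta P1 W)
  (u : R) (hu : 0 < u) (K : {fset site d}) (hK : K != fset0)
  (* N_K and the i.i.d. branching random walks; X j stands for X^(j+1) *)
  (d2 : measure_display) (Om2 : measurableType d2) (P2 : probability Om2 R)
  (N : Om2 -> nat) (X : nat -> Om2 -> brw K)
  (hX : indep_poisson_iid_brw mu theta (harmonic_measure P1 W (K := K))
          (u * BCap P1 W K) P2 N X)
  (* the branching interlacement at level u *)
  (d3 : measure_display) (Om3 : measurableType d3) (P3 : probability Om3 R)
  (I : Om3 -> set (site d))
  (hI : is_branching_interlacement (BCap P1 W) u P3 I) :
  forall A : set (site d),
    P2 [set w | [set` K] `&` \bigcup_(j < N w) brw_range (X j w) = A] =
    P3 [set w | I w `&` [set` K] = A].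
Proof.
move=> A.
have hm := mass_is_pmf hW; have hnu := bush_pmf_is_pmf hW.
have [k0 hk0] := offspring_two_children hmu hm hnu.
(* By [hX] the harmonic measure is the law of an actual random variable, hence of total mass one. *)
have hmK : is_pmf (harmonic_measure P1 W (K := K)).
  by case: hX => _ h _ _ _; exact: is_pmf_law (h 0%N).
have rate0 : 0 < u * BCap P1 W K by rewrite mulr_gt0// BCap_gt0.
have [mI voidI] := hI.
transitivity (P2 [set w | (\bigcup_(j < N w) brw_range (X j w)) `&` [set` K] = A]).
  by congr (P2 _); apply/seteqP; split=> w /=; rewrite setIC.
apply: void_probabilities => B BK.
- by have [] := poissonian_avoids htheta hX hm hnu B rate0.
- apply: (@pmeas_ext _ _ (fun w => forall z, z \in B -> ~ I w z)).
    move=> w; split=> [h|h z zB Iz].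
      by apply/seteqP; split=> // z [Iz zB]; exact: (h z zB Iz).
    by suff : (I w `&` [set` B]) z by rewrite h.
  apply: pmeas_forall => z; apply: pmeas_imply; first exact: pmeas_cst.
  by apply: pmeas_not; exact: mI.
have [_ ->] := poissonian_avoids htheta hX hm hnu B rate0.
by rewrite voidI -mulrA (BCap_generating htheta hW hk0 hmK BK).
Qed.
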